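(* The existence of rational invariants, of decoupling functions and of an invariant lemma (all three notions are defined in the context) yields new and uniform proofs of the algebraicity of the generating function $Q(x,y;t)$ for the following three of the four unweighted models Kreweras, reverse Kreweras, double Kreweras, Gessel (the reverse Kreweras model, with steps $(0,1),(-1,-1),(1,0)$, is excepted): (a) Kreweras: steps $(1,1),(-1,0),(0,-1)$; (b) double Kreweras: steps $(0,-1),(1,1),(-1,0),(0,1),(-1,-1),(1,0)$; (c) Gessel: steps $(1,0),(1,1),(-1,0),(-1,-1)$. This extends to the following four weighted models (step : weight): (d) $(-1,0):1,\ (-1,-1):1,\ (0,-1):\lambda,\ (1,-1):1,\ (1,0):2,\ (1,1):1$; (e) $(-1,0):1,\ (-1,1):1,\ (0,1):2,\ (1,1):1,\ (1,0):2,\ (1,-1):1,\ (0,-1):1$; (f) $(-1,0):2,\ (-1,1):1,\ (0,1):1,\ (-1,-1):1,\ (1,0):1,\ (1,-1):1,\ (0,-1):2$; (g) $(-1,0):2,\ (-1,1):1,\ (0,1):2,\ (1,1):1,\ (1,0):1,\ (0,-1):1,\ (-1,-1):1$.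
   Context: Generating function. A quadrant model is a step set $\mathcal S\subset\{-1,0,1\}^2$, possibly with a weight $\omega_{(i,j)}$ attached to each step $(i,j)\in\mathcal S$ (all weights are $1$ in an unweighted model; in model (d), $\lambda$ denotes the weight of the step $(0,-1)$). Let $q(i,j;n)$ be the number (in the weighted case: the sum of the weights, the weight of a walk being the product of the weights of its steps) of $n$-step walks from $(0,0)$ to $(i,j)$ with steps in $\mathcal S$ that stay in the quadrant $\{(a,b): a\ge 0, b\ge 0\}$. Set $Q(x,y;t)=\sum_{i,j,n\ge0} q(i,j;n)x^iy^jt^n$. It is algebraic if it satisfies a polynomial equation with polynomial coefficients in $x$, $y$ and $t$. Kernel. The kernel is $K(x,y)=xy\big(t\sum_{(i,j)\in\mathcal S}\omega_{(i,j)}x^iy^j-1\big)$, and $Y_0,Y_1$ denote its two roots when it is seen as a polynomial in $y$. Rational invariants. A $y$-invariant of the model is a rational function $I(y)$ of $y$ and $t$ that depends on $y$ and satisfies $I(Y_0)=I(Y_1)$; $x$-invariants are defined similarly, exchanging the roles of $x$ and $y$. If $I(y)$ is a $y$-invariant, then $I(Y_0)=I(Y_1)$ is an $x$-invariant. Decoupling functions. The model is decoupled if there are rational functions $F(x)$ (in $x,t$) and $G(y)$ (in $y,t$), called decoupling functions, such that $xy=F(x)+G(y)$ as soon as $K(x,y)=0$; equivalently, $x(Y_0-Y_1)=G(Y_0)-G(Y_1)$. Invariant lemma. This is a statement, adapted to each model, saying that a series $F(y)$ in $t$ of a suitable form, with coefficients polynomial in $y$, that takes the same value at $Y_0$ and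 $Y_1$ is independent of $y$. For Gessel's model it reads: let $F(y)=\sum_{0\le j\le n+n_0}a(j,n)y^jt^{2n}$, for some $n_0\ge 0$, be a Laurent series in $t$ with coefficients in $\mathbb Q[y]$; then for $x=t+t^2(u+1/u)$, with $u$ a new variable, $F(Y_0)$ and $F(Y_1)$ are well-defined Laurent series in $t$ with coefficients in $\mathbb Q(u)$, and if they coincide then $F(y)$ is independent of $y$. The invariant lemmas for the other models are analogues of this one. *)

(* Defs.v *)
From HB Require Import structures.
From mathcomp Require Import all_boot all_order all_algebra.
From mathcomp Require Import boolp.

Set Implicit Arguments.
Unset Strict Implicit.
Unset Printing Implicit Defensive.

Import GRing.Theory.
Local Open Scope ring_scope.

Local Notation "x %:F" := (tofrac x) : ring_scope.

Record fps (R : Type) := FPS { fps_coef : nat -> R }.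

HB.instance Definition _ (R : Type) := gen_eqMixin (fps R).
HB.instance Definition _ (R : Type) := gen_choiceMixin (fps R).

Lemma fpsP (R : Type) (a b : fps R) :
  (forall n, fps_coef a n = fps_coef b n) -> a = b.
Proof. by case: a b => a [b] /= /funext ->. Qed.

Section FpsRing.
Variable R : comNzRingType.
Implicit Types a b c : fps R.

Definition fps_of_poly (p : {poly R}) : fps R := FPS (fun n => p`_n).
Definition fps_trunc N a : {poly R} := \poly_(i < N) fps_coef a i.

Definition fps_add a b := FPS (fun n => fps_coef a n + fps_coef b n).
Definition fps_opp a := FPS (fun n => - fps_coef a n).
Definition fps_mul a b :=
  FPS (fun n => \sum_(i < n.+1) fps_coef a i * fps_coef b (n - i)).

Fact fps_addA : associative fps_add.
Proof. by move=> a b c; apply: fpsP => n /=; rewrite addrA. Qed.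
Fact fps_addC : commutative fps_add.
Proof. by move=> a b; apply: fpsP => n /=; rewrite addrC. Qed.
Fact fps_add0 : left_id (fps_of_poly 0) fps_add.
Proof. by move=> a; apply: fpsP => n /=; rewrite coef0 add0r. Qed.
Fact fps_addN : left_inverse (fps_of_poly 0) fps_opp fps_add.
Proof. by move=> a; apply: fpsP => n /=; rewrite coef0 addNr. Qed.

HB.instance Definition _ :=
  GRing.isZmodule.Build (fps R) fps_addA fps_addC fps_add0 fps_addN.

Lemma coef_trunc N a i : (i < N)%N -> (fps_trunc N a)`_i = fps_coef a i.
Proof. by move=> ltiN; rewrite coef_poly ltiN. Qed.

Lemma coef_mul_trunc N a b n : (n < N)%N ->
  fps_coef (fps_mul a b) n = (fps_trunc N a * fps_trunc N b)`_n.
Proof.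
move=> ltnN; rewrite coefM /=; apply: eq_bigr => i _.
by rewrite !coef_trunc //; apply: leq_ltn_trans ltnN; rewrite ?leq_subr // -ltnS.
Qed.

Lemma coefM_eq_low (p p' q q' : {poly R}) n :
  (forall i, (i <= n)%N -> p`_i = p'`_i) ->
  (forall i, (i <= n)%N -> q`_i = q'`_i) -> (p * q)`_n = (p' * q')`_n.
Proof.
move=> pp qq; rewrite !coefM; apply: eq_bigr => i _.
by rewrite pp ?qq ?leq_subr // -ltnS.
Qed.

Fact fps_mulA : associative fps_mul.
Proof.
move=> a b c; apply: fpsP => n.
rewrite !(@coef_mul_trunc n.+1) //.
transitivity (fps_trunc n.+1 a * (fps_trunc n.+1 b * fps_trunc n.+1 c))`_n.
  apply: coefM_eq_low => // i lein.
  by rewrite coef_trunc ?(@coef_mul_trunc n.+1).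
rewrite mulrA; apply: coefM_eq_low => // i lein.
by rewrite coef_trunc ?(@coef_mul_trunc n.+1).
Qed.

Fact fps_mulC : commutative fps_mul.
Proof.
by move=> a b; apply: fpsP => n; rewrite !(@coef_mul_trunc n.+1) // mulrC.
Qed.

Fact fps_mul1 : left_id (fps_of_poly 1) fps_mul.
Proof.
move=> a; apply: fpsP => n /=.
rewrite big_ord_recl coef1 subn0 mul1r big1 ?addr0 // => i _.
by rewrite coef1 mul0r.
Qed.

Fact fps_mulDl : left_distributive fps_mul fps_add.
Proof.
move=> a b c; apply: fpsP => n /=; rewrite -big_split /=.
by apply: eq_bigr => i _; rewrite mulrDl.
Qed.

Fact fps_1neq0 : fps_of_poly 1 != 0.
Proof.
apply/eqP => /(congr1 (fun a => fps_coef a 0)) /= /eqP.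
by rewrite coef1 coef0 oner_eq0.
Qed.

HB.instance Definition _ := GRing.Zmodule_isComNzRing.Build (fps R)
  fps_mulA fps_mulC fps_mul1 fps_mulDl fps_1neq0.

Definition fps_unit : pred (fps R) := fun a => `[< exists b, b * a = 1 >].

Definition fps_inv a : fps R :=
  if pselect (exists b, b * a = 1) is left e then projT1 (cid e) else a.

Fact fps_mulV : {in fps_unit, left_inverse 1 fps_inv *%R}.
Proof.
move=> a /asboolP ua; rewrite /fps_inv.
by case: pselect => // e; case: (cid e).
Qed.

Fact fps_unitP a b : b * a = 1 -> fps_unit a.
Proof. by move=> ba1; apply/asboolP; exists b. Qed.

Fact fps_inv_out : {in [predC fps_unit], fps_inv =1 id}.
Proof.
move=> a; rewrite inE /= => /asboolP nua; rewrite /fps_inv.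
by case: pselect.
Qed.

HB.instance Definition _ := GRing.ComNzRing_hasMulInverse.Build (fps R)
  fps_mulV fps_unitP fps_inv_out.

End FpsRing.

Section FpsIdomain.
Variable R : idomainType.

Fact fps_order (a : fps R) : a != 0 ->
  exists2 m, fps_coef a m != 0 & forall i, (i < m)%N -> fps_coef a i = 0.
Proof.
move=> a_neq0; have exa : exists n, fps_coef a n != 0.
  apply: contrapT => noa; case/eqP: a_neq0; apply: fpsP => n /=.
  rewrite coef0; apply/eqP; apply: contrapT => an0.
  by apply: noa; exists n; apply/negP.
case: (ex_minnP exa) => m am0 minm; exists m => // i ltim.
by apply: contraTeq ltim => /minm; rewrite -leqNgt.
Qed.

Fact fps_integral : GRing.integral_domain_axiom (fps R).
Proof.
move=> a b ab0; apply: contraT; rewrite negb_or => /andP[a0 b0].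
have [[m am zm] [k bk zk]] := (fps_order a0, fps_order b0).
move/(congr1 (fun c => fps_coef c (m + k))): ab0; rewrite /= coef0.
have ltm : (m < (m + k).+1)%N by rewrite ltnS leq_addr.
rewrite (bigD1 (Ordinal ltm)) //= addKn big1 ?addr0 => [/eqP|i].
  by rewrite mulf_eq0 (negPf am) (negPf bk).
rewrite -val_eqE /= neq_ltn => /orP[/zm -> | ltmi]; first by rewrite mul0r.
have lei : (i <= m + k)%N by rewrite -ltnS.
by rewrite zk ?mulr0 // ltn_subLR // ltn_add2r.
Qed.

HB.instance Definition _ :=
  GRing.ComUnitRing_isIntegral.Build (fps R) fps_integral.

End FpsIdomain.

(* The step (i, j) of weight w is the triple ((i, j), w). *)
Definition wstep (F : Type) : Type := ((int * int) * F)%type.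
Definition model (F : Type) : Type := seq (wstep F).

Definition swap_model (F : Type) (S : model F) : model F :=
  [seq ((s.1.2, s.1.1), s.2) | s <- S].

Section GeneratingFunction.
Variable F : fieldType.
Implicit Types (S : model F) (w : seq (wstep F)).

Fixpoint words S (n : nat) : seq (seq (wstep F)) :=
  if n is n'.+1 then [seq s :: w | s <- S, w <- words S n'] else [:: [::]].

Definition endpoint w : int * int :=
  (\sum_(s <- w) s.1.1, \sum_(s <- w) s.1.2).

Definition in_quadrant w : bool :=
  all (fun k => (0 <= (endpoint (take k w)).1)%R
             && (0 <= (endpoint (take k w)).2)%R) (iota 0 (size w).+1).

Definition walk_count S (i j n : nat) : F :=
  \sum_(w <- words S n | in_quadrant w && (endpoint w == (i%:Z, j%:Z)))
    \prod_(s <- w) s.2.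

(* Q(x,y;t) in F[x][y][[t]]: the inner variable is x, the outer one is y.  As
   steps lie in {-1,0,1}^2, q(i,j;n) = 0 as soon as i > n or j > n. *)
Definition gen_fun S : fps {poly {poly F}} :=
  FPS (fun n => \poly_(j < n.+1) \poly_(i < n.+1) walk_count S i j n).

(* P is a polynomial with coefficients in F[x][y][t]. *)
Definition algebraic_gf (f : fps {poly {poly F}}) : Prop :=
  exists2 P : {poly {poly {poly {poly F}}}},
    P != 0 & (map_poly (@fps_of_poly {poly {poly F}}) P).[f] = 0.

End GeneratingFunction.

(* K(x,y) as a polynomial in y, for elements t, x of a ring receiving the
   weights through phi. *)
Definition kernel (F : Type) (A : comNzRingType) (phi : F -> A) (S : model F)
    (t x : A) : {poly A} :=
  \sum_(s <- S) (t * phi s.2 * x ^+ absz (1 + s.1.1)) *: 'X^(absz (1 + s.1.2))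
  - x *: 'X.

Definition kernel_roots (A : comNzRingType) (K : {poly A}) (Y0 Y1 : A) : Prop :=
  size K = 3%N /\ K = lead_coef K *: (('X - Y0%:P) * ('X - Y1%:P)).

Section Invariants.
Variable F : fieldType.

(* F(t), and rational functions in one further variable (x or y) over it. *)
Definition coefFrac : fieldType := {fraction {poly F}}.
Definition ratFrac : fieldType := {fraction {poly coefFrac}}.

Definition cst (c : coefFrac) : ratFrac := (c%:P)%:F.
Definition varFrac : ratFrac := ('X)%:F.
Definition tFrac : ratFrac := cst (('X)%:F).
Definition weightFrac (c : F) : ratFrac := cst ((c%:P)%:F).

(* The field E is an extension of F(t)(x), in which the kernel may split. *)
Section Extension.
Variables (E : fieldType) (phi : {rmorphism ratFrac -> E}).

Definition ratval (I : ratFrac) (Y v : E) : Prop :=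
  exists A B : {poly coefFrac},
    [/\ I = A%:F / B%:F,
        (map_poly (phi \o cst) B).[Y] != 0 &
        v = (map_poly (phi \o cst) A).[Y] / (map_poly (phi \o cst) B).[Y]].

Definition ext_kernel (S : model F) : {poly E} :=
  kernel (phi \o weightFrac) S (phi tFrac) (phi varFrac).

End Extension.

(* Y0 and Y1 are algebraic over F(t)(x); quantifying over all the extensions
   in which the kernel splits makes I(Y0) = I(Y1) independent of the choice of
   a particular one. *)
Definition y_invariant (S : model F) (I : ratFrac) : Prop :=
  ~ (exists c, I = cst c) /\
  forall (E : fieldType) (phi : {rmorphism ratFrac -> E}) (Y0 Y1 : E),
    kernel_roots (ext_kernel phi S) Y0 Y1 ->
    exists2 v, ratval phi I Y0 v & ratval phi I Y1 v.

Definition x_invariant (S : model F) (I : ratFrac) : Prop :=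
  y_invariant (swap_model S) I.

(* Here f is in F(t)(x), hence f(x) is the image of f in E, and g in F(t)(y). *)
Definition decoupling (S : model F) (f g : ratFrac) : Prop :=
  forall (E : fieldType) (phi : {rmorphism ratFrac -> E}) (Y : E),
    root (ext_kernel phi S) Y ->
    exists2 v, ratval phi g Y v & phi varFrac * Y = phi f + v.

Definition has_rational_invariants (S : model F) : Prop :=
  (exists I, y_invariant S I) /\ (exists J, x_invariant S J).

Definition decoupled (S : model F) : Prop := exists f g, decoupling S f g.

End Invariants.

Section InvariantLemma.
Variable F : fieldType.

Definition uFrac : fieldType := {fraction {poly F}}.

(* Laurent series in s over F(u), as the fraction field of F(u)[[s]]. *)
Definition laurent : fieldType := {fraction (fps uFrac)}.

Definition lau_cst (c : uFrac) : laurent := (fps_of_poly c%:P)%:F.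
Definition lau_weight (c : F) : laurent := lau_cst (c%:P)%:F.
Definition lau_u : laurent := lau_cst ('X)%:F.
Definition lau_s : laurent := (fps_of_poly 'X)%:F.

(* l is the sum of the series of the v k for the s-adic topology. *)
Definition lau_sum (v : nat -> laurent) (l : laurent) : Prop :=
  forall N : nat, exists M : nat, forall m : nat, (M <= m)%N ->
    exists g : fps uFrac, l - \sum_(k < m) v k = lau_s ^+ N * g%:F.

(* How the general invariant lemma is instantiated: t = s^ram, the variable x
   is specialised to xmul * t + s^xexp * (u + 1/u), and a monomial y^j t^n is
   allowed to occur when slope * j <= n + n0. *)
Record lemma_data := LemmaData { ram : nat; xmul : nat; xexp : nat; slope : nat }.

Definition lau_t (D : lemma_data) : laurent := lau_s ^+ ram D.
Definition lau_x (D : lemma_data) : laurent :=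
  (xmul D)%:R * lau_t D + lau_s ^+ xexp D * (lau_u + lau_u^-1).

(* The Laurent series in t with coefficients a n in F[y].  A bound n0 >= 0
   forces a n = 0 for n < - n0. *)
Definition admissible (D : lemma_data) (a : int -> {poly F}) (n0 : nat) : Prop :=
  forall (n : int) (j : nat), (a n)`_j != 0 -> ((slope D * j)%N%:Z <= n + n0%:Z)%R.

Definition subst_y (D : lemma_data) (a : int -> {poly F}) (n0 : nat)
    (Y l : laurent) : Prop :=
  lau_sum (fun k => (map_poly lau_weight (a (k%:Z - n0%:Z))).[Y] * lau_t D ^ (k%:Z - n0%:Z)) l.

Definition invariant_lemma (S : model F) (D : lemma_data) : Prop :=
  exists Y0 Y1 : laurent,
    kernel_roots (kernel lau_weight S (lau_t D) (lau_x D)) Y0 Y1 /\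
    forall (a : int -> {poly F}) (n0 : nat), admissible D a n0 ->
      exists l0 l1 : laurent,
        [/\ subst_y D a n0 Y0 l0, subst_y D a n0 Y1 l1 &
            l0 = l1 -> forall n, (size (a n) <= 1)%N].

End InvariantLemma.

Inductive model_name :=
  | Kreweras | DoubleKreweras | Gessel
  | WeightedD | WeightedE | WeightedF | WeightedG.

Definition steps (F : fieldType) (lambda : F) (m : model_name) : model F :=
  match m with
  | Kreweras => [:: ((1, 1), 1); ((-1, 0), 1); ((0, -1), 1)]
  | DoubleKreweras =>
      [:: ((0, -1), 1); ((1, 1), 1); ((-1, 0), 1);
          ((0, 1), 1); ((-1, -1), 1); ((1, 0), 1)]
  | Gessel => [:: ((1, 0), 1); ((1, 1), 1); ((-1, 0), 1); ((-1, -1), 1)]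
  | WeightedD =>
      [:: ((-1, 0), 1); ((-1, -1), 1); ((0, -1), lambda);
          ((1, -1), 1); ((1, 0), 2%:R); ((1, 1), 1)]
  | WeightedE =>
      [:: ((-1, 0), 1); ((-1, 1), 1); ((0, 1), 2%:R); ((1, 1), 1);
          ((1, 0), 2%:R); ((1, -1), 1); ((0, -1), 1)]
  | WeightedF =>
      [:: ((-1, 0), 2%:R); ((-1, 1), 1); ((0, 1), 1); ((-1, -1), 1);
          ((1, 0), 1); ((1, -1), 1); ((0, -1), 2%:R)]
  | WeightedG =>
      [:: ((-1, 0), 2%:R); ((-1, 1), 1); ((0, 1), 2%:R); ((1, 1), 1);
          ((1, 0), 1); ((0, -1), 1); ((-1, -1), 1)]
  end.

(* In each case the discriminant of the kernel in y is
   s^(2 xexp) (u - 1/u)^2 (1 + O(s)), and Y0, Y1 are u s^e (1 + O(s)) and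
   u^-1 s^e (1 + O(s)) with, in the order of the table,
   e = -1, -1, -1, -1, 1, 0, 0.  Every walk satisfies the degree bound of
   slope 1.  For Gessel and WeightedD, Y0^j t^n only has order n - j, so slope 2
   is needed; there (1,1) is the only step raising y, and a walk ending at x = 0
   has y <= n/2.  For Gessel, series in even powers t^(2n) with the bound
   j <= n + n0 are particular cases of admissible ones. *)
Definition lemma_data_of (m : model_name) : lemma_data :=
  match m with
  | Kreweras => LemmaData 2 1 5 1
  | DoubleKreweras => LemmaData 2 1 3 1
  | Gessel => LemmaData 1 1 2 2
  | WeightedD => LemmaData 1 1 2 2
  | WeightedE => LemmaData 2 1 3 1
  | WeightedF => LemmaData 1 2 1 1
  | WeightedG => LemmaData 1 2 1 1
  end.

(* Main.v *)
From HB Require Import structures.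
Require Import Defs.
From mathcomp Require Import all_boot all_order all_algebra.
From mathcomp Require Import generic_quotient boolp.
From mathcomp Require Import ring zify.

(* Let I(y) = A/B and J(x) be the rational invariants, equal on the curve K = 0.
   Setting K to zero in the functional equation and using the decoupling
   functions gives a second pair of invariants, m(y) and m1(x), built from
   Q(0,y) and Q(x,0).  A suitable combination of m and I of degree at most 3 in m
   and 1 in I, with coefficients depending on t only, has no pole; then it is
   equal to a series c(t).  This needs no substitution of Y0 and Y1: on the curve the
   combination P(y) agrees with its analogue N(x)/d(x) in x, so K divides
   N(x) - d(x) P(y) up to powers of y and 1 + y, and comparing the coefficients
   of lowest order in t, where K reduces to -xy, gives N(x) = d(x) P(y).
   The result is an equation Phi(m(y), I(y)) = c, still involving unknown series
   in t such as Q(0,0).  At a critical point Y(t) of I, Puiseux in t, the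
   derivative of Phi in m vanishes; the one, two or three critical points of I
   with distinct critical values give enough equations to show that these
   series are algebraic, and so are m, m1 and finally Q(x,y).
   The roots Y0, Y1 occurring in the invariant lemma itself are obtained by
   Hensel's lemma, and the lowest coefficient in s of F(Y0) - F(Y1) is a nonzero
   combination of the u^j - u^(-j) when F depends on y. *)

Set Implicit Arguments.
Unset Strict Implicit.
Unset Printing Implicit Defensive.

Import GRing.Theory.
Local Open Scope ring_scope.
Local Notation "x %:F" := (tofrac x) : ring_scope.

(** * Formal power series *)

Arguments fps_coef : simpl never.

(** Differentiating Phi(m(y), I(y)) = c in y at a critical point Y of I leaves the derivative of Phi
    in m times m'(Y). The second factor is nonzero: its numerator reduces at t = 0 to an explicit
    nonzero value, free of Q(0,y). Each critical point adds one unknown, the value of m, and two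
    equations, the relation and its derivative. A model thus needs as many critical points as it has
    unknown constants, and these are read off at the poles of m = dec_num / dec_den + dec_scale
    K(0,y) Q(0,y) and of I. For Kreweras, (d) and (e), K(0,y) vanishes at the poles of m, so that
    the polar part of m^2 is explicit and only c is unknown. For double Kreweras and (f), m has a
    pole at y = 0 where K(0,y) does not vanish: Q(0,0) enters and there are two unknowns. For Gessel
    and (g) the product I m has a triple pole, which calls for a cubic in m and leaves three
    unknowns. *)

Lemma fps_coefE (T : Type) (a : nat -> T) n : fps_coef (FPS a) n = a n.
Proof. by []. Qed.

Section FpsCoef.
Variable R : comNzRingType.
Implicit Types (a b : fps R) (p : {poly R}).

Lemma fps_coefD a b n : fps_coef (a + b) n = fps_coef a n + fps_coef b n.
Proof. by []. Qed.

Lemma fps_coefB a b n : fps_coef (a - b) n = fps_coef a n - fps_coef b n.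
Proof. by []. Qed.

Lemma fps_coef0 n : fps_coef (0 : fps R) n = 0.
Proof. exact: coef0. Qed.

Lemma fps_coef1 n : fps_coef (1 : fps R) n = (n == 0)%:R.
Proof. by rewrite [LHS]coef1. Qed.

Lemma fps_coefM a b n :
  fps_coef (a * b) n = \sum_(i < n.+1) fps_coef a i * fps_coef b (n - i).
Proof. by []. Qed.

Lemma fps_coef_sum (I : Type) (r : seq I) (P : pred I) (f : I -> fps R) n :
  fps_coef (\sum_(i <- r | P i) f i) n = \sum_(i <- r | P i) fps_coef (f i) n.
Proof.
by elim/big_rec2: _ => [|i x y _ <-]; rewrite ?fps_coef0 ?fps_coefD.
Qed.

Fact fps_of_poly_is_zmod : zmod_morphism (@fps_of_poly R).
Proof. by move=> p q; apply: fpsP => n; rewrite fps_coefB !fps_coefE coefB. Qed.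

Fact fps_of_poly_is_monoid : monoid_morphism (@fps_of_poly R).
Proof. by split=> // p q; apply: fpsP => n; rewrite fps_coefM fps_coefE coefM. Qed.

HB.instance Definition _ :=
  GRing.isZmodMorphism.Build {poly R} (fps R) (@fps_of_poly R)
    fps_of_poly_is_zmod.
HB.instance Definition _ :=
  GRing.isMonoidMorphism.Build {poly R} (fps R) (@fps_of_poly R)
    fps_of_poly_is_monoid.

Definition fpsC (c : R) : fps R := fps_of_poly c%:P.

Fact fpsC_is_zmod : zmod_morphism fpsC.
Proof. by move=> p q; rewrite /fpsC polyCB rmorphB. Qed.

Fact fpsC_is_monoid : monoid_morphism fpsC.
Proof. by split=> [|p q]; rewrite /fpsC ?polyC1 ?rmorph1 // polyCM rmorphM. Qed.

HB.instance Definition _ := GRing.isZmodMorphism.Build R (fps R) fpsC fpsC_is_zmod.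
HB.instance Definition _ :=
  GRing.isMonoidMorphism.Build R (fps R) fpsC fpsC_is_monoid.

Lemma fps_coefC c n : fps_coef (fpsC c) n = if n == 0 then c else 0.
Proof. exact: coefC. Qed.

Lemma fps_coefCM c a n : fps_coef (fpsC c * a) n = c * fps_coef a n.
Proof.
rewrite fps_coefM big_ord_recl fps_coefC subn0 big1 ?addr0 // => i _.
by rewrite fps_coefC mul0r.
Qed.

Definition fpsX : fps R := fps_of_poly 'X.

Lemma fps_coefXnM k a n :
  fps_coef (fpsX ^+ k * a) n = if (n < k)%N then 0 else fps_coef a (n - k).
Proof.
rewrite -rmorphXn (@coef_mul_trunc _ n.+1) //.
have -> : (fps_trunc n.+1 (fps_of_poly 'X^k) * fps_trunc n.+1 a)`_n
          = ('X^k * fps_trunc n.+1 a)`_n.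
  by apply: coefM_eq_low => // i lein; rewrite coef_trunc.
rewrite coefXnM; case: ltnP => // lekn.
by rewrite coef_trunc // ltnS leq_subr.
Qed.

Lemma fps_coefXM a n :
  fps_coef (fpsX * a) n = if n is n'.+1 then fps_coef a n' else 0.
Proof. by rewrite -[fpsX]expr1 fps_coefXnM; case: n => // n; rewrite subn1. Qed.

Lemma fps_coefX n : fps_coef fpsX n = (n == 1)%:R.
Proof. exact: coefX. Qed.

Lemma fpsX_neq0 : fpsX != 0.
Proof.
apply/eqP => /(congr1 (fun a => fps_coef a 1)) /eqP.
by rewrite fps_coefX fps_coef0 oner_eq0.
Qed.

Definition fps_shift k a : fps R := FPS (fun n => fps_coef a (n + k)).

Lemma fps_shiftK k a :
  (forall i, (i < k)%N -> fps_coef a i = 0) -> a = fpsX ^+ k * fps_shift k a.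
Proof.
move=> a0; apply: fpsP => n; rewrite fps_coefXnM.
by case: ltnP => [/a0|lekn] //; rewrite fps_coefE subnK.
Qed.

Definition fps_head a : R := fps_coef a 0.

Fact fps_head_is_zmod : zmod_morphism fps_head.
Proof. by []. Qed.

Fact fps_head_is_monoid : monoid_morphism fps_head.
Proof.
by split=> [|a b]; rewrite /fps_head ?fps_coef1 // fps_coefM big_ord1 subnn.
Qed.

HB.instance Definition _ :=
  GRing.isZmodMorphism.Build (fps R) R fps_head fps_head_is_zmod.
HB.instance Definition _ :=
  GRing.isMonoidMorphism.Build (fps R) R fps_head fps_head_is_monoid.

Lemma fps_headX : fps_head fpsX = 0.
Proof. by rewrite /fps_head fps_coefX. Qed.

Lemma fps_headC c : fps_head (fpsC c) = c.
Proof. by rewrite /fps_head fps_coefC. Qed.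

Lemma fps_head_eq0 a : fps_head a = 0 -> exists b, a = fpsX * b.
Proof.
move=> a0; exists (fps_shift 1 a); rewrite -[fpsX]expr1.
by apply: fps_shiftK => -[|].
Qed.

Lemma fps_coefM_low m k a b :
    (forall i, (i < m)%N -> fps_coef a i = 0) ->
    (forall i, (i < k)%N -> fps_coef b i = 0) ->
  fps_coef (a * b) (m + k) = fps_coef a m * fps_coef b k.
Proof.
move=> /fps_shiftK -> /fps_shiftK ->; rewrite mulrACA -exprD.
by rewrite !fps_coefXnM !ltnn !subnn fps_coefM big_ord1.
Qed.

End FpsCoef.

(** * Base change, ramified substitution and differentiation of power series *)

Section FpsMap.
Variables (A B : comNzRingType) (f : {rmorphism A -> B}).

Definition fps_map (a : fps A) : fps B := FPS (fun n => f (fps_coef a n)).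

Fact fps_map_is_zmod : zmod_morphism fps_map.
Proof. by move=> a b; apply: fpsP => n; rewrite fps_coefB !fps_coefE rmorphB. Qed.

Fact fps_map_is_monoid : monoid_morphism fps_map.
Proof.
split=> [|a b]; apply: fpsP => n; first by rewrite fps_coefE !fps_coef1 rmorph_nat.
by rewrite fps_coefE fps_coefM rmorph_sum fps_coefM; apply: eq_bigr => i _; rewrite rmorphM.
Qed.

HB.instance Definition _ :=
  GRing.isZmodMorphism.Build (fps A) (fps B) fps_map fps_map_is_zmod.
HB.instance Definition _ :=
  GRing.isMonoidMorphism.Build (fps A) (fps B) fps_map fps_map_is_monoid.

Lemma fps_mapX : fps_map (fpsX A) = fpsX B.
Proof. by apply: fpsP => n; rewrite fps_coefE !fps_coefX rmorph_nat. Qed.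

Lemma fps_mapC c : fps_map (fpsC c) = fpsC (f c).
Proof. by apply: fpsP => n; rewrite fps_coefE !fps_coefC; case: eqP; rewrite ?rmorph0. Qed.

End FpsMap.

Section FpsEval.
Variables (A B : comNzRingType) (f : {rmorphism A -> fps B}) (m : nat).

(* Coefficient N of the sum of the f (a_n) s^(m.+1 * n), to which only the terms
   n <= N contribute. *)
Definition fps_eval (a : fps A) : fps B :=
  FPS (fun N => fps_coef (\sum_(n < N.+1) f (fps_coef a n) * fpsX B ^+ (m.+1 * n)) N).

(** Every positive power of t = s^(m+1) raises the order in s, so each coefficient is that of the
    value of a polynomial; this is how the ring laws pass from polynomials to series. *)
Lemma fps_eval_trunc M (a : fps A) N : (N < M)%N ->
  fps_coef (fps_eval a) N
    = fps_coef (map_poly f (fps_trunc M a)).[fpsX B ^+ m.+1] N.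
Proof.
move=> ltNM; rewrite (@horner_coef_wide _ M); last first.
  by apply: leq_trans (size_poly _ _) _; exact: size_poly.
rewrite fps_coefE (big_ord_widen _ (fun n => f (fps_coef a n) * fpsX B ^+ (m.+1 * n)) ltNM).
rewrite !fps_coef_sum [RHS](bigID (fun i : 'I_M => (i < N.+1)%N)) /=.
rewrite [X in _ = _ + X]big1 ?addr0 => [|i].
  by apply: eq_bigr => i _; rewrite coef_map coef_trunc // exprM.
rewrite -ltnNge => ltNi; rewrite -exprM mulrC fps_coefXnM.
have -> : (N < m.+1 * i)%N by nia.
by [].
Qed.

Fact fps_eval_is_zmod : zmod_morphism fps_eval.
Proof.
move=> a b; apply: fpsP => N; rewrite fps_coefB !(@fps_eval_trunc N.+1) //.
rewrite -fps_coefB -hornerN -hornerD -raddfB; congr (fps_coef _.[_] _).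
congr (map_poly _ _); apply/polyP => i; rewrite coefB !coef_poly.
by case: ifP; rewrite ?subr0.
Qed.

Fact fps_eval_is_monoid : monoid_morphism fps_eval.
Proof.
split=> [|a b]; apply: fpsP => N.
  rewrite (@fps_eval_trunc N.+1) //; congr (fps_coef _ _).
  have -> : fps_trunc N.+1 (1 : fps A) = 1.
    by apply/polyP => i; rewrite coef_poly fps_coef1 coef1; case: i => [|i] //; case: ifP.
  by rewrite rmorph1 hornerC.
rewrite (@fps_eval_trunc N.+1) // (@coef_mul_trunc _ N.+1) //.
set pa := fps_trunc N.+1 a; set pb := fps_trunc N.+1 b.
pose ev p := (map_poly f p).[fpsX B ^+ m.+1].
have evM p q : ev (p * q) = ev p * ev q by rewrite /ev rmorphM hornerM.
have evD p q : ev (p + q) = ev p + ev q by rewrite /ev rmorphD hornerD.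
(* Polynomials that agree up to degree N differ by a multiple of X^(N+1), whose value has order
   greater than N. *)
have low (c p : {poly A}) : (forall i, (i < N.+1)%N -> c`_i = p`_i) ->
    fps_coef (ev c) N = fps_coef (ev p) N.
  move=> eqcp; rewrite -[c](subrK p) evD fps_coefD.
  have /(congr1 ev) := poly_take_drop N.+1 (c - p).
  have -> : take_poly N.+1 (c - p) = 0.
    apply/polyP => i; rewrite coef_take_poly coef0; case: ltnP => // lti.
    by rewrite coefB eqcp // subrr.
  rewrite add0r evM {2}/ev map_polyXn hornerXn -exprM => <-.
  rewrite mulrC fps_coefXnM; have -> : (N < m.+1 * N.+1)%N by nia.
  by rewrite add0r.
rewrite (low _ (pa * pb)) => [|i lti].
  rewrite evM (@coef_mul_trunc _ N.+1) //.
  by apply: coefM_eq_low => j lej; rewrite !coef_trunc // (@fps_eval_trunc N.+1).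
by rewrite coef_trunc // (@coef_mul_trunc _ N.+1).
Qed.

HB.instance Definition _ :=
  GRing.isZmodMorphism.Build (fps A) (fps B) fps_eval fps_eval_is_zmod.
HB.instance Definition _ :=
  GRing.isMonoidMorphism.Build (fps A) (fps B) fps_eval fps_eval_is_monoid.

Lemma fps_evalX : fps_eval (fpsX A) = fpsX B ^+ m.+1.
Proof.
apply: fpsP => N; rewrite (@fps_eval_trunc N.+2) //; congr (fps_coef _ _).
have -> : fps_trunc N.+2 (fpsX A) = 'X.
  by apply/polyP => i; rewrite coef_poly fps_coefX coefX; case: i => [|[|i]] //; case: ifP.
by rewrite map_polyX hornerX.
Qed.

Lemma fps_evalC c : fps_eval (fpsC c) = f c.
Proof.
apply: fpsP => N; rewrite (@fps_eval_trunc N.+1) //; congr (fps_coef _ _).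
have -> : fps_trunc N.+1 (fpsC c) = c%:P.
  by apply/polyP => i; rewrite coef_poly fps_coefC coefC; case: i => [|i] //; case: ifP.
by rewrite map_polyC hornerC.
Qed.

Lemma fps_eval_head a : fps_head (fps_eval a) = fps_head (f (fps_head a)).
Proof. by rewrite /fps_head fps_coefE big_ord1 muln0 expr0 mulr1. Qed.

End FpsEval.

Section FpsDeriv.
Variable R : comNzRingType.
Implicit Types a b : fps {poly R}.

Definition fps_deriv a : fps {poly R} := FPS (fun n => (fps_coef a n)^`()).

Lemma fps_derivD a b : fps_deriv (a + b) = fps_deriv a + fps_deriv b.
Proof. by apply: fpsP => n; rewrite fps_coefD !fps_coefE derivD. Qed.

Lemma fps_derivM a b : fps_deriv (a * b) = fps_deriv a * b + a * fps_deriv b.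
Proof.
apply: fpsP => n; rewrite fps_coefD !fps_coefM fps_coefE fps_coefM raddf_sum -big_split.
by apply: eq_bigr => i _; rewrite /= derivM.
Qed.

Lemma fps_deriv_const (c : fps R) : fps_deriv (fps_map polyC c) = 0.
Proof. by apply: fpsP => n; rewrite fps_coef0 !fps_coefE derivC. Qed.

Lemma fps_derivC p : fps_deriv (fpsC p) = fpsC p^`().
Proof. by apply: fpsP => n; rewrite fps_coefE !fps_coefC; case: eqP; rewrite ?derivC ?linear0. Qed.

End FpsDeriv.

(** * Hensel's lemma for power series over a field *)

Section Hensel.
Variable k : fieldType.
Implicit Types a b : fps k.

Definition fps_congr N a b := forall i, (i < N)%N -> fps_coef a i = fps_coef b i.

Lemma fps_congr_mul N a b : fps_congr N a b -> exists c, a = b + fpsX k ^+ N * c.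
Proof.
move=> eqab; exists (fps_shift N (a - b)).
rewrite -fps_shiftK ?subrKC // => i lti.
by rewrite fps_coefB eqab ?subrr.
Qed.

Lemma mul_fps_congr N b c : fps_congr N (b + fpsX k ^+ N * c) b.
Proof. by move=> i lti; rewrite fps_coefD fps_coefXnM lti addr0. Qed.

Lemma horner_fps_congr N (p : {poly fps k}) a b :
  fps_congr N a b -> fps_congr N p.[a] p.[b].
Proof.
move=> eqab; have [q ->] : exists q, p.[a] = p.[b] + (a - b) * q.
  have /factor_theorem[q] : root (p - p.[b]%:P) b by rewrite rootE !hornerE subrr.
  move/(congr1 (horner^~ a)); rewrite !hornerE => /eqP; rewrite subr_eq => /eqP ->.
  by exists q.[a]; rewrite addrC mulrC.
have [c ->] := fps_congr_mul eqab.
have -> : b + fpsX k ^+ N * c - b = fpsX k ^+ N * c by ring.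
by rewrite -mulrA; apply: mul_fps_congr.
Qed.

Lemma hensel (p : {poly fps k}) (z : k) :
    fps_head p.[fpsC z] = 0 -> fps_head p^`().[fpsC z] != 0 ->
  exists2 a, p.[a] = 0 & fps_head a = z.
Proof.
move=> p0; set d := fps_head _ => d_neq0.
pose c := fpsC d^-1.
(* Newton's iteration with the slope frozen at its reduction [d]: it gains only one coefficient per
   step, but only a constant has to be inverted. *)
pose step a := a - c * p.[a].
pose it n := iter n step (fpsC z).
have headit n : fps_head (it n) = z /\ fps_congr n.+1 p.[it n] 0.
  elim: n => [|n [hn cn]] /=.
    by rewrite /it /= fps_headC; split=> // -[|//] _; rewrite fps_coef0.
  have [e pe] := fps_congr_mul cn; rewrite add0r in pe.
  have stepE : step (it n) = it n + fpsX k ^+ n.+1 * (- c * e).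
    by rewrite /step pe; ring.
  have hs : fps_head (step (it n)) = z.
    by rewrite /fps_head stepE fps_coefD fps_coefXnM addr0.
  split=> //.
  (* Taylor expansion at the current approximation. The increment has order n + 1, so the terms from
     the quadratic one on have order at least 2n + 2, hence at least n + 2. *)
  have tay : p.[step (it n)] = p.[it n] + p^`().[it n] * (fpsX k ^+ n.+1 * (- c * e))
      + fpsX k ^+ n.+2 * (fpsX k ^+ n * (c * e) ^+ 2
        * (\sum_(i < size p - 2) (p^`N(i.+2)).[it n] * (fpsX k ^+ n.+1 * (- c * e)) ^+ i)).
    rewrite stepE; set h := _ * (- c * e).
    have hh : forall x : fps k, fpsX k ^+ n.+2 * (fpsX k ^+ n * (c * e) ^+ 2 * x) = h ^+ 2 * x.
      by move=> x; rewrite /h !exprS; ring.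
    rewrite hh nderiv_taylor; last exact: mulrC.
    have -> : \sum_(i < size p) (p^`N(i)).[it n] * h ^+ i
      = \sum_(i < (size p - 2).+2) (p^`N(i)).[it n] * h ^+ i.
      have le2 : (size p <= (size p - 2).+2)%N by lia.
      rewrite (big_ord_widen _ (fun i => (p^`N(i)).[it n] * h ^+ i) le2).
      rewrite [RHS](bigID (fun i : 'I_(size p - 2).+2 => (i < size p)%N)) /=.
      rewrite [X in _ = _ + X]big1 ?addr0 // => i.
      by rewrite -leqNgt => /nderivn_poly0 ->; rewrite horner0 mul0r.
    rewrite !big_ord_recl /= nderivn0 nderivn1 expr0 expr1 mulr1 addrA mulr_sumr.
    congr (_ + _); apply: eq_bigr => i _; rewrite /bump /= !add1n !exprS; ring.
  move=> i lti; rewrite fps_coef0 tay fps_coefD fps_coefXnM lti addr0 pe.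
  have -> : fpsX k ^+ n.+1 * e + p^`().[it n] * (fpsX k ^+ n.+1 * (- c * e))
     = fpsX k ^+ n.+1 * (e * (1 - c * p^`().[it n])) by ring.
  rewrite fps_coefXnM; case: ltnP => // lei.
  have -> : i = n.+1 by lia.
  rewrite subnn -/(fps_head _) rmorphM rmorphB rmorph1 rmorphM /= fps_headC.
  have -> : fps_head p^`().[it n] = d.
    have cit : fps_congr 1 (it n) (fpsC z).
      by case=> // _; rewrite -/(fps_head _) hn fps_coefC.
    exact: (@horner_fps_congr 1 p^`() _ _ cit 0 isT).
  by rewrite mulVf // subrr mulr0.
have itS n i : (i <= n)%N -> fps_coef (it n.+1) i = fps_coef (it n) i.
  move=> lei; rewrite /it iterS -/(it n) {1}/step fps_coefB.
  have [_ /fps_congr_mul[e ->]] := headit n.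
  by rewrite add0r mulrCA fps_coefXnM ltnS lei subr0.
(* The coefficient of index n no longer changes after step n, so the diagonal is the limit. *)
pose a := FPS (fun n => fps_coef (it n) n).
have cong n : fps_congr n.+1 a (it n).
  move=> i; rewrite ltnS fps_coefE => /subnKC <-.
  elim: (n - i)%N => [|j ->]; first by rewrite addn0.
  by rewrite addnS itS // leq_addr.
exists a; last by have [<- _] := headit 0.
apply: fpsP => n; have [_ cn] := headit n.
by rewrite (horner_fps_congr p (@cong n)) // cn.
Qed.

End Hensel.

(** * The invariant lemma *)

Lemma quadratic_of_roots (R : comNzRingType) (c a b : R) :
  c *: 'X^2 + (- (c * (a + b))) *: 'X + (c * (a * b))%:P
    = c *: (('X - a%:P) * ('X - b%:P)).
Proof. by rewrite -!mul_polyC polyCN !polyCM polyCD; ring. Qed.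

Lemma kernel_roots_of_factors (R : fieldType) (c a b : R) : c != 0 ->
  kernel_roots (c *: (('X - a%:P) * ('X - b%:P))) a b.
Proof.
move=> c_neq0; split.
  by rewrite size_scale // size_Mmonic ?polyXsubC_eq0 ?monicXsubC // !size_XsubC.
by rewrite lead_coefZ lead_coefM !lead_coefXsubC !mulr1.
Qed.

Section GeneralInvariantLemma.
Variables (F : fieldType) (D : lemma_data) (e : int).
Local Notation k := (uFrac F).
Local Notation W := (fps k).
Local Notation s := (lau_s F).
Local Notation "c %:k" := ((c%:P : {poly F})%:F : k) (at level 2).
Local Notation u := (('X : {poly F})%:F : k).

Hypothesis slope_gt0 : (0 < slope D)%N.
Hypothesis ram_gt0 : (0 < ram D)%N.
(** The order of Y^j t^i in s is ram i + e j. It is at least i/2 on the admissible range, so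
    finitely many terms reach a given order; i/2 is attained for slope 2, ram 1 and e = -1. *)
Hypothesis order_ge : forall (i j : nat), (slope D * j <= i)%N ->
  (i%:Z <= 2 * ((ram D)%:Z * i%:Z + e * j%:Z))%R.

Let lau_sX n : s ^+ n = (fpsX k ^+ n)%:F.
Proof. by rewrite rmorphXn. Qed.

Let s_neq0 : s != 0.
Proof. by rewrite tofrac_eq0 fpsX_neq0. Qed.

Section Family.
Variables (a : int -> {poly F}) (n0 : nat).
Hypothesis adm : admissible D a n0.

Let b (i : nat) : {poly F} := a (i%:Z - n0%:Z).
(** The order of Y^j t^i; by [E_val] the absolute value changes nothing where the coefficient is
    nonzero. *)
Let E (i j : nat) : nat := absz ((ram D)%:Z * i%:Z + e * j%:Z).

Let b_neq0 i j : (b i)`_j != 0 -> (slope D * j <= i)%N.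
Proof. by move=> /adm; rewrite subrK lez_nat. Qed.

Let size_b i : (size (b i) <= i.+1)%N.
Proof.
apply/leq_sizeP => j ltij; apply/eqP; apply: contraT => /b_neq0 le_i.
have : (j <= slope D * j)%N by rewrite leq_pmull.
lia.
Qed.

Let E_val i j : (b i)`_j != 0 -> (E i j)%:Z = (ram D)%:Z * i%:Z + e * j%:Z.
Proof. by move=> /b_neq0 /order_ge; rewrite /E; lia. Qed.

Let E_ge i j : (b i)`_j != 0 -> (i <= 2 * E i j)%N.
Proof. by move=> nz; have := order_ge (b_neq0 nz); rewrite -E_val //; lia. Qed.

Let term (U : W) (i : nat) : W :=
  \sum_(j < i.+1) fpsC (((b i)`_j)%:k) * (fpsX k ^+ E i j * U ^+ j).

Let term_coef U i N : fps_coef (term U i) N = \sum_(j < i.+1)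
  ((b i)`_j)%:k * (if (N < E i j)%N then 0 else fps_coef (U ^+ j) (N - E i j)).
Proof.
by rewrite /term fps_coef_sum; apply: eq_bigr => j _; rewrite fps_coefCM fps_coefXnM.
Qed.

Let term_low U i N : (2 * N < i)%N -> fps_coef (term U i) N = 0.
Proof.
move=> ltNi; rewrite fps_coef_sum big1 // => j _; rewrite fps_coefCM.
have [->|nz] := eqVneq ((b i)`_j) 0; first by rewrite rmorph0 mul0r.
rewrite fps_coefXnM; have -> : (N < E i j)%N by have := E_ge nz; lia.
by rewrite mulr0.
Qed.

(** [term U i] has order at least i/2, so only the terms with i at most 2N contribute to the
    coefficient N. *)
Let total (U : W) : W := FPS (fun N => \sum_(i < (2 * N).+1) fps_coef (term U i) N).

Let total_coef U N m : (2 * N < m)%N ->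
  fps_coef (total U) N = \sum_(i < m) fps_coef (term U i) N.
Proof.
move=> ltNm; rewrite fps_coefE (big_ord_widen _ (fun i => fps_coef (term U i) N) ltNm).
rewrite [RHS](bigID (fun i : 'I_m => (i < (2 * N).+1)%N)) /=.
rewrite [X in _ = _ + X]big1 ?addr0 // => i.
by rewrite -leqNgt => ?; apply: term_low.
Qed.

Let subst_term (U : W) i :
  (map_poly (@lau_weight F) (b i)).[s ^ e * U%:F] * lau_t F D ^ (i%:Z - n0%:Z)
    = s ^ (- (ram D * n0)%N%:Z) * (term U i)%:F.
Proof.
rewrite /map_poly horner_poly (big_ord_widen _
  (fun j => lau_weight (b i)`_j * (s ^ e * U%:F) ^+ j) (size_b i)).
rewrite big_mkcond rmorph_sum mulr_suml mulr_sumr; apply: eq_bigr => j _.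
have [b0|nz] := eqVneq ((b i)`_j) 0.
  rewrite b0 /lau_weight /lau_cst !(polyC0, tofrac0) [fpsC _]rmorph0.
  by rewrite !mul0r if_same rmorph0 mulr0 mul0r.
have -> : (j < size (b i))%N.
  by rewrite ltnNge; apply: contra nz => /leq_sizeP->.
rewrite /lau_weight /lau_cst -/(fpsC _) !rmorphM !rmorphXn /= -[(fpsX k)%:F]/s mulrCA.
rewrite -!mulrA; congr (_ * _).
have -> : s ^+ E i j = s ^ ((ram D)%:Z * i%:Z + e * j%:Z) by rewrite -E_val.
have -> : (s ^ e * U%:F) ^+ j = s ^ (e * j%:Z) * U%:F ^+ j.
  by rewrite exprMn exprnP exprz_exp.
have -> : lau_t F D ^ (i%:Z - n0%:Z) = s ^ ((ram D)%:Z * (i%:Z - n0%:Z)).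
  by rewrite /lau_t exprnP exprz_exp.
rewrite mulrAC mulrA -!expfzDr //; congr (s ^ _ * _).
lia.
Qed.

Lemma subst_y_total (U : W) :
  subst_y D a n0 (s ^ e * U%:F) (s ^ (- (ram D * n0)%N%:Z) * (total U)%:F).
Proof.
move=> N; exists (2 * (N + ram D * n0)).+1 => m lem.
exists (fps_shift (N + ram D * n0) (total U - \sum_(i < m) term U i)).
under eq_bigr do rewrite subst_term.
rewrite -mulr_sumr -rmorph_sum -mulrBr -rmorphB.
rewrite {1}[total U - _](@fps_shiftK _ (N + ram D * n0)) => [|i lti]; last first.
  rewrite fps_coefB fps_coef_sum (@total_coef _ _ m) ?subrr //.
  by apply: leq_trans lem; rewrite ltnS; lia.
rewrite /= tofracM -lau_sX exprD mulrA; congr (_ * _).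
rewrite mulrCA -[s ^+ (ram D * n0)]/(s ^ (ram D * n0)%N%:Z) -expfzDr //.
by rewrite addNr mulr1.
Qed.

Lemma subst_y_eq_const (U0 U1 : W) (l0 l1 : laurent F) :
    fps_head U0 = u -> fps_head U1 = u^-1 ->
    l0 = s ^ (- (ram D * n0)%N%:Z) * (total U0)%:F ->
    l1 = s ^ (- (ram D * n0)%N%:Z) * (total U1)%:F ->
  l0 = l1 -> forall n, (size (a n) <= 1)%N.
Proof.
move=> hU0 hU1 -> -> /(mulfI (expfz_neq0 _ s_neq0)) /eqP.
rewrite tofrac_eq => /eqP eqL n; apply/leq_sizeP => j0 j0_gt0.
apply: contrapT => /eqP nz.
(* The orders of the terms with j > 0. Those with j = 0 are the same for [U0] and [U1] and cancel in
   the difference. *)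
pose Q m := `[< exists i j, [/\ (0 < j)%N, (b i)`_j != 0 & E i j = m] >].
have exQ : exists m, Q m.
  exists (E (absz (n + n0%:Z)) j0); apply/asboolP; exists (absz (n + n0%:Z)), j0.
  have nnE : (absz (n + n0%:Z))%:Z = n + n0%:Z by have := adm nz; lia.
  by split; [exact: j0_gt0 | rewrite /b nnE addrK; exact: nz | reflexivity].
case: (ex_minnP exQ) => m /asboolP[i1 [j1 [j1_gt0 nz1 Em]]] minm.
have u_neq0 : u != 0 by rewrite tofrac_eq0 polyX_eq0.
pose J := (2 * m).+1.
(* The coefficient of s^m in the difference of the two sums, multiplied by u^J to make it a
   polynomial in u. Terms with i >= J have order greater than m, and j <= i < J in the others. *)
pose G := \sum_(i < J) \sum_(j < i.+1)
   (if (0 < j)%N && (E i j == m) then (b i)`_j else 0) *: ('X^(J + j) - 'X^(J - j) : {poly F}).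
have ltJ : (2 * m < J)%N by exact: ltnSn.
have G0 : G = 0.
  apply/eqP; rewrite -tofrac_eq0.
  have eqm : fps_coef (total U0) m = fps_coef (total U1) m by rewrite eqL.
  have {}eqm := etrans (esym (total_coef U0 ltJ)) (etrans eqm (total_coef U1 ltJ)).
  pose d := \sum_(i < J) fps_coef (term U0 i) m - \sum_(i < J) fps_coef (term U1 i) m.
  have d0 : d = 0 by apply/eqP; rewrite /d subr_eq0; apply/eqP.
  suff -> : G%:F = u ^+ J * d by rewrite d0 mulr0.
  rewrite /d -sumrB mulr_sumr rmorph_sum.
  apply: eq_bigr => i _.
  have -> : fps_coef (term U0 i) m - fps_coef (term U1 i) m = \sum_(j < i.+1)
     ((b i)`_j)%:k * ((if (m < E i j)%N then 0 else fps_coef (U0 ^+ j) (m - E i j))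
                    - (if (m < E i j)%N then 0 else fps_coef (U1 ^+ j) (m - E i j))).
    under eq_bigr do rewrite mulrBr.
    by rewrite sumrB; congr (_ - _); exact: term_coef.
  rewrite mulr_sumr rmorph_sum; apply: eq_bigr => j _.
  rewrite -mul_polyC rmorphM /= mulrCA.
  have [j0'|jn0] := posnP j.
    have -> : U0 ^+ j = U1 ^+ j by rewrite j0' !expr0.
    rewrite /= polyC0 tofrac0 mul0r.
    by rewrite [X in _ = _ * (_ * X)]subrr !mulr0.
  have [bz|nzb] := eqVneq ((b i)`_j) 0.
    by rewrite bz; case: ifP; rewrite polyC0 rmorph0 !mul0r.
  have leE : (m <= E i j)%N.
    apply: minm; apply/asboolP; exists (nat_of_ord i), (nat_of_ord j).
    by split; [exact: jn0 | exact: nzb | reflexivity].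
  have [Eij|neE] := eqVneq (E i j) m; last first.
    have -> : (m < E i j)%N by lia.
    by rewrite subrr mulr0 mulr0 /= polyC0 rmorph0 mul0r.
  rewrite Eij ltnn subnn /=; congr (_ * _).
  have hX (U : W) : fps_coef (U ^+ j) 0 = fps_head U ^+ j by rewrite -rmorphXn.
  rewrite !hX hU0 hU1 rmorphB !rmorphXn mulrBr -exprD; congr (_ - _).
  have lej : (j <= J)%N by apply: leq_trans (ltnW (ltn_ord i)); rewrite -ltnS.
  rewrite exprVn; apply: (canRL (mulfK _)); first by rewrite expf_neq0.
  by rewrite -exprD subnK.
have lt1 : (i1 < J)%N by have := E_ge nz1; rewrite /J; lia.
have lt2 : (j1 < i1.+1)%N.
  by rewrite ltnS; apply: leq_trans (b_neq0 nz1); rewrite leq_pmull.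
move/(congr1 (fun p : {poly F} => p`_(J + j1))): G0; rewrite coef0 coef_sum.
under eq_bigr do rewrite coef_sum.
have coef_mon (j : nat) (c : F) : (0 < j)%N ->
    (c *: ('X^(J + j) - 'X^(J - j)) : {poly F})`_(J + j1) = if j == j1 then c else 0.
  move=> j_gt0; rewrite coefZ coefB !coefXn.
  have -> : (J + j1 == J - j)%N = false by apply/eqP; lia.
  by rewrite eqn_add2l subr0 eq_sym; case: eqP; rewrite ?mulr1 ?mulr0.
(* No cancellation is possible: when the order m is fixed, j determines i because ram is not 0. *)
have uniq1 i j : (b i)`_j != 0 -> E i j = m -> j = j1 -> i = i1.
  move=> nzb Eij jj; have := E_val nzb; rewrite Eij jj => eqm.
  have := E_val nz1; rewrite Em eqm => /addIr.
  have : ((ram D)%:Z != 0)%R by lia.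
  by move=> r0 /(mulfI r0) [].
have other (i : nat) (j : nat) : ((i != i1) || (j != j1))%N ->
    ((if (0 < j)%N && (E i j == m) then (b i)`_j else 0)
      *: ('X^(J + j) - 'X^(J - j)) : {poly F})`_(J + j1) = 0.
  move=> ne; case: posnP => [_|jp] /=; first by rewrite scale0r coef0.
  rewrite (coef_mon _ _ jp); case: (j =P j1) => [jj|_]; last by [].
  case: (E i j =P m) => [Eij|_]; last by [].
  have [->|nzb] := eqVneq ((b i)`_j) 0; first by [].
  by move: ne; rewrite (uniq1 _ _ nzb Eij jj) jj !eqxx.
have main : (((if (0 < j1)%N && (E i1 j1 == m) then (b i1)`_j1 else 0) *:
     ('X^(J + j1) - 'X^(J - j1)) : {poly F}))`_(J + j1) = (b i1)`_j1.
  by rewrite (coef_mon _ _ j1_gt0) eqxx j1_gt0 Em eqxx.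
have outer (i : 'I_J) : i != Ordinal lt1 -> \sum_(j < i.+1)
    (((if (0 < j)%N && (E i j == m) then (b i)`_j else 0) *:
      ('X^(J + j) - 'X^(J - j)) : {poly F}))`_(J + j1) = 0.
  move=> nei; apply: big1 => j _; apply: (other i j); apply/orP; left.
  by apply: contra nei => /eqP ii; apply/eqP/val_inj.
have inner (j : 'I_i1.+1) : j != Ordinal lt2 ->
    (((if (0 < j)%N && (E i1 j == m) then (b i1)`_j else 0) *:
      ('X^(J + j) - 'X^(J - j)) : {poly F}))`_(J + j1) = 0.
  move=> nej; apply: (other i1 j); apply/orP; right.
  by apply: contra nej => /eqP jj; apply/eqP/val_inj.
rewrite (@big_only1 _ _ _ _ (Ordinal lt1) _ _ isT (fun i nei _ => outer i nei)).
rewrite (@big_only1 _ _ _ _ (Ordinal lt2) _ _ isT (fun j nej _ => inner j nej)).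
by move/(etrans (esym main))/eqP; apply/negP.
Qed.

End Family.

(* The kernel becomes, after y = s^e z and up to a power of s, a quadratic
   polynomial in z whose reduction modulo s is a multiple of (z - u)(z - 1/u). *)
Lemma invariant_lemma_of_kernel (S : model F) (K0 K1 K2 A0 A1 A2 : W) (r : int) (c : k) :
    kernel (@lau_weight F) S (lau_t F D) (lau_x F D)
      = K2%:F *: 'X^2 + K1%:F *: 'X + K0%:F%:P ->
    K2%:F * s ^ (2 * e) = s ^ r * A2%:F -> K1%:F * s ^ e = s ^ r * A1%:F ->
    K0%:F = s ^ r * A0%:F ->
    c != 0 -> fps_head A2 = c -> fps_head A1 = - (c * (u + u^-1)) -> fps_head A0 = c ->
  invariant_lemma S D.
Proof.
move=> kerE eK2 eK1 eK0 c_neq0 hA2 hA1 hA0.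
have u_neq0 : u != 0 by rewrite tofrac_eq0 polyX_eq0.
have uV : u - u^-1 != 0.
  apply/eqP => /(congr1 (fun x => x * u)) /eqP; rewrite mul0r mulrBl mulVf //.
  rewrite -rmorphM -(rmorph1 (@tofrac _)) -rmorphB tofrac_eq0 => /eqP.
  move/(congr1 (fun p : {poly F} => p`_2)).
  by rewrite -expr2 coefB coefXn coef1 coef0 subr0 => /eqP; rewrite oner_eq0.
pose p : {poly W} := A2 *: 'X^2 + A1 *: 'X + A0%:P.
have p_at (z : k) : p.[fpsC z] = A2 * fpsC z ^+ 2 + A1 * fpsC z + A0.
  by rewrite /p !(hornerD, hornerZ, hornerMn, hornerXn, hornerX, hornerC).
have dp_at (z : k) : p^`().[fpsC z] = A2 * fpsC z *+ 2 + A1.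
  rewrite /p derivD derivD derivC addr0 !derivZ derivX derivXn expr1.
  rewrite hornerD !hornerZ hornerMn hornerX hornerC.
  by rewrite mulr1 mulrnAr.
have rootof (z : k) : z ^+ 2 - (u + u^-1) * z + 1 = 0 -> z *+ 2 - (u + u^-1) != 0 ->
    exists2 U, p.[U] = 0 & fps_head U = z.
  move=> z0 z1; apply: hensel.
    rewrite p_at expr2 !rmorphD !rmorphM /= !fps_headC hA2 hA1 hA0.
    by apply: etrans (mulr0 c); rewrite -z0; ring.
  rewrite dp_at rmorphD rmorphMn rmorphM /= fps_headC hA2 hA1.
  have -> : (c * z) *+ 2 - c * (u + u^-1) = c * (z *+ 2 - (u + u^-1)) by ring.
  by apply: mulf_neq0; [exact: c_neq0 | exact: z1].
have [||U0 pU0 hU0] := rootof u.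
- by rewrite mulrDl mulVf // expr2; ring.
- by have -> : u *+ 2 - (u + u^-1) = u - u^-1 by ring.
have [||U1 pU1 hU1] := rootof u^-1.
- by rewrite mulrDl mulfV // expr2; ring.
- have -> : u^-1 *+ 2 - (u + u^-1) = - (u - u^-1) by ring.
  by rewrite oppr_eq0; exact: uV.
have U01 : U0 - U1 != 0.
  by apply: contra_neq uV => /(congr1 (@fps_head _)); rewrite rmorphB rmorph0 /= hU0 hU1.
have A2_neq0 : A2 != 0.
  by apply: contra_neq c_neq0 => A20; rewrite -hA2 A20 rmorph0.
(* Vieta's formulas, valid because the two roots are distinct, with heads u and 1/u, in an integral
   domain. *)
have sumU : A1 = - (A2 * (U0 + U1)).
  apply: (mulfI U01); apply/eqP; rewrite -subr_eq0; apply/eqP.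
  transitivity (p.[U0] - p.[U1]); last by rewrite pU0 pU1 subrr.
  by rewrite /p !(hornerD, hornerZ, hornerMn, hornerXn, hornerX, hornerC); ring.
have prodU : A0 = A2 * (U0 * U1).
  apply/eqP; rewrite -subr_eq0; apply/eqP.
  transitivity (p.[U0]); last by [].
  by rewrite /p !(hornerD, hornerZ, hornerMn, hornerXn, hornerX, hornerC) sumU; ring.
have sn0 (n : int) : s ^ n != 0 by rewrite expfz_neq0.
have K2_neq0 : K2%:F != 0.
  apply: contra_neq A2_neq0 => K20; move/eqP: eK2; rewrite K20 mul0r eq_sym.
  by rewrite mulf_eq0 (negPf (sn0 r)) tofrac_eq0 => /eqP.
have se2 : s ^ (2 * e) = s ^ e * s ^ e by rewrite -expfzDr // mulr_natl.
exists (s ^ e * U0%:F), (s ^ e * U1%:F); split; last first.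
  move=> a n0 adm; eexists; eexists; split; try exact: (subst_y_total adm).
  exact: (subst_y_eq_const adm hU0 hU1 erefl erefl).
have kerF : kernel (@lau_weight F) S (lau_t F D) (lau_x F D)
     = K2%:F *: (('X - (s ^ e * U0%:F)%:P) * ('X - (s ^ e * U1%:F)%:P)).
  rewrite kerE.
  have -> : K1%:F = - (K2%:F * (s ^ e * U0%:F + s ^ e * U1%:F)).
    apply: (mulIf (sn0 e)); rewrite eK1 sumU rmorphN rmorphM rmorphD /=.
    rewrite mulrN mulrA -eK2 se2; ring.
  have -> : K0%:F = K2%:F * (s ^ e * U0%:F * (s ^ e * U1%:F)).
    by rewrite eK0 prodU !tofracM [LHS]mulrA -eK2 se2; ring.
  exact: quadratic_of_roots.
by rewrite kerF; apply: kernel_roots_of_factors.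
Qed.

End GeneralInvariantLemma.

(** * Rational invariants and decoupling functions of the models *)

Section ModelData.
Variables (R : comNzRingType) (l : R).
Implicit Types (t x y : R) (m : model_name).

(** The data of the models are expressions over an arbitrary commutative ring: the same identities
    serve in extensions of F(t)(x), in Laurent series and in F[x][y][[t]], and the data commute with
    all morphisms. *)
Definition ker2 m t x : R :=
  match m with
  | Kreweras | Gessel | WeightedD => t * x ^+ 2
  | DoubleKreweras => t * x * (1 + x)
  | WeightedE | WeightedG => t * (1 + x) ^+ 2
  | WeightedF => t * (1 + x)
  end.

Definition ker1 m t x : R :=
  match m with
  | Kreweras => t - x
  | DoubleKreweras | Gessel => t * (1 + x ^+ 2) - x
  | WeightedD | WeightedE => t * (1 + 2 * x ^+ 2) - x
  | WeightedF | WeightedG => t * (2 + x ^+ 2) - x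
  end.

Definition ker0 m t x : R :=
  match m with
  | Kreweras => t * x
  | DoubleKreweras | WeightedG => t * (1 + x)
  | Gessel => t
  | WeightedD => t * (1 + l * x + x ^+ 2)
  | WeightedE => t * x * (1 + x)
  | WeightedF => t * (1 + x) ^+ 2
  end.

Definition ker m t x y : R := ker2 m t x * y ^+ 2 + ker1 m t x * y + ker0 m t x.

Let tau t : R := 1 + 3 * t.

(** Model (g) is (e) with x replaced by 1/x, and (f) is (e) with both variables inverted.
    Accordingly [poly_f] is -y^5 times [poly_e] at 1/y, and the three models share these two
    polynomials up to sign. *)
Let poly_e t y : R :=
  t * tau t * y ^+ 5 + (tau t ^+ 2 - t * tau t - t ^+ 2) * y ^+ 3
  + t * y ^+ 2 + t * y - t ^+ 2.

Let poly_f t y : R :=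
  t ^+ 2 * y ^+ 5 - t * y ^+ 4 - t * y ^+ 3
  + (t ^+ 2 + t * tau t - tau t ^+ 2) * y ^+ 2 - t * tau t.

(* I(y) = inv_num / inv_den and J(x) = inv_numx / inv_denx satisfy
   I(y) = J(x) when the kernel vanishes. *)
Definition inv_num m t y : R :=
  match m with
  | Kreweras => t - y - t * y ^+ 3
  | DoubleKreweras => t * y ^+ 3 + y - t
  | Gessel => t ^+ 2 * (y - 1) ^+ 2 * (1 + y) ^+ 2 + y ^+ 2
  | WeightedD => (1 + t * l) ^+ 2 - (1 + t * l) * (1 + y) - t ^+ 2 * (1 + y) ^+ 3
  | WeightedE => - poly_e t y
  | WeightedF => poly_f t y
  | WeightedG => poly_e t y
  end.

Definition inv_den m y : R :=
  match m with
  | Kreweras => y ^+ 2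
  | DoubleKreweras => y * (1 + y)
  | Gessel | WeightedF => y * (1 + y) ^+ 2
  | WeightedD => (1 + y) ^+ 2
  | WeightedE | WeightedG => y ^+ 2 * (1 + y) ^+ 2
  end.

Definition inv_numx m t x : R :=
  match m with
  | Kreweras => t - x - t * x ^+ 3
  | DoubleKreweras => t * x ^+ 3 + x - t
  | Gessel => - (t * (1 + x ^+ 2)) ^+ 2 + t * x * (1 + x ^+ 2)
  | WeightedD => t ^+ 2 - t * x - t * (1 + t * l) * x ^+ 3
  | WeightedE => - poly_e t x
  | WeightedF => poly_f t x
  | WeightedG => - poly_f t x
  end.

Definition inv_denx m x : R :=
  match m with
  | Kreweras | Gessel | WeightedD => x ^+ 2
  | DoubleKreweras => x * (1 + x)
  | WeightedE => x ^+ 2 * (1 + x) ^+ 2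
  | WeightedF | WeightedG => x * (1 + x) ^+ 2
  end.

(** A congruence modulo the kernel rather than an equality on its zero set: at K = 0 it gives the
    rational invariants, and in the ring of series it feeds the divisibility argument. The witnesses
    are the exact quotients. *)
Lemma rational_invariant m t x y : exists c,
  inv_num m t y * inv_denx m x - inv_den m y * inv_numx m t x = ker m t x y * c.
Proof.
rewrite /ker; case: m => /=.
- by exists (x - y); ring.
- by exists (y - x); ring.
- by exists (t * x ^+ 2 * y + t * x ^+ 2 + t * y ^+ 2 + t * y - x * y); ring.
- by exists (t * x * l - t * y - t + x); ring.
- exists (3 * t * x ^+ 3 * y ^+ 2 - 3 * t * x ^+ 2 * y ^+ 3 - 2 * t * x ^+ 2 * y
    + t * x ^+ 2 + 2 * t * x * y ^+ 2 + t * x - t * y ^+ 2 - t * y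
    + x ^+ 3 * y ^+ 2 - x ^+ 2 * y ^+ 3 - x ^+ 2 * y + x * y ^+ 2).
  by rewrite /poly_e /tau; ring.
- exists (- t * x ^+ 3 * y ^+ 2 - t * x ^+ 3 * y + t * x ^+ 2 * y ^+ 3
    + 2 * t * x ^+ 2 * y + t * x * y ^+ 3 - 2 * t * x * y ^+ 2 - 3 * t * x
    + 3 * t * y + x ^+ 2 * y - x * y ^+ 2 - x + y).
  by rewrite /poly_f /tau; ring.
- exists (t * x ^+ 3 * y ^+ 2 + t * x ^+ 3 * y - 2 * t * x ^+ 2 * y ^+ 2
    - t * x ^+ 2 + 3 * t * x * y ^+ 3 + 2 * t * x * y - t * x - 3 * t * y ^+ 2
    - x ^+ 2 * y ^+ 2 + x * y ^+ 3 + x * y - y ^+ 2).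
  by rewrite /poly_e /poly_f /tau; ring.
Qed.

(* xy = dec_numx / (dec_scale dec_denx) - dec_num / (dec_scale dec_den) when the
   kernel vanishes. *)
Definition dec_num m t y : R :=
  match m with
  | Kreweras => 1
  | DoubleKreweras => 1 + y
  | Gessel => 1
  | WeightedD => 1 + t * l
  | WeightedE => t * (y ^+ 2 - 1) * (1 + y) + tau t * y
  | WeightedF => (1 + y) ^+ 2 * (t * y - tau t)
  | WeightedG => (1 + y) ^+ 2
  end.

Definition dec_den m y : R :=
  match m with
  | Kreweras | DoubleKreweras | WeightedF | WeightedG => y
  | Gessel | WeightedD => 1 + y
  | WeightedE => y * (1 + y)
  end.

Definition dec_scale m t : R :=
  match m with
  | Kreweras | DoubleKreweras | WeightedG => 1
  | _ => t
  end.

Definition dec_numx m t x : R :=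
  match m with
  | Kreweras | Gessel => x - t
  | DoubleKreweras => - t * x ^+ 2 + t * x + x
  | WeightedD => x - t - t * x ^+ 2
  | WeightedE => - t * x ^+ 3 + 3 * t * x ^+ 2 + 2 * t * x + t + x ^+ 2
  | WeightedF => - t ^+ 2 * x ^+ 3 - 5 * t ^+ 2 * x ^+ 2 - 13 * t ^+ 2 * x
                 - t * x ^+ 2 - 7 * t * x - x
  | WeightedG => - t * x ^+ 2 + 2 * t * x + x
  end.

Definition dec_denx m t x : R :=
  match m with
  | Kreweras => t * x
  | DoubleKreweras | WeightedG => t * (1 + x)
  | Gessel | WeightedD => x
  | WeightedE => x * (1 + x)
  | WeightedF => t * (1 + x) ^+ 2
  end.

Lemma decoupling_identity m t x y : exists c,
  dec_den m y * dec_numx m t x - dec_denx m t x * dec_num m t y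
    - dec_scale m t * dec_den m y * dec_denx m t x * (x * y) = ker m t x y * c.
Proof.
rewrite /ker; case: m => /=.
- by exists (- 1); ring.
- by exists (- 1); ring.
- by exists (- 1); ring.
- by exists (- 1); ring.
- by exists (1 - x * y); rewrite /tau; ring.
- by exists (- t * x * y - t * y + 3 * t + 1); rewrite /tau; ring.
- by exists (- 1); ring.
Qed.

End ModelData.

Section Kernel.
Variables (F : fieldType) (lambda : F) (m : model_name).
Variables (A : comNzRingType) (phi : F -> A) (t x : A).
Hypotheses (phi1 : phi 1 = 1) (phi2 : phi 2%:R = 2%:R).

Lemma kernel_steps : kernel phi (steps lambda m) t x
  = ker2 m t x *: 'X^2 + ker1 m t x *: 'X + (ker0 (phi lambda) m t x)%:P.
Proof.
rewrite /kernel -!mul_polyC.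
by case: m; rewrite !big_cons big_nil /= -!mul_polyC !(phi1, phi2)
  !(rmorphB, rmorphD, rmorphM, rmorphXn, rmorph1) /=; ring.
Qed.

Lemma horner_kernel_steps y :
  (kernel phi (steps lambda m) t x).[y] = ker (phi lambda) m t x y.
Proof. rewrite kernel_steps !hornerE /= /ker; ring. Qed.

Lemma horner_kernel_swap y :
  (kernel phi (swap_model (steps lambda m)) t x).[y] = ker (phi lambda) m t y x.
Proof.
rewrite /kernel /ker.
by case: m; rewrite !big_cons big_nil !hornerE /= !(phi1, phi2); ring.
Qed.

End Kernel.

Section DataMorphism.
Variables (R R' : comNzRingType) (f : {rmorphism R -> R'}).
Variables (l : R) (m : model_name) (t x y : R).

Let morphE := (rmorphB, rmorphD, rmorphN, rmorphM, rmorphXn, rmorph1, rmorph_nat).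

Lemma rmorph_ker2 : f (ker2 m t x) = ker2 m (f t) (f x).
Proof. by case: m; rewrite /= ?morphE. Qed.

Lemma rmorph_ker1 : f (ker1 m t x) = ker1 m (f t) (f x).
Proof. by case: m; rewrite /= ?morphE. Qed.

Lemma rmorph_ker0 : f (ker0 l m t x) = ker0 (f l) m (f t) (f x).
Proof. by case: m; rewrite /= ?morphE. Qed.

Lemma rmorph_ker : f (ker l m t x y) = ker (f l) m (f t) (f x) (f y).
Proof. by rewrite /ker !morphE /= rmorph_ker0 rmorph_ker1 rmorph_ker2. Qed.

Lemma rmorph_inv_num : f (inv_num l m t y) = inv_num (f l) m (f t) (f y).
Proof. by case: m; rewrite /= ?morphE. Qed.

Lemma rmorph_inv_den : f (inv_den m y) = inv_den m (f y).
Proof. by case: m; rewrite /= ?morphE. Qed.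

Lemma rmorph_inv_numx : f (inv_numx l m t x) = inv_numx (f l) m (f t) (f x).
Proof. by case: m; rewrite /= ?morphE. Qed.

Lemma rmorph_inv_denx : f (inv_denx m x) = inv_denx m (f x).
Proof. by case: m; rewrite /= ?morphE. Qed.

Lemma rmorph_dec_num : f (dec_num l m t y) = dec_num (f l) m (f t) (f y).
Proof. by case: m; rewrite /= ?morphE. Qed.

Lemma rmorph_dec_den : f (dec_den m y) = dec_den m (f y).
Proof. by case: m; rewrite /= ?morphE. Qed.

Lemma rmorph_dec_scale : f (dec_scale m t) = dec_scale m (f t).
Proof. by case: m; rewrite /= ?morphE. Qed.

Lemma rmorph_dec_numx : f (dec_numx m t x) = dec_numx m (f t) (f x).
Proof. by case: m; rewrite /= ?morphE. Qed.

Lemma rmorph_dec_denx : f (dec_denx m t x) = dec_denx m (f t) (f x).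
Proof. by case: m; rewrite /= ?morphE. Qed.

End DataMorphism.

Lemma nat_neq0_char0 (R : fieldType) : [pchar R] =i pred0 ->
  forall n, (0 < n)%N -> (n%:R : R) != 0.
Proof. by move=> char0 n; rewrite (pcharf0P R).1 // -lt0n. Qed.

Lemma fmorph_addV (K K' : fieldType) (f : {rmorphism K -> K'}) (z : K) :
  f (z + z^-1) = f z + (f z)^-1.
Proof. by rewrite rmorphD fmorphV. Qed.

Lemma mul_expz_shift (K : fieldType) (z a : K) (n r : nat) (e : int) :
  z != 0 -> n%:Z + e = r%:Z -> z ^+ n * a * z ^ e = z ^ r * a.
Proof. by move=> z_neq0 <-; rewrite mulrAC expfzDr. Qed.

(** * Expansion of the kernels in s and the invariant lemma of each model *)

Section InvariantLemmaModels.
Variables (F : fieldType) (lambda : F) (m : model_name).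
Local Notation D := (lemma_data_of m).
Local Notation k := (uFrac F).
Local Notation X := (fpsX k).
Local Notation s := (lau_s F).
Local Notation u := (('X : {poly F})%:F : k).
Local Notation w := (fpsC (u + u^-1)).
Local Notation L := (fpsC ((lambda%:P : {poly F})%:F : k)).

Let t := X ^+ ram D.
Let x := (xmul D)%:R * t + X ^+ xexp D * w.

(** The conditions on n0, n1, n2 say that the Newton polygon of the kernel is one segment of slope
    given by e: after y = s^e z its three coefficients have the same order n0, and the reduction is
    z^2 - (u + 1/u) z + 1. *)
Lemma invariant_lemma_of_expansion (e : int) (n0 n1 n2 : nat) (A0 A1 A2 : fps k) :
    (forall (i j : nat), (slope D * j <= i)%N ->
       (i%:Z <= 2 * ((ram D)%:Z * i%:Z + e * j%:Z))%R) ->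
    ker2 m t x = X ^+ n2 * A2 -> ker1 m t x = X ^+ n1 * A1 ->
    ker0 L m t x = X ^+ n0 * A0 ->
    n2%:Z + 2 * e = n0%:Z -> n1%:Z + e = n0%:Z ->
    fps_head A2 = 1 -> fps_head A1 = - (u + u^-1) -> fps_head A0 = 1 ->
  invariant_lemma (steps lambda m) D.
Proof.
move=> ord e2 e1 e0 en2 en1 h2 h1 h0.
have s_neq0 : s != 0 by rewrite tofrac_eq0 fpsX_neq0.
have tE : lau_t F D = t%:F by rewrite rmorphXn.
have wE : lau_u F + (lau_u F)^-1 = w%:F.
  exact: esym (fmorph_addV (@tofrac _ \o @fpsC k) u).
have sE n : s ^+ n = (X ^+ n)%:F by rewrite rmorphXn.
have xE : lau_x F D = x%:F.
  rewrite /lau_x wE tE sE /x tofracD; congr (_ + _); last by rewrite tofracM.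
  by rewrite tofracM; congr (_ * _); rewrite rmorph_nat.
pose weight : {rmorphism F -> laurent F} :=
  @tofrac _ \o (@fpsC k \o (@tofrac _ \o @polyC F)).
have w1 : @lau_weight F 1 = 1 := rmorph1 weight.
have w2 : @lau_weight F 2%:R = 2%:R := rmorph_nat weight 2.
have kerE : kernel (@lau_weight F) (steps lambda m) t%:F x%:F
    = (ker2 m t x)%:F *: 'X^2 + (ker1 m t x)%:F *: 'X + ((ker0 L m t x)%:F)%:P.
  apply: (etrans (kernel_steps lambda m t%:F x%:F w1 w2)).
  have e2' := rmorph_ker2 (@tofrac _) m t x.
  have e1' := rmorph_ker1 (@tofrac _) m t x.
  have e0' := rmorph_ker0 (@tofrac _) L m t x.
  by congr (_ *: _ + _ *: _ + _%:P); apply: esym; [exact: e2' | exact: e1' | exact: e0'].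
have mon n (A : fps k) : (X ^+ n * A)%:F = s ^+ n * A%:F by rewrite tofracM sE.
have sl : (0 < slope D)%N by case: (m).
have rm : (0 < ram D)%N by case: (m).
apply: (@invariant_lemma_of_kernel F D e sl rm ord (steps lambda m)
   (ker0 L m t x) (ker1 m t x) (ker2 m t x) A0 A1 A2 n0%:Z 1).
- by rewrite tE xE; exact: kerE.
- by rewrite e2 mon; exact: (mul_expz_shift _ s_neq0 en2).
- by rewrite e1 mon; exact: (mul_expz_shift _ s_neq0 en1).
- by rewrite e0 mon.
- exact: oner_neq0.
- exact: h2.
- by rewrite mul1r.
- exact: h0.
Qed.

End InvariantLemmaModels.

(* The two roots of the kernel are u^(+-1) s^e (1 + O(s)) with e = root_order. *)
Definition root_order (m : model_name) : int :=
  match m with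
  | Kreweras | DoubleKreweras | Gessel | WeightedD => -1
  | WeightedE => 1
  | WeightedF | WeightedG => 0
  end.

(** The orders in s of [ker0], [ker1] and [ker2]. *)
Definition kernel_order (m : model_name) : nat * nat * nat :=
  match m with
  | Kreweras => (4, 5, 6)%N
  | DoubleKreweras => (2, 3, 4)%N
  | Gessel | WeightedD => (1, 2, 3)%N
  | WeightedE => (4, 3, 2)%N
  | WeightedF | WeightedG => (1, 1, 1)%N
  end.

Section KernelExpansion.
Variables (R : comNzRingType) (m : model_name) (l X w : R).
Let p := 1 + X * w.

Definition kernel_exp2 : R :=
  match m with
  | Kreweras => (1 + X ^+ 3 * w) ^+ 2
  | DoubleKreweras => p * (1 + X ^+ 2 * p)
  | Gessel | WeightedD => p ^+ 2
  | WeightedE => (1 + X ^+ 2 * p) ^+ 2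
  | WeightedF => 1 + X * (2 + w)
  | WeightedG => (1 + X * (2 + w)) ^+ 2
  end.

(** The summand xmul t of x cancels the term of [ker1] that is free of x, so that the leading
    coefficient is -w, with w = u + 1/u. *)
Definition kernel_exp1 : R :=
  match m with
  | Kreweras => - w
  | DoubleKreweras => - w + X ^+ 3 * p ^+ 2
  | Gessel => - w + X * p ^+ 2
  | WeightedD => - w + 2 * X * p ^+ 2
  | WeightedE => - w + 2 * X ^+ 3 * p ^+ 2
  | WeightedF | WeightedG => - w + X ^+ 2 * (2 + w) ^+ 2
  end.

Definition kernel_exp0 : R :=
  match m with
  | Kreweras => 1 + X ^+ 3 * w
  | DoubleKreweras => 1 + X ^+ 2 * p
  | Gessel => 1
  | WeightedD => 1 + l * X * p + X ^+ 2 * p ^+ 2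
  | WeightedE => p * (1 + X ^+ 2 * p)
  | WeightedF => (1 + X * (2 + w)) ^+ 2
  | WeightedG => 1 + X * (2 + w)
  end.

Let D := lemma_data_of m.
Let t := X ^+ ram D.
Let x := (xmul D)%:R * t + X ^+ xexp D * w.

Lemma ker2_expansion : ker2 m t x = X ^+ (kernel_order m).2 * kernel_exp2.
Proof. by rewrite /x /t /D /kernel_exp2 /p; case: m => /=; ring. Qed.

Lemma ker1_expansion : ker1 m t x = X ^+ (kernel_order m).1.2 * kernel_exp1.
Proof. by rewrite /x /t /D /kernel_exp1 /p; case: m => /=; ring. Qed.

Lemma ker0_expansion : ker0 l m t x = X ^+ (kernel_order m).1.1 * kernel_exp0.
Proof. by rewrite /x /t /D /kernel_exp0 /p; case: m => /=; ring. Qed.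

End KernelExpansion.

Section KernelExpansionMorphism.
Variables (R R' : comNzRingType) (f : {rmorphism R -> R'}).
Variables (m : model_name) (l X w : R).
Hypothesis fX : f X = 0.

Let morphE := (rmorphB, rmorphD, rmorphN, rmorphM, rmorphXn, rmorph1, rmorph_nat).

Lemma rmorph_kernel_exp2 : f (kernel_exp2 m X w) = 1.
Proof. by rewrite /kernel_exp2; case: m; rewrite ?morphE /= ?fX; ring. Qed.

Lemma rmorph_kernel_exp1 : f (kernel_exp1 m X w) = - f w.
Proof. by rewrite /kernel_exp1; case: m; rewrite ?morphE /= ?fX; ring. Qed.

Lemma rmorph_kernel_exp0 : f (kernel_exp0 m l X w) = 1.
Proof. by rewrite /kernel_exp0; case: m; rewrite ?morphE /= ?fX; ring. Qed.

End KernelExpansionMorphism.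

Lemma steps_invariant_lemma (F : fieldType) (lambda : F) (m : model_name) :
  invariant_lemma (steps lambda m) (lemma_data_of m).
Proof.
pose k := uFrac F; pose X := fpsX k.
pose u := (('X : {poly F})%:F : k); pose w := fpsC (u + u^-1).
pose L := fpsC ((lambda%:P : {poly F})%:F : k).
have hX : fps_head X = 0 := fps_headX _.
apply: (@invariant_lemma_of_expansion F lambda m (root_order m)
  (kernel_order m).1.1 (kernel_order m).1.2 (kernel_order m).2
  (kernel_exp0 m L X w) (kernel_exp1 m X w) (kernel_exp2 m X w)).
- by case: (m) => i j /=; lia.
- exact: ker2_expansion.
- exact: ker1_expansion.
- exact: ker0_expansion.
- by case: (m).
- by case: (m).
- exact: (rmorph_kernel_exp2 _ _ hX).
- by rewrite -[u + u^-1](fps_headC (R := k)); exact: (rmorph_kernel_exp1 _ _ hX).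
- exact: (rmorph_kernel_exp0 _ _ _ hX).
Qed.

Section HornerData.
Variables (R : comNzRingType) (l t z : R) (m : model_name).

Lemma horner_inv_num : (inv_num l%:P m t%:P 'X).[z] = inv_num l m t z.
Proof.
by have := rmorph_inv_num (horner_eval z) l%:P m t%:P 'X;
  rewrite /= /horner_eval !hornerC hornerX.
Qed.

Lemma horner_inv_numx : (inv_numx l%:P m t%:P 'X).[z] = inv_numx l m t z.
Proof.
by have := rmorph_inv_numx (horner_eval z) l%:P m t%:P 'X;
  rewrite /= /horner_eval !hornerC hornerX.
Qed.

Lemma horner_inv_den : (inv_den m 'X).[z] = inv_den m z.
Proof.
by have := rmorph_inv_den (horner_eval z) m 'X; rewrite /= /horner_eval hornerX.
Qed.

Lemma horner_inv_denx : (inv_denx m 'X).[z] = inv_denx m z.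
Proof.
by have := rmorph_inv_denx (horner_eval z) m 'X; rewrite /= /horner_eval hornerX.
Qed.

Lemma horner_inv_num_t (p : {poly R}) :
  (inv_num l%:P m 'X p).[t] = inv_num l m t p.[t].
Proof.
by have := rmorph_inv_num (horner_eval t) l%:P m 'X p;
  rewrite /= /horner_eval !hornerC hornerX.
Qed.

Lemma horner_inv_numx_t (p : {poly R}) :
  (inv_numx l%:P m 'X p).[t] = inv_numx l m t p.[t].
Proof.
by have := rmorph_inv_numx (horner_eval t) l%:P m 'X p;
  rewrite /= /horner_eval !hornerC hornerX.
Qed.

Variables (S : comNzRingType) (g : {rmorphism {poly R} -> S}) (l' t' z' : S).
Hypotheses (gl : g l%:P = l') (gt : g t%:P = t') (gX : g 'X = z').

Lemma image_inv_num : g (inv_num l%:P m t%:P 'X) = inv_num l' m t' z'.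
Proof. by rewrite rmorph_inv_num gl gt gX. Qed.

Lemma image_inv_numx : g (inv_numx l%:P m t%:P 'X) = inv_numx l' m t' z'.
Proof. by rewrite rmorph_inv_numx gl gt gX. Qed.

Lemma image_inv_den : g (inv_den m 'X) = inv_den m z'.
Proof. by rewrite rmorph_inv_den gX. Qed.

Lemma image_inv_denx : g (inv_denx m 'X) = inv_denx m z'.
Proof. by rewrite rmorph_inv_denx gX. Qed.

Lemma image_dec_num : g (dec_num l%:P m t%:P 'X) = dec_num l' m t' z'.
Proof. by rewrite rmorph_dec_num gl gt gX. Qed.

Lemma image_dec_den : g (dec_den m 'X) = dec_den m z'.
Proof. by rewrite rmorph_dec_den gX. Qed.

Lemma image_dec_scale : g (dec_scale m t%:P) = dec_scale m t'.
Proof. by rewrite rmorph_dec_scale gt. Qed.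

End HornerData.

(** * Rational invariants and decoupling functions over F(t) *)

Section RationalModels.
Variables (F : fieldType) (char0 : [pchar F] =i pred0) (lambda : F).
Implicit Types m : model_name.
Local Notation FT := (coefFrac F).
Local Notation RF := (ratFrac F).

Fact cst_is_zmod : zmod_morphism (@cst F).
Proof. exact: (rmorphB (@tofrac _ \o @polyC FT)). Qed.

Fact cst_is_monoid : monoid_morphism (@cst F).
Proof.
by split; [exact: (rmorph1 (@tofrac _ \o @polyC FT))
          | exact: (rmorphM (@tofrac _ \o @polyC FT))].
Qed.

HB.instance Definition _ := GRing.isZmodMorphism.Build FT RF (@cst F) cst_is_zmod.
HB.instance Definition _ :=
  GRing.isMonoidMorphism.Build FT RF (@cst F) cst_is_monoid.

(* F[t][x] in F(t)(x), the inner variable being t. *)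
Definition to_ratFrac : {poly {poly F}} -> RF := @tofrac _ \o map_poly (@tofrac _).

HB.instance Definition _ := GRing.RMorphism.copy to_ratFrac
  (@tofrac _ \o map_poly (@tofrac {poly F})).

Lemma to_ratFrac_neq0 p (t x : F) : p.[x%:P].[t] != 0 -> to_ratFrac p != 0.
Proof.
apply: contra_neq => p0; suff -> : p = 0 by rewrite !horner0.
move/eqP: p0; rewrite /to_ratFrac /= tofrac_eq0 => /eqP/polyP p0.
apply/polyP => i; have /eqP := p0 i.
by rewrite coef_map !coef0 /= tofrac_eq0 => /eqP.
Qed.

Definition to_coefFrac : {poly F} -> FT := @tofrac _.
HB.instance Definition _ := GRing.RMorphism.copy to_coefFrac (@tofrac {poly F}).

Lemma to_coefFrac_neq0 (p : {poly F}) (t : F) : p.[t] != 0 -> to_coefFrac p != 0.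
Proof. by apply: contra_neq => /eqP; rewrite tofrac_eq0 => /eqP->; rewrite horner0. Qed.

Let tt : {poly {poly F}} := 'X%:P.
Let ll : {poly {poly F}} := lambda%:P%:P.

Lemma to_ratFracX : to_ratFrac 'X = varFrac F.
Proof. by rewrite /to_ratFrac /= map_polyX. Qed.

Lemma to_ratFracC p : to_ratFrac p%:P = cst (to_coefFrac p).
Proof. by rewrite /to_ratFrac /= map_polyC. Qed.

Section KernelRoots.
Variables (E : fieldType) (psi : {rmorphism {poly {poly F}} -> E}) (te xe le : E).
Hypotheses (psi_x : psi 'X = xe) (psi_t : psi 'X%:P = te).
Hypothesis psi_l : psi lambda%:P%:P = le.
Hypothesis psi_neq0 : forall p (t x : F), p.[x%:P].[t] != 0 -> psi p != 0.

Let one_neq0 (n : nat) : (0 < n)%N -> (n%:R : F) != 0.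
Proof. exact: nat_neq0_char0. Qed.

Let psi_ker m p q : psi (ker lambda%:P%:P m 'X%:P p q) = ker le m te (psi p) (psi q).
Proof. by rewrite -psi_t -psi_l; exact: rmorph_ker. Qed.

Let ker_neq0 m (p q : {poly {poly F}}) (t x : F) :
    ker lambda m t p.[x%:P].[t] q.[x%:P].[t] != 0 ->
  ker le m te (psi p) (psi q) != 0.
Proof.
move=> k0; rewrite -psi_ker; apply: (@psi_neq0 _ t x).
pose h : {rmorphism {poly {poly F}} -> F} := horner_eval t \o horner_eval x%:P.
have hl : h lambda%:P%:P = lambda by rewrite /h /= /horner_eval !hornerC.
have ht : h 'X%:P = t by rewrite /h /= /horner_eval hornerC hornerX.
have e := rmorph_ker h lambda%:P%:P m 'X%:P p q; rewrite hl ht in e.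
have {}e : (ker lambda%:P%:P m 'X%:P p q).[x%:P].[t]
   = ker lambda m t p.[x%:P].[t] q.[x%:P].[t] := e.
by rewrite e.
Qed.

Let psi0 : psi 0 = 0. Proof. exact: rmorph0. Qed.
Let psiN1 : psi (- 1) = - 1.
Proof. by apply: etrans (rmorphN psi 1) _; congr (- _); exact: rmorph1. Qed.

(** K(x,0) is nonzero because its value at x = t = 1 is. For [WeightedD] that value is lambda + 2,
    which may vanish; the denominators in y of this model are powers of 1 + y. *)
Lemma ker_rooty_neq0 m Y : m <> WeightedD -> ker le m te xe Y = 0 -> Y != 0.
Proof.
move=> mD; apply: contra_eq_neq => ->.
have := @ker_neq0 m 'X 0 1 1; rewrite psi_x psi0 hornerX hornerC !horner0; apply.
have -> : ker lambda m 1 1 0 =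
    (match m with
     | DoubleKreweras | WeightedE | WeightedG => 2 | WeightedF => 4 | _ => 1 end)%:R.
  by case: m mD => //= _; rewrite /ker /=; ring.
by apply: one_neq0; case: (m).
Qed.

Lemma ker_rooty_neqN1 m Y : ker le m te xe Y = 0 -> 1 + Y != 0.
Proof.
apply: contra_eq_neq => /eqP; rewrite addrC addr_eq0 => /eqP ->.
have := @ker_neq0 m 'X (- 1) 0 1.
rewrite psi_x psiN1 hornerX hornerC !hornerN !hornerC; apply.
(* At t = 0 the kernel of every model is -xy. *)
have -> : ker lambda m 0 1 (- 1) = 1 by case: (m); rewrite /ker /=; ring.
exact: oner_neq0.
Qed.

Lemma ker_rootx_neq0 m Y : ker le m te Y xe = 0 -> Y != 0.
Proof.
apply: contra_eq_neq => ->.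
have := @ker_neq0 m 0 'X 1 1; rewrite psi_x psi0 hornerX hornerC !horner0; apply.
have -> : ker lambda m 1 0 1 =
    (match m with Kreweras => 1 | WeightedF | WeightedG => 4 | _ => 2 end)%:R.
  by case: (m); rewrite /ker /=; ring.
by apply: one_neq0; case: (m).
Qed.

Lemma ker_rootx_neqN1 m Y : ker le m te Y xe = 0 -> 1 + Y != 0.
Proof.
apply: contra_eq_neq => /eqP; rewrite addrC addr_eq0 => /eqP ->.
have := @ker_neq0 m (- 1) 'X 0 1.
rewrite psi_x psiN1 hornerX hornerC !hornerN !hornerC; apply.
have -> : ker lambda m 0 (- 1) 1 = 1 by case: (m); rewrite /ker /=; ring.
exact: oner_neq0.
Qed.

Lemma te_neq0 : te != 0.
Proof. by rewrite -psi_t; apply: (@psi_neq0 _ 1 1); rewrite !hornerE oner_eq0. Qed.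

Lemma xe_neq0 : xe != 0.
Proof. by rewrite -psi_x; apply: (@psi_neq0 _ 1 1); rewrite !hornerE oner_eq0. Qed.

Lemma xe_neqN1 : 1 + xe != 0.
Proof.
rewrite -psi_x -(rmorph1 psi) -rmorphD; apply: (@psi_neq0 _ 1 0).
by rewrite !hornerE oner_eq0.
Qed.

End KernelRoots.

Section Kernel.
Variables (E : fieldType) (phi : {rmorphism RF -> E}).
Local Notation te := (phi (tFrac F)).
Local Notation xe := (phi (varFrac F)).
Local Notation le := (phi (weightFrac lambda)).

Let psi : {rmorphism {poly {poly F}} -> E} := phi \o to_ratFrac.

Let psi_x : psi 'X = xe. Proof. by rewrite /psi /= to_ratFracX. Qed.
Let psi_t : psi tt = te. Proof. exact: (congr1 phi (to_ratFracC 'X)). Qed.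
Let psi_l : psi ll = le. Proof. exact: (congr1 phi (to_ratFracC lambda%:P)). Qed.

Let psi_neq0 p (t x : F) : p.[x%:P].[t] != 0 -> psi p != 0.
Proof. by move/to_ratFrac_neq0; rewrite -(fmorph_eq0 phi). Qed.

Let weight1 : (phi \o @weightFrac F) 1 = 1.
Proof. exact: (rmorph1 (phi \o (@cst F \o (to_coefFrac \o @polyC F)))). Qed.

Let weight2 : (phi \o @weightFrac F) 2%:R = 2%:R.
Proof. exact: (rmorph_nat (phi \o (@cst F \o (to_coefFrac \o @polyC F))) 2). Qed.

Lemma root_ext_kernel m Y :
  root (ext_kernel phi (steps lambda m)) Y = (ker le m te xe Y == 0).
Proof. by rewrite rootE /ext_kernel horner_kernel_steps. Qed.

Lemma root_ext_kernel_swap m Y :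
  root (ext_kernel phi (swap_model (steps lambda m))) Y = (ker le m te Y xe == 0).
Proof. by rewrite rootE /ext_kernel horner_kernel_swap. Qed.

Lemma ext_rooty m Y : root (ext_kernel phi (steps lambda m)) Y ->
  [/\ ker le m te xe Y = 0, m <> WeightedD -> Y != 0 & 1 + Y != 0].
Proof.
rewrite root_ext_kernel => /eqP k0; split=> // [mD|].
  exact: (ker_rooty_neq0 psi_x psi_t psi_l psi_neq0 mD k0).
exact: (ker_rooty_neqN1 psi_x psi_t psi_l psi_neq0 k0).
Qed.

Lemma ext_rootx m Y : root (ext_kernel phi (swap_model (steps lambda m))) Y ->
  [/\ ker le m te Y xe = 0, Y != 0 & 1 + Y != 0].
Proof.
rewrite root_ext_kernel_swap => /eqP k0; split=> //.
  exact: (ker_rootx_neq0 psi_x psi_t psi_l psi_neq0 k0).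
exact: (ker_rootx_neqN1 psi_x psi_t psi_l psi_neq0 k0).
Qed.

Lemma ext_t_neq0 : te != 0. Proof. exact: (te_neq0 psi_t psi_neq0). Qed.
Lemma ext_x_neq0 : xe != 0. Proof. exact: (xe_neq0 psi_x psi_neq0). Qed.
Lemma ext_x_neqN1 : 1 + xe != 0. Proof. exact: (xe_neqN1 psi_x psi_neq0). Qed.

Definition eval_at (Y : E) : {poly FT} -> E :=
  horner_eval Y \o map_poly (phi \o @cst F).

HB.instance Definition _ Y := GRing.RMorphism.copy (eval_at Y)
  (horner_eval Y \o map_poly (phi \o @cst F)).

Lemma eval_atX Y : eval_at Y 'X = Y.
Proof. by rewrite /eval_at /= map_polyX /horner_eval hornerX. Qed.

Lemma eval_atC Y c : eval_at Y c%:P = phi (cst c).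
Proof.
exact: etrans (congr1 (horner_eval Y) (map_polyC (phi \o @cst F) c)) (hornerC _ _).
Qed.

Lemma ratval_eval_at (A B : {poly FT}) (Y v : E) :
  eval_at Y B != 0 -> v * eval_at Y B = eval_at Y A -> ratval phi (A%:F / B%:F) Y v.
Proof.
move=> B0 e; exists A, B.
by split; [reflexivity | exact: B0 | exact: (canRL (mulfK B0) e)].
Qed.

End Kernel.

Local Notation tp := ((('X : {poly F})%:F : FT)%:P : {poly FT}).
Local Notation lp := (((lambda%:P : {poly F})%:F : FT)%:P : {poly FT}).

Lemma frac_nonconst (A B : {poly FT}) (z : FT) :
  B != 0 -> B.[z] = 0 -> A.[z] != 0 -> ~ (exists c, A%:F / B%:F = cst c).
Proof.
move=> B0 Bz /eqP Az [c /(congr1 (fun a => a * B%:F))].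
rewrite mulfVK ?tofrac_eq0 // -tofracM => /eqP; rewrite tofrac_eq => /eqP AE.
by apply: Az; rewrite AE hornerM Bz mulr0.
Qed.

Lemma inv_den_neq0 (R : idomainType) m (y : R) :
  (m <> WeightedD -> y != 0) -> 1 + y != 0 -> inv_den m y != 0.
Proof.
by case: m => y0 y1; rewrite /= ?mulf_neq0 ?expf_neq0 //; apply: y0.
Qed.

Lemma inv_denx_neq0 (R : idomainType) m (x : R) :
  x != 0 -> 1 + x != 0 -> inv_denx m x != 0.
Proof. by case: m => x0 x1; rewrite /= ?mulf_neq0 ?expf_neq0. Qed.

Lemma dec_den_neq0 (R : idomainType) m (y : R) :
  (m <> WeightedD -> y != 0) -> 1 + y != 0 -> dec_den m y != 0.
Proof. by case: m => y0 y1; rewrite /= ?mulf_neq0 //; apply: y0. Qed.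

Lemma dec_scale_neq0 (R : idomainType) m (t : R) : t != 0 -> dec_scale m t != 0.
Proof. by case: m; rewrite /= ?oner_neq0. Qed.

Lemma dec_denx_neq0 (R : idomainType) m (t x : R) :
  t != 0 -> x != 0 -> 1 + x != 0 -> dec_denx m t x != 0.
Proof. by case: m => t0 x0 x1; rewrite /= ?mulf_neq0 ?expf_neq0. Qed.

Lemma kernel_roots_root (R : idomainType) (K : {poly R}) (a b : R) :
  kernel_roots K a b -> root K a /\ root K b.
Proof.
move=> [_ KE]; split; rewrite rootE KE hornerZ hornerM !hornerXsubC subrr.
  by rewrite mul0r mulr0.
by rewrite !mulr0.
Qed.

Lemma polyX1_neq0 (R : idomainType) : 1 + 'X != 0 :> {poly R}.
Proof.
apply/eqP => /(congr1 (horner^~ 0)) /eqP.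
by rewrite hornerD hornerX hornerC addr0 horner0 oner_eq0.
Qed.

Lemma steps_y_invariant m :
  y_invariant (steps lambda m) ((inv_num lp m tp 'X)%:F / (inv_den m 'X)%:F).
Proof.
have B0 : inv_den m 'X != 0 :> {poly FT}.
  by apply: inv_den_neq0 => [_|]; rewrite ?polyX_eq0 ?polyX1_neq0.
split=> [|E phi Y0 Y1 /kernel_roots_root[r0 r1]].
  (* I is not constant because it has a pole at z. *)
  pose z : FT := if m is WeightedD then -1 else 0.
  have evA : (inv_num lp m tp 'X).[z] = inv_num (to_coefFrac lambda%:P) m (to_coefFrac 'X) z.
    exact: horner_inv_num.
  have evB : (inv_den m 'X).[z] = inv_den m z by exact: horner_inv_den.
  apply: (@frac_nonconst _ _ z) => //; first by rewrite evB /z; case: (m) => /=; ring.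
  pose z' : {poly F} := if m is WeightedD then -1 else 0.
  have zE : z = to_coefFrac z'.
    by rewrite /z /z'; case: (m); rewrite ?rmorph0 // rmorphN rmorph1.
  rewrite evA zE -rmorph_inv_num.
  pose t0 : F := if m is WeightedD then 0 else 1.
  apply: (@to_coefFrac_neq0 _ t0); rewrite horner_inv_num_t.
  suff [n n0 ->] : exists2 n, (0 < n)%N & inv_num lambda m t0 z'.[t0]
      = (-1) ^+ (if m is (DoubleKreweras | WeightedF | WeightedG) then 1 else 0) * n%:R.
    by rewrite mulf_neq0 ?expf_neq0 ?oppr_eq0 ?oner_eq0 //; apply: nat_neq0_char0.
  exists (if m is WeightedF then 4 else 1)%N; first by case: (m).
  by rewrite /t0 /z'; case: (m); rewrite /= ?hornerN ?hornerC; ring.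
(* The common value at the two roots is J(x), which does not depend on the root. *)
pose v := inv_numx (phi (weightFrac lambda)) m (phi (tFrac F)) (phi (varFrac F))
  / inv_denx m (phi (varFrac F)).
have d0 := inv_denx_neq0 m (ext_x_neq0 phi) (ext_x_neqN1 phi).
suff val Y : root (ext_kernel phi (steps lambda m)) Y ->
    ratval phi ((inv_num lp m tp 'X)%:F / (inv_den m 'X)%:F) Y v.
  by exists v; apply: val.
move=> /ext_rooty[k0 Y0' Y1'].
have evA := image_inv_num m (eval_atC phi Y (to_coefFrac lambda%:P))
  (eval_atC phi Y (to_coefFrac 'X)) (eval_atX phi Y).
have evB := image_inv_den m (eval_atX phi Y).
apply: ratval_eval_at; rewrite evB ?inv_den_neq0 // evA /v.
have [c] := rational_invariant (phi (weightFrac lambda)) m (phi (tFrac F)) (phi (varFrac F)) Y.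
rewrite k0 mul0r => /eqP; rewrite subr_eq0 => /eqP e.
by apply: (mulIf d0); rewrite mulrAC mulfVK // mulrC -e.
Qed.

Lemma steps_x_invariant m :
  x_invariant (steps lambda m) ((inv_numx lp m tp 'X)%:F / (inv_denx m 'X)%:F).
Proof.
have B0 : inv_denx m 'X != 0 :> {poly FT}.
  by apply: inv_denx_neq0; rewrite ?polyX_eq0 ?polyX1_neq0.
split=> [|E phi Y0 Y1 /kernel_roots_root[r0 r1]].
  have evA : (inv_numx lp m tp 'X).[0]
      = inv_numx (to_coefFrac lambda%:P) m (to_coefFrac 'X) 0.
    exact: horner_inv_numx.
  have evB : (inv_denx m 'X).[0] = inv_denx m 0 :> FT by exact: horner_inv_denx.
  apply: (@frac_nonconst _ _ 0) => //; first by rewrite evB; case: (m) => /=; ring.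
  have zE : 0 = to_coefFrac 0 by rewrite rmorph0.
  rewrite evA [X in inv_numx _ _ _ X]zE -rmorph_inv_numx.
  apply: (@to_coefFrac_neq0 _ 1); rewrite horner_inv_numx_t horner0.
  suff [n n0 ->] : exists2 n, (0 < n)%N & inv_numx lambda m 1 0

      = (-1) ^+ (if m is (DoubleKreweras | Gessel | WeightedF) then 1 else 0) * n%:R.
    by rewrite mulf_neq0 ?expf_neq0 ?oppr_eq0 ?oner_eq0 //; apply: nat_neq0_char0.
  exists (if m is (WeightedF | WeightedG) then 4 else 1)%N; first by case: (m).
  by case: (m); rewrite /=; ring.
pose v := inv_num (phi (weightFrac lambda)) m (phi (tFrac F)) (phi (varFrac F))
  / inv_den m (phi (varFrac F)).
have d0 := inv_den_neq0 (fun _ : m <> WeightedD => ext_x_neq0 phi) (ext_x_neqN1 phi).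
suff val Y : root (ext_kernel phi (swap_model (steps lambda m))) Y ->
    ratval phi ((inv_numx lp m tp 'X)%:F / (inv_denx m 'X)%:F) Y v.
  by exists v; apply: val.
move=> /ext_rootx[k0 Y0' Y1'].
have evA := image_inv_numx m (eval_atC phi Y (to_coefFrac lambda%:P))
  (eval_atC phi Y (to_coefFrac 'X)) (eval_atX phi Y).
have evB := image_inv_denx m (eval_atX phi Y).
apply: ratval_eval_at; rewrite evB ?inv_denx_neq0 // evA /v.
have [c] := rational_invariant (phi (weightFrac lambda)) m (phi (tFrac F)) Y (phi (varFrac F)).
rewrite k0 mul0r => /eqP; rewrite subr_eq0 => /eqP e.
by apply: (mulIf d0); rewrite mulrAC mulfVK // e mulrC.
Qed.

Lemma steps_decoupled m : decoupled (steps lambda m).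
Proof.
exists (dec_numx m (tFrac F) (varFrac F)
  / (dec_scale m (tFrac F) * dec_denx m (tFrac F) (varFrac F))).
exists ((- dec_num lp m tp 'X)%:F / (dec_scale m tp * dec_den m 'X)%:F).
move=> E phi Y /ext_rooty[k0 Y0 Y1].
pose te := phi (tFrac F); pose xe := phi (varFrac F).
have t0 : te != 0 := ext_t_neq0 phi.
have s0 := dec_scale_neq0 m t0.
have d0 : dec_den m Y != 0 by apply: dec_den_neq0.
have dx0 := dec_denx_neq0 m t0 (ext_x_neq0 phi) (ext_x_neqN1 phi).
pose v := - dec_num (phi (weightFrac lambda)) m te Y / (dec_scale m te * dec_den m Y).
exists v.
  have evA := image_dec_num m (eval_atC phi Y (to_coefFrac lambda%:P))
    (eval_atC phi Y (to_coefFrac 'X)) (eval_atX phi Y).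
  have evB := image_dec_den m (eval_atX phi Y).
  have evS := image_dec_scale m (eval_atC phi Y (to_coefFrac 'X)).
  have evSB := etrans (rmorphM (eval_at phi Y) (dec_scale m tp) (dec_den m 'X))
    (congr2 *%R evS evB).
  have evN := etrans (rmorphN (eval_at phi Y) (dec_num lp m tp 'X)) (congr1 -%R evA).
  apply: ratval_eval_at; rewrite evSB; first by rewrite mulf_neq0.
  by rewrite evN /v mulfVK // mulf_neq0.
have ef : phi (dec_numx m (tFrac F) (varFrac F)
     / (dec_scale m (tFrac F) * dec_denx m (tFrac F) (varFrac F)))
   = dec_numx m te xe / (dec_scale m te * dec_denx m te xe).
  by rewrite fmorph_div rmorphM rmorph_dec_numx rmorph_dec_scale rmorph_dec_denx.
rewrite ef /v -/xe.
have [c] := decoupling_identity (phi (weightFrac lambda)) m te xe Y.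
rewrite k0 mul0r => /eqP; rewrite subr_eq0 => /eqP e.
have sd0 : dec_scale m te * dec_den m Y * dec_denx m te xe != 0.
  by rewrite mulf_neq0 // mulf_neq0.
apply: (mulfI sd0); rewrite -e.
by move: s0 d0 dx0; rewrite -/xe; move: (dec_scale _ _) (dec_den _ _) (dec_denx _ _ _);
  move=> a b c0 ha hb hc; field; rewrite ha hb hc.
Qed.

Lemma steps_rational_invariants m : has_rational_invariants (steps lambda m).
Proof. by split; eexists; [exact: steps_y_invariant | exact: steps_x_invariant]. Qed.

End RationalModels.

(** * The functional equation *)

Section FunctionalEquation.
Variables (F : fieldType) (S : model F).
Hypothesis small_steps : all (fun s : wstep F =>
  [&& (-1 <= s.1.1)%R, (s.1.1 <= 1)%R, (-1 <= s.1.2)%R & (s.1.2 <= 1)%R]) S.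

Lemma big_words_cons (f : seq (wstep F) -> F) n :
  \sum_(w <- words S n.+1) f w = \sum_(s <- S) \sum_(w <- words S n) f (s :: w).
Proof. by rewrite -[words S n.+1]/(allpairs_dep _ _ _) big_allpairs_dep. Qed.

Lemma big_words_rcons (f : seq (wstep F) -> F) n :
  \sum_(w <- words S n.+1) f w = \sum_(w <- words S n) \sum_(s <- S) f (rcons w s).
Proof.
elim: n f => [|n IHn] f.
  by rewrite big_words_cons big_seq1; apply: eq_bigr => s _; rewrite big_seq1.
rewrite !big_words_cons.
by apply: eq_bigr => s _; rewrite IHn.
Qed.

Lemma endpoint_rcons (w : seq (wstep F)) s :
  endpoint (rcons w s) = ((endpoint w).1 + s.1.1, (endpoint w).2 + s.1.2).
Proof. by rewrite /endpoint -cats1 !big_cat !big_seq1. Qed.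

Lemma in_quadrant_rcons (w : seq (wstep F)) s :
  in_quadrant (rcons w s)
    = in_quadrant w && ((0 <= (endpoint (rcons w s)).1)%R
                        && (0 <= (endpoint (rcons w s)).2)%R).
Proof.
rewrite /in_quadrant size_rcons -[(size w).+2]addn1 iotaD all_cat add0n.
congr (_ && _); last by rewrite /= andbT take_oversize ?size_rcons.
apply: eq_in_all => k; rewrite mem_iota add0n ltnS => /andP[_ lek].
by rewrite -cats1 takel_cat.
Qed.

Lemma in_quadrant_endpoint (w : seq (wstep F)) : in_quadrant w ->
  (0 <= (endpoint w).1)%R && (0 <= (endpoint w).2)%R.
Proof.
move/allP/(_ (size w)); rewrite take_size; apply.
by rewrite mem_iota add0n ltnS leqnn.
Qed.

(** Endpoints range over all of Z^2, with value 0 outside the quadrant; the recurrence on the last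
    step then has no boundary cases. *)
Definition walks (n : nat) (p : int * int) : F :=
  \sum_(w <- words S n | in_quadrant w && (endpoint w == p)) \prod_(s <- w) s.2.

Lemma walks_out n p : ~~ ((0 <= p.1)%R && (0 <= p.2)%R) -> walks n p = 0.
Proof.
move=> np; rewrite /walks big1 // => w /andP[/in_quadrant_endpoint qw /eqP ep].
by rewrite ep (negPf np) in qw.
Qed.

Lemma walks0 p : walks 0 p = (p == (0, 0))%:R.
Proof.
rewrite /walks /= big_mkcond big_seq1 big_nil /in_quadrant /= /endpoint !big_nil.
by rewrite eq_sym; case: eqP.
Qed.

Lemma walksS n p : (0 <= p.1)%R && (0 <= p.2)%R ->
  walks n.+1 p = \sum_(s <- S) s.2 * walks n (p.1 - s.1.1, p.2 - s.1.2).
Proof.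
move=> qp; rewrite /walks big_mkcond big_words_rcons exchange_big /=.
apply: eq_bigr => s _; rewrite mulr_sumr [RHS]big_mkcond /=.
apply: eq_bigr => w _; rewrite in_quadrant_rcons -andbA.
case: (in_quadrant w); rewrite !(andTb, andFb) //.
have -> : (endpoint (rcons w s) == p) = (endpoint w == (p.1 - s.1.1, p.2 - s.1.2)).
  rewrite endpoint_rcons; case: (p) => a b; case: (endpoint w) => c d.
  have eqB (x y z : int) : (x + y == z) = (x == z - y).
    by rewrite eq_sym -subr_eq eq_sym.
  by rewrite !xpair_eqE; congr (_ && _); exact: eqB.
case: eqP => [ep|_]; last by rewrite andbF.
have -> : endpoint (rcons w s) = p.
  by rewrite endpoint_rcons ep /= !subrK; case: (p).
by rewrite qp /= -cats1 big_cat big_seq1 mulrC.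
Qed.

Lemma walks_bound n p : (n%:Z < p.1)%R || (n%:Z < p.2)%R -> walks n p = 0.
Proof.
elim: n p => [|n IHn] p hp.
  by rewrite walks0; case: eqP => // pE; rewrite pE in hp.
have [qp|] := boolP ((0 <= p.1)%R && (0 <= p.2)%R); last exact: walks_out.
rewrite walksS // big_seq big1 // => s /(allP small_steps) /and4P[h1 h2 h3 h4].
rewrite IHn ?mulr0 //=.
have ltB (a b : int) : (n.+1%:Z < a)%R -> (b <= 1)%R -> (n%:Z < a - b)%R by lia.
by move: hp; case/orP => hp; apply/orP; [left|right]; apply: ltB.
Qed.

Lemma coef_gen_fun n i j : (fps_coef (gen_fun S) n)`_j`_i = walks n (i%:Z, j%:Z).
Proof.
rewrite /gen_fun fps_coefE coef_poly; case: ltnP => [_|ltnj].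
  rewrite coef_poly; case: ltnP => [//|ltni].
  by rewrite walks_bound //=; apply/orP; left; lia.
by rewrite coef0 walks_bound //=; apply/orP; right; lia.
Qed.

(** The step polynomial multiplied by xy, which makes all exponents nonnegative. *)
Definition step_poly : {poly {poly F}} :=
  \sum_(s <- S) (s.2%:P * 'X^(absz (1 + s.1.1)))%:P * 'X^(absz (1 + s.1.2)).

Definition set_x0 : {poly {poly F}} -> {poly {poly F}} :=
  map_poly (polyC \o horner_eval 0).
HB.instance Definition _ := GRing.RMorphism.copy set_x0
  (map_poly (@polyC F \o horner_eval 0)).

Definition set_y0 : {poly {poly F}} -> {poly {poly F}} := polyC \o horner_eval 0.
HB.instance Definition _ := GRing.RMorphism.copy set_y0
  (@polyC {poly F} \o horner_eval 0).

Lemma coef_set_x0 p i j : (set_x0 p)`_j`_i = if i == 0%N then p`_j`_0 else 0.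
Proof. by rewrite /set_x0 coef_map /= coefC /horner_eval horner_coef0. Qed.

Lemma coef_set_y0 p i j : (set_y0 p)`_j`_i = if j == 0%N then p`_0`_i else 0.
Proof.
by rewrite /set_y0 /= coefC /horner_eval horner_coef0; case: eqP; rewrite ?coef0.
Qed.

Lemma coef_step_poly_gen_fun n i j :
  (step_poly * fps_coef (gen_fun S) n)`_j.+1`_i.+1 = walks n.+1 (i%:Z, j%:Z).
Proof.
rewrite walksS // /step_poly mulr_suml !coef_sum !big_seq.
apply: eq_bigr => s /(allP small_steps) /and4P[h1 h2 h3 h4].
rewrite -mulrA coefCM -mulrA coefCM coefXnM coefXnM.
have out : (i%:Z - s.1.1 < 0)%R || (j%:Z - s.1.2 < 0)%R ->
    walks n (i%:Z - s.1.1, j%:Z - s.1.2) = 0.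
  move=> lt0; apply: walks_out; rewrite /= negb_and -!Order.TotalTheory.ltNge.
  exact: lt0.
have lt_index (k : nat) (a : int) : (k.+1 < absz (1 + a)%R)%N -> (-1 <= a)%R -> (k%:Z - a < 0)%R.
  by lia.
have sub_index (k : nat) (a : int) : (absz (1 + a)%R <= k.+1)%N -> (-1 <= a)%R ->
    (k.+1 - absz (1 + a)%R)%N%:Z = k%:Z - a.
  by lia.
case: ltnP => [lti|lei].
  by rewrite out //; apply/orP; left; apply: lt_index.
case: ltnP => [ltj|lej].
  by rewrite coef0 out //; apply/orP; right; apply: lt_index.
by rewrite coef_gen_fun; congr (_ * walks _ (_, _)); apply: sub_index.
Qed.

(** The coefficient of x^(i+1) y^(j+1) is the recurrence on the last step. The monomials with
    exponent 0 in x or in y are forbidden arrivals; they are removed by inclusion-exclusion. *)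
Lemma gen_fun_equation :
  (fpsX _ * fpsC step_poly - fpsC ('X%:P * 'X)) * gen_fun S
   = fpsX _ * fpsC (set_y0 step_poly) * fps_map set_y0 (gen_fun S)
   + fpsX _ * fpsC (set_x0 step_poly) * fps_map set_x0 (gen_fun S)
   - fpsX _ * fpsC (set_x0 (set_y0 step_poly)) * fps_map set_x0 (fps_map set_y0 (gen_fun S))
   - fpsC ('X%:P * 'X).
Proof.
apply: fpsP => n; rewrite mulrBl !(fps_coefB, fps_coefD) -!mulrA.
have coefxy (p : {poly {poly F}}) i j : ('X%:P * 'X * p)`_j`_i
    = if (i == 0)%N || (j == 0)%N then 0 else p`_j.-1`_i.-1.
  rewrite -mulrA coefCM coefXM; case: j => [|j].
    by rewrite /= mulr0 coef0 orbT.
  by rewrite mulrC coefMX; case: i.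
have X0 (a : fps {poly {poly F}}) : fps_coef (fpsX _ * a) 0 = 0 by rewrite fps_coefXM.
have XS (a : fps {poly {poly F}}) k : fps_coef (fpsX _ * a) k.+1 = fps_coef a k.
  by rewrite fps_coefXM.
case: n => [|n]; apply/polyP => j; apply/polyP => i.
  rewrite !X0 !fps_coefCM fps_coefC !(sub0r, subr0, addr0) !coefN coefxy.
  rewrite -['X%:P * 'X in RHS]mulr1 coefxy.
  case: ifP => // /norP[i0 j0]; rewrite coef_gen_fun walks0 coefC.
  by case: i i0 => // -[|i] _; case: j j0 => // -[|j] _; rewrite ?coef0 ?coefC.
rewrite !XS !fps_coefCM fps_coefC subr0 !fps_coefE -!rmorphM.
set p := step_poly * _.
rewrite !(coefB, coefD) coefxy !coef_set_x0 !coef_set_y0.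
case: i => [|i]; first by rewrite /=; ring.
case: j => [|j]; first by rewrite /=; ring.
by rewrite /= coef_step_poly_gen_fun coef_gen_fun; ring.
Qed.

End FunctionalEquation.

(** * Invariants with polynomial coefficients *)

Lemma no_lt0 i (P : Prop) : (i < 0)%N -> P.
Proof. by []. Qed.

Lemma fps_headB (A : comNzRingType) (a b : fps A) :
  fps_head (a - b) = fps_head a - fps_head b.
Proof. exact: rmorphB. Qed.

Lemma fps_headM (A : comNzRingType) (a b : fps A) :
  fps_head (a * b) = fps_head a * fps_head b.
Proof. exact: rmorphM. Qed.

Lemma fps_map_factor (A B : comNzRingType) (f : {rmorphism A -> B}) (c : A) (a : fps A) :
    (forall p, f p = 0 -> exists q, p = c * q) -> fps_map f a = 0 ->
  exists b, a = fpsC c * b.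
Proof.
move=> fc fa0; have ex n : exists q, fps_coef a n = c * q.
  by apply: fc; have := congr1 (fun b => fps_coef b n) fa0; rewrite /= fps_coef0.
exists (FPS (fun n => projT1 (cid (ex n)))); apply: fpsP => n.
by rewrite fps_coefCM fps_coefE; case: (cid _).
Qed.

Lemma horner_factor (A : comNzRingType) (b : A) (p : {poly A}) :
  horner_eval b p = 0 -> exists q, p = ('X - b%:P) * q.
Proof. by move/eqP/factor_theorem => [q ->]; exists q; rewrite mulrC. Qed.

Lemma map_horner_factor (A : comNzRingType) (b : A) (p : {poly {poly A}}) :
  map_poly (horner_eval b) p = 0 -> exists q, p = ('X - b%:P)%:P * q.
Proof.
move=> /polyP p0; have ex n : exists q, p`_n = ('X - b%:P) * q.
  by apply: horner_factor; have := p0 n; rewrite coef_map coef0.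
exists (\poly_(i < size p) projT1 (cid (ex i))); apply/polyP => n.
rewrite coefCM coef_poly; case: ltnP => [_|/leq_sizeP->//]; last by rewrite mulr0.
by case: (cid _).
Qed.

Section TwoVariables.
Variable F : fieldType.
Local Notation R := (fps {poly F}).
Local Notation P := (fps {poly {poly F}}).

Definition const_ser : fps F -> R := fps_map polyC.
Definition in_x : R -> P := fps_map polyC.
Definition in_y : R -> P := fps_map (map_poly polyC).
Definition at_var (b : F) : R -> fps F := fps_map (horner_eval b).
Definition at_x (b : F) : P -> R := fps_map (map_poly (horner_eval b)).
Definition at_y (b : F) : P -> R := fps_map (horner_eval b%:P).

HB.instance Definition _ := GRing.RMorphism.copy const_ser (fps_map (@polyC F)).
HB.instance Definition _ := GRing.RMorphism.copy in_x (fps_map (@polyC {poly F})).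
HB.instance Definition _ := GRing.RMorphism.copy in_y (fps_map (map_poly (@polyC F))).
HB.instance Definition _ b := GRing.RMorphism.copy (at_var b) (fps_map (horner_eval b)).
HB.instance Definition _ b :=
  GRing.RMorphism.copy (at_x b) (fps_map (map_poly (horner_eval b))).
HB.instance Definition _ b := GRing.RMorphism.copy (at_y b) (fps_map (horner_eval b%:P)).

Lemma at_y_in_x b a : at_y b (in_x a) = a.
Proof. by apply: fpsP => n; rewrite !fps_coefE; apply: hornerC. Qed.

Lemma at_x_in_y b a : at_x b (in_y a) = a.
Proof.
apply: fpsP => n; rewrite !fps_coefE; apply/polyP => i.
by rewrite !coef_map; apply: hornerC.
Qed.

Lemma at_x_in_x b a : at_x b (in_x a) = const_ser (at_var b a).
Proof. by apply: fpsP => n; rewrite !fps_coefE; apply: map_polyC. Qed.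

Lemma at_y_in_y b a : at_y b (in_y a) = const_ser (at_var b a).
Proof. by apply: fpsP => n; rewrite !fps_coefE; apply: horner_map. Qed.

Lemma at_var_const b c : at_var b (const_ser c) = c.
Proof. by apply: fpsP => n; rewrite !fps_coefE; apply: hornerC. Qed.

Lemma in_y_const c : in_y (const_ser c) = in_x (const_ser c).
Proof. by apply: fpsP => n; rewrite !fps_coefE; apply: map_polyC. Qed.

Lemma coef_in_x a n j : (fps_coef (in_x a) n)`_j = if j == 0%N then fps_coef a n else 0.
Proof. exact: coefC. Qed.

Lemma coef_in_y a n j : (fps_coef (in_y a) n)`_j = ((fps_coef a n)`_j)%:P.
Proof. exact: coef_map. Qed.

Lemma in_x_inj : injective in_x.
Proof. exact: can_inj (at_y_in_x 0). Qed.

Lemma in_y_inj : injective in_y.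
Proof. exact: can_inj (at_x_in_y 0). Qed.

Lemma in_x_eq0 a : (in_x a == 0) = (a == 0).
Proof. exact: raddf_eq0 in_x_inj. Qed.

Lemma in_y_eq0 a : (in_y a == 0) = (a == 0).
Proof. exact: raddf_eq0 in_y_inj. Qed.

Lemma const_ser_inj : injective const_ser.
Proof. exact: can_inj (at_var_const 0). Qed.

Definition var : R := fpsC 'X.

Lemma at_var_var b : at_var b var = fpsC b.
Proof. exact: etrans (fps_mapC (horner_eval b) _) (congr1 (@fpsC F) (hornerX b)). Qed.

Lemma var_sub_neq0 b : var - const_ser (fpsC b) != 0.
Proof.
apply/eqP => /(congr1 (fun a : R => (fps_coef a 0)`_1)) /eqP.
rewrite fps_coef0 coef0 fps_coefB coefB /var fps_coefC coefX.
by rewrite /const_ser fps_coefE coefC subr0 oner_eq0.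
Qed.

Lemma at_yM b (a c : P) : at_y b (a * c) = at_y b a * at_y b c.
Proof. exact: rmorphM. Qed.

Lemma at_yD b (a c : P) : at_y b (a + c) = at_y b a + at_y b c.
Proof. exact: rmorphD. Qed.

Lemma at_xM b (a c : P) : at_x b (a * c) = at_x b a * at_x b c.
Proof. exact: rmorphM. Qed.

Lemma at_xD b (a c : P) : at_x b (a + c) = at_x b a + at_x b c.
Proof. exact: rmorphD. Qed.

Lemma at_var_factor b a : at_var b a = 0 -> exists c, a = (var - const_ser (fpsC b)) * c.
Proof.
move/(@fps_map_factor _ _ _ ('X - b%:P)) => [p /horner_factor//|c ->].
by exists c; rewrite /var /const_ser fps_mapC rmorphB.
Qed.

Lemma at_x_factor b a : at_x b a = 0 ->
  exists c, a = in_x (var - const_ser (fpsC b)) * c.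
Proof.
move/(@fps_map_factor _ _ _ ('X - b%:P)%:P) => [p /map_horner_factor//|c ->].
by exists c; rewrite /var /const_ser !fps_mapC -(rmorphB (@fpsC _)) /in_x fps_mapC.
Qed.

Lemma at_y_factor b a : at_y b a = 0 ->
  exists c, a = in_y (var - const_ser (fpsC b)) * c.
Proof.
move/(@fps_map_factor _ _ _ ('X - b%:P%:P)) => [p /horner_factor//|c ->].
exists c; rewrite /var /const_ser !fps_mapC -(rmorphB (@fpsC _)) /in_y fps_mapC.
congr (fpsC _ * _); apply: esym; rewrite [LHS]rmorphB.
by congr (_ - _); [apply: map_polyX | apply: map_polyC].
Qed.

Lemma const_ser0 : const_ser (fpsC 0) = 0.
Proof.
exact: etrans (congr1 const_ser (rmorph0 (@fpsC F))) (rmorph0 const_ser).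
Qed.

Lemma const_serN1 : const_ser (fpsC (- 1)) = - 1.
Proof.
have e : fpsC (- 1 : F) = - 1 by rewrite rmorphN rmorph1.
by rewrite e; apply: etrans (rmorphN const_ser 1) _; congr (- _); exact: rmorph1.
Qed.

Lemma var_subC0 : var = var - const_ser (fpsC 0).
Proof. by rewrite const_ser0 subr0. Qed.

Lemma var_subCN1 : 1 + var = var - const_ser (fpsC (- 1)).
Proof. by rewrite const_serN1 opprK addrC. Qed.

Lemma var_neq0 : var != 0. Proof. by rewrite var_subC0 var_sub_neq0. Qed.
Lemma var1_neq0 : 1 + var != 0. Proof. by rewrite var_subCN1 var_sub_neq0. Qed.

(** * Pairs of invariants without poles are trivial *)

Section InvariantPairs.
Variable K : P.
Hypothesis K0 : fps_head K = - ('X%:P * 'X).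

(* Together with the lowest order argument of [admits_one], these are the
   properties of K that make an invariant pair with no pole trivial. *)
Definition nonconstant_in_y (k : R) :=
  forall (c : fps F) (h : R), const_ser c = k * h -> h = 0.

(** d is an admissible denominator for the side in x; the property is built up from 1 by adjoining
    the factors t, x and 1 + x. *)
Definition admits (d : R) := forall (N M : R) (H : P),
  in_x N - in_x d * in_y M = K * H -> H = 0.

(** If H has lowest coefficient H_n in t, that of K H is -xy H_n and has mixed monomials only, while
    N(x) - M(y) has none. *)
Lemma admits_one : admits 1.
Proof.
move=> N M H; rewrite rmorph1 mul1r => eq_KH; apply: contrapT => /eqP H_neq0.
have [n Hn lowH] := fps_order H_neq0.
have := @fps_coefM_low _ 0 n K H (fun i => @no_lt0 i _) lowH.
rewrite -eq_KH add0n fps_coefB -/(fps_head K) K0 => /polyP eqn.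
case/eqP: Hn; apply/polyP => j; apply/polyP => i; rewrite !coef0.
have := congr1 (fun p : {poly F} => p`_i.+1) (eqn j.+1).
rewrite coefB coef_in_x coef_in_y sub0r coefN coefC /= oppr0 mulNr -mulrA coefN.
by rewrite coefCM coefXM coefN coefXM /= => /eqP; rewrite eq_sym oppr_eq0 => /eqP.
Qed.

(** At t = 0 the equation reads N = -xy H with N free of y, so N and H are both divisible by t. *)
Lemma admits_t d : admits d -> admits (fpsX _ * d).
Proof.
move=> ad N M H eq_KH.
have hN : fps_head N = 0 /\ fps_head H = 0.
  have /polyP eq0 := congr1 (@fps_head _) eq_KH.
  have {}eq0 j : (fps_head (in_x N))`_j = (- ('X%:P * 'X) * fps_head H)`_j.
    rewrite -K0 -fps_headM -eq0 fps_headB fps_headM.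
    have -> : fps_head (in_x (fpsX _ * d)) = 0.
      by rewrite /fps_head fps_coefE -/(fps_head _) fps_headM fps_headX mul0r rmorph0.
    by rewrite mul0r subr0.
  have hN : fps_head N = 0.
    have := eq0 0%N; rewrite /fps_head coef_in_x /= => ->.
    by rewrite mulNr -mulrA coefN coefCM coefXM /= mulr0 oppr0.
  split=> //; apply/polyP => j; rewrite coef0.
  have := eq0 j.+1; rewrite /fps_head coef_in_x /= mulNr -mulrA coefN coefCM coefXM /=.
  by move/eqP; rewrite eq_sym oppr_eq0 mulf_eq0 polyX_eq0 => /eqP.
have [[N' NE] [H' HE]] := (fps_head_eq0 hN.1, fps_head_eq0 hN.2).
rewrite HE (ad N' M H') ?mulr0 //; apply: (mulfI (fpsX_neq0 _)).
transitivity (in_x N - in_x (fpsX _ * d) * in_y M).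
  by rewrite NE !rmorphM /= [in_x (fpsX _)]fps_mapX; ring.
by rewrite eq_KH HE; ring.
Qed.

(** At x = b the left-hand side is free of y while K(b,y) is not; hence H vanishes there, then N,
    and x - b can be divided out. *)
Lemma admits_x b d : nonconstant_in_y (at_x b K) -> admits d ->
  admits ((var - const_ser (fpsC b)) * d).
Proof.
move=> Kb ad N M H eq_KH.
have zb : at_var b (var - const_ser (fpsC b)) = 0.
  by rewrite rmorphB /= at_var_var at_var_const subrr.
have eqb : const_ser (at_var b N) = at_x b K * at_x b H.
  rewrite -rmorphM -eq_KH rmorphB !rmorphM /= !at_x_in_x zb.
  by rewrite rmorph0 !mul0r subr0.
have H0 := Kb _ _ eqb.
have N0 : at_var b N = 0.
  by apply: const_ser_inj; rewrite eqb H0 mulr0 rmorph0.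
have [[N' NE] [H' HE]] := (at_var_factor N0, at_x_factor H0).
rewrite HE (ad N' M H') ?mulr0 //.
have z_neq0 : in_x (var - const_ser (fpsC b)) != 0.
  by rewrite in_x_eq0 var_sub_neq0.
apply: (mulfI z_neq0).
transitivity (in_x N - in_x ((var - const_ser (fpsC b)) * d) * in_y M).
  by rewrite NE !(rmorphM in_x); ring.
by rewrite eq_KH HE; ring.
Qed.

Definition cancels (e : R) := forall (A H : P),
  in_y e * A = K * H -> exists H', A = K * H'.

Lemma cancels_one : cancels 1.
Proof. by move=> A H; rewrite rmorph1 mul1r; exists H. Qed.

(** At y = b the left-hand side vanishes and K(x,b) does not, so the factor y - b goes into H. *)
Lemma cancels_y b e : at_y b K != 0 -> cancels e ->
  cancels ((var - const_ser (fpsC b)) * e).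
Proof.
move=> Kb ce A H; rewrite rmorphM -mulrA => eq_KH.
have /eqP : at_y b K * at_y b H = 0.
  have z0 : at_var b (var - const_ser (fpsC b)) = 0.
    by rewrite rmorphB /= at_var_var at_var_const subrr.
  by rewrite -at_yM -eq_KH at_yM at_y_in_y z0 rmorph0 mul0r.
rewrite mulf_eq0 (negPf Kb) /= => /eqP /at_y_factor[H' HE].
apply: (ce A H').
have z_neq0 : in_y (var - const_ser (fpsC b)) != 0.
  by rewrite in_y_eq0 var_sub_neq0.
by apply: (mulfI z_neq0); rewrite eq_KH HE; ring.
Qed.

Lemma trivial_invariant_pair (e d N M : R) (H : P) :
    cancels e -> admits d -> d != 0 ->
    in_y e * (in_x N - in_x d * in_y M) = K * H ->
  exists r, M = const_ser r /\ N = d * const_ser r.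
Proof.
move=> ce ad d_neq0 /ce[H' eq_KH].
have /eqP := eq_KH; rewrite (ad _ _ _ eq_KH) mulr0 subr_eq0 => /eqP eqN.
exists (at_var 0 M).
have NE : N = d * const_ser (at_var 0 M).
  have := congr1 (at_y 0) eqN; rewrite at_y_in_x => ->.
  exact: etrans (at_yM 0 _ _) (congr2 *%R (at_y_in_x 0 d) (at_y_in_y 0 M)).
split=> //; apply: in_y_inj.
have dx : in_x d != 0 by rewrite in_x_eq0.
by apply: (mulfI dx); rewrite -eqN NE rmorphM in_y_const.
Qed.

End InvariantPairs.

(** In the product k h the lowest coefficient in t has positive degree unless h = 0. *)
Lemma nonconstant_head (k : R) : (1 < size (fps_head k))%N -> nonconstant_in_y k.
Proof.
move=> k1 c h eqc; apply: contrapT => /eqP h_neq0.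
have [n hn lowh] := fps_order h_neq0.
have := @fps_coefM_low _ 0 n k h (fun i => @no_lt0 i _) lowh.
rewrite -eqc add0n fps_coefE -/(fps_head k) => /(congr1 (fun p : {poly F} => size p)).
rewrite size_polyC size_mul // -?size_poly_gt0; last exact: ltnW.
have aux (a b : nat) (B : bool) : (1 < a)%N -> (0 < b)%N -> B = (a + b).-1 :> nat -> False.
  by case: B; lia.
by apply: aux => //; rewrite size_poly_gt0.
Qed.

Lemma nonconstant_t (k : R) : nonconstant_in_y k -> nonconstant_in_y (fpsX _ * k).
Proof.
move=> nk c h eqc.
have c0 : fps_head c = 0.
  have := congr1 (@fps_head _) eqc; rewrite !fps_headM fps_headX !mul0r.
  by rewrite /fps_head fps_coefE => /eqP; rewrite polyC_eq0 => /eqP.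
have [c' cE] := fps_head_eq0 c0; apply: (nk c' h).
apply: (mulfI (fpsX_neq0 _)); rewrite mulrA -eqc cE rmorphM; congr (_ * _).
by rewrite [RHS]fps_mapX.
Qed.

End TwoVariables.

(* phi(m) + I (r m + s) is a polynomial in m and I; it is congruent to itself
   modulo K when m and I are replaced by m1 = mu1/g1 and J = n/d. *)
Lemma invariant_combination (R : comNzRingType)
    (K A B n d mu g mu1 g1 X1 X2 M c3 c2 c1 r s : R) :
    g * mu1 - g1 * mu = K * X1 -> A * d - B * n = K * X2 ->
    B * (c3 * mu ^+ 3 + c2 * mu ^+ 2 * g + c1 * mu * g ^+ 2)
      + A * (r * mu * g ^+ 2 + s * g ^+ 3) = B * g ^+ 3 * M ->
  exists H, B * g ^+ 3 * (d * (c3 * mu1 ^+ 3 + c2 * mu1 ^+ 2 * g1 + c1 * mu1 * g1 ^+ 2)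
      + n * (r * mu1 * g1 ^+ 2 + s * g1 ^+ 3) - d * g1 ^+ 3 * M) = K * H.
Proof.
move=> E1 E2 E3.
(* With denominators cleared, a - b divides the difference of the cubic parts; the mixed part uses J
   m1 - I m = J (m1 - m) + m (J - I). *)
pose a := g * mu1; pose b := g1 * mu.
pose f1 := B * d * (c3 * (a ^+ 2 + a * b + b ^+ 2) + c2 * (a + b) * (g * g1)
  + c1 * (g * g1) ^+ 2) + r * (g * g1) ^+ 2 * (B * n).
pose f2 := r * (g * g1) ^+ 2 * b + s * (g * g1) ^+ 3.
exists (X1 * f1 - X2 * f2).
transitivity (f1 * (g * mu1 - g1 * mu) - f2 * (A * d - B * n)
  + d * g1 ^+ 3 * (B * (c3 * mu ^+ 3 + c2 * mu ^+ 2 * g + c1 * mu * g ^+ 2)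
      + A * (r * mu * g ^+ 2 + s * g ^+ 3) - B * g ^+ 3 * M)).
  by rewrite /f1 /f2 /a /b; ring.
by rewrite E3 subrr E1 E2; ring.
Qed.

Local Notation set_y0r F := (@set_y0 F : {rmorphism {poly {poly F}} -> {poly {poly F}}}).
Local Notation set_x0r F := (@set_x0 F : {rmorphism {poly {poly F}} -> {poly {poly F}}}).

(** * The functional equation in terms of the kernel, and the second pair of invariants *)

Section Catalytic.
Variables (F : fieldType) (char0 : [pchar F] =i pred0) (lambda : F) (m : model_name).
Local Notation R := (fps {poly F}).
Local Notation P := (fps {poly {poly F}}).
Local Notation S := (steps lambda m).

Let t : R := fpsX _.
Let l : R := const_ser (fpsC lambda).
Let z : R := var F.

Lemma small_steps_model : all (fun s : wstep F =>
  [&& (-1 <= s.1.1)%R, (s.1.1 <= 1)%R, (-1 <= s.1.2)%R & (s.1.2 <= 1)%R]) S.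
Proof. by case: m. Qed.

Definition model_ker : P := ker (in_x l) m (in_x t) (in_x z) (in_y z).
Local Notation K := model_ker.

Definition series_y : R := at_x 0 (gen_fun S).
Definition series_x : R := at_y 0 (gen_fun S).
Definition series_00 : fps F := at_var 0 series_y.

Lemma step_polyE : step_poly S
  = ker lambda%:P%:P m 1 'X%:P 'X + 'X%:P * 'X.
Proof.
rewrite /step_poly /ker.
by case: m; rewrite !big_cons big_nil /= ?polyCM ?polyCD ?rmorphXn ?polyC1 /=; ring.
Qed.

Lemma ker_linear_t (A : comNzRingType) (a b x y : A) :
  ker a m b x y = b * (ker a m 1 x y + x * y) - x * y.
Proof. by rewrite /ker; case: m => /=; ring. Qed.

Lemma model_kerE : fpsX _ * fpsC (step_poly S) - fpsC ('X%:P * 'X) = K.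
Proof.
rewrite step_polyE /K [RHS]ker_linear_t.
have xE : in_x z = fpsC 'X%:P :> P by exact: fps_mapC.
have yE : in_y z = fpsC 'X :> P.
  by apply: etrans (fps_mapC _ _) _; congr fpsC; apply: map_polyX.
have tE : in_x t = fpsX _ :> P by exact: fps_mapX.
have lE : in_x l = fpsC lambda%:P%:P :> P.
  by rewrite /l; apply: etrans (congr1 (@in_x F) (fps_mapC _ _)) (fps_mapC _ _).
rewrite xE yE tE lE.
have e : fpsC (ker lambda%:P%:P m 1 'X%:P 'X) = ker (fpsC lambda%:P%:P) m (fpsC 1)
    (fpsC 'X%:P) (fpsC 'X) := rmorph_ker (@fpsC {poly {poly F}}) _ m _ _ _.
have fpsCM (a b : {poly {poly F}}) : fpsC (a * b) = fpsC a * fpsC b by exact: rmorphM.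
have fpsCD (a b : {poly {poly F}}) : fpsC (a + b) = fpsC a + fpsC b by exact: rmorphD.
by rewrite fpsCD e rmorph1 fpsCM.
Qed.

Lemma at_y_ker b : at_y b K = ker l m t z (const_ser (fpsC b)).
Proof.
have e : at_y b K = ker (at_y b (in_x l)) m (at_y b (in_x t)) (at_y b (in_x z))
    (at_y b (in_y z)) := rmorph_ker (at_y b) _ m _ _ _.
by rewrite e !at_y_in_x at_y_in_y at_var_var.
Qed.

Lemma at_x_ker b : at_x b K = ker l m t (const_ser (fpsC b)) z.
Proof.
have tE : t = const_ser (fpsX _) by apply: esym; exact: fps_mapX.
have e : at_x b K = ker (at_x b (in_x l)) m (at_x b (in_x t)) (at_x b (in_x z))
    (at_x b (in_y z)) := rmorph_ker (at_x b) _ m _ _ _.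
have lE : at_var b l = fpsC lambda := at_var_const b _.
have tE' : at_var b t = fpsX _ by rewrite tE at_var_const.
rewrite e at_x_in_y (at_x_in_x b l) (at_x_in_x b t) (at_x_in_x b z).
by rewrite at_var_var lE tE' -tE.
Qed.

Lemma ker_y0 (A : comNzRingType) (a b x : A) : ker a m b x 0 = ker0 a m b x.
Proof. by rewrite /ker expr2 !mulr0 !add0r. Qed.

(** The term in Q(0,0) is attached to the part in x, so that the right-hand side has the shape u(x)
    + v(y) - xy required by decoupling. *)
Lemma functional_equation : K * gen_fun S
  = in_x (ker0 l m t z * series_x - const_ser (ker0 (fpsC lambda) m (fpsX _) 0 * series_00))
    + in_y (ker l m t 0 z * series_y) - in_x z * in_y z.
Proof.
have := gen_fun_equation small_steps_model; rewrite model_kerE => ->.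
have c0 := const_ser0 F.
have xyE : fpsC ('X%:P * 'X) = in_x z * in_y z :> P.
  have xE : in_x z = fpsC 'X%:P :> P by exact: fps_mapC.
  have yE : in_y z = fpsC 'X :> P.
    by apply: etrans (fps_mapC _ _) _; congr fpsC; apply: map_polyX.
  by rewrite xE yE; exact: rmorphM.
have set_yE (a : P) : fps_map (set_y0r F) a = in_x (at_y 0 a).
  apply: fpsP => n; have z0 : 0 = 0%:P :> {poly F} by rewrite polyC0.
  exact: (congr1 (fun c => ((fps_coef a n).[c])%:P) z0).
have set_xE (a : P) : fps_map (set_x0r F) a = in_y (at_x 0 a).
  by apply: fpsP => n; exact: map_poly_comp.
have stepE : fpsX _ * fpsC (step_poly S) = K + in_x z * in_y z :> P.
  by rewrite -model_kerE -xyE subrK.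
have set_y_step : fpsX _ * fpsC (set_y0 (step_poly S)) = in_x (ker0 l m t z) :> P.
  transitivity (fps_map (set_y0r F) (fpsX _ * fpsC (step_poly S))).
    apply: esym; apply: etrans (rmorphM (fps_map (set_y0r F)) _ _) _.
    by congr (_ * _); [exact: fps_mapX | exact: fps_mapC].
  rewrite set_yE stepE; congr in_x; rewrite at_yD at_yM at_y_in_y at_var_var c0 mulr0 addr0.
  by rewrite at_y_ker c0 ker_y0.
have set_x_step : fpsX _ * fpsC (set_x0 (step_poly S)) = in_y (ker l m t 0 z) :> P.
  transitivity (fps_map (set_x0r F) (fpsX _ * fpsC (step_poly S))).
    apply: esym; apply: etrans (rmorphM (fps_map (set_x0r F)) _ _) _.
    by congr (_ * _); [exact: fps_mapX | exact: fps_mapC].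
  rewrite set_xE stepE; congr in_y; rewrite at_xD at_xM.
  rewrite at_x_in_x at_var_var c0 mul0r addr0.
  by rewrite at_x_ker c0.
have set_xy_step : fpsX _ * fpsC (set_x0 (set_y0 (step_poly S)))
    = in_x (const_ser (ker0 (fpsC lambda) m (fpsX _) 0)) :> P.
  transitivity (fps_map (set_x0r F) (fpsX _ * fpsC (set_y0 (step_poly S)))).
    apply: esym; apply: etrans (rmorphM (fps_map (set_x0r F)) _ _) _.
    by congr (_ * _); [exact: fps_mapX | exact: fps_mapC].
  rewrite set_y_step set_xE at_x_in_x in_y_const; congr (in_x (const_ser _)).
  have e : at_var 0 (ker0 l m t z) = ker0 (at_var 0 l) m (at_var 0 t) (at_var 0 z)
    := rmorph_ker0 (at_var 0) _ m _ _.
  have tE : at_var 0 t = fpsX _ by exact: fps_mapX.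
  by rewrite e tE at_var_var rmorph0 /l at_var_const.
rewrite set_y_step set_x_step set_xy_step !set_yE !set_xE xyE.
have in_xB (a b : R) : in_x (a - b) = in_x a - in_x b by exact: rmorphB.
have in_xM (a b : R) : in_x (a * b) = in_x a * in_x b by exact: rmorphM.
have in_yM (a b : R) : in_y (a * b) = in_y a * in_y b by exact: rmorphM.
have constM (a b : fps F) : const_ser (a * b) = const_ser a * const_ser b by exact: rmorphM.
have e00 : at_var 0 series_x = series_00.
  apply: fpsP => n.
  have := horner_map (horner_eval (0 : F)) (fps_coef (gen_fun S) n) 0%:P.
  by rewrite [X in _.[X]]hornerC => /esym.
rewrite at_x_in_x e00 in_y_const in_xB constM !in_xM in_yM; ring.
Qed.

End Catalytic.

Lemma size_gt1_horner (A : comNzRingType) (p : {poly A}) (a b : A) :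
  p.[a] != p.[b] -> (1 < size p)%N.
Proof.
by apply: contra_neqT; rewrite -leqNgt => /size1_polyC ->; rewrite !hornerC.
Qed.

(** Eliminating xy between the decoupling identity and the functional equation leaves a function of
    x and a function of y that are congruent modulo K: the second pair of invariants. *)
Lemma decoupling_combination (R : comNzRingType) (K g g1 n0 mu0 s xy X Q u v : R) :
    g * n0 - g1 * mu0 - s * g * g1 * xy = K * X -> K * Q = u + v - xy ->
  g * (n0 - s * g1 * u) - g1 * (mu0 + s * g * v) = K * (X - s * g * g1 * Q).
Proof.
by move=> E3 FE; rewrite [RHS]mulrBr -E3 [K * (_ * Q)]mulrCA FE; ring.
Qed.

Lemma rmorph_combination (R R' : comNzRingType) (f : {rmorphism R -> R'})
    (B A mu g k3 k2 k1 a b : R) :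
  f (B * (k3 * mu ^+ 3 + k2 * mu ^+ 2 * g + k1 * mu * g ^+ 2)
      + A * (a * mu * g ^+ 2 + b * g ^+ 3))
  = f B * (f k3 * f mu ^+ 3 + f k2 * f mu ^+ 2 * f g + f k1 * f mu * f g ^+ 2)
      + f A * (f a * f mu * f g ^+ 2 + f b * f g ^+ 3).
Proof. by rewrite !(rmorphD, rmorphM, rmorphXn). Qed.

Lemma rmorph_denominator (R R' : comNzRingType) (f : {rmorphism R -> R'}) (B g : R) :
  f (B * g ^+ 3) = f B * f g ^+ 3.
Proof. by rewrite !(rmorphM, rmorphXn). Qed.

Section Factors.
Variables (R : comNzRingType) (Q : R -> Prop).

(** All denominators of the data are products of powers of t, z and 1 + z, so it suffices to check
    [admits] and [cancels] on these factors. *)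
Definition stable_factor (f : R) := forall d, Q d -> Q (f * d).

Lemma stable_factorM f g : stable_factor f -> stable_factor g -> stable_factor (f * g).
Proof. by move=> sf sg d Qd; rewrite -mulrA; apply/sf/sg. Qed.

Lemma stable_factorX f n : stable_factor f -> stable_factor (f ^+ n).
Proof.
move=> sf; elim: n => [|n IHn] d Qd; first by rewrite mul1r.
by rewrite exprS -mulrA; apply/sf/IHn.
Qed.

Variables (m : model_name) (t z : R).
Hypotheses (sz : stable_factor z) (sz1 : stable_factor (1 + z)).

Ltac split_factors :=
  repeat lazymatch goal with
  | |- stable_factor (_ * _) => apply: stable_factorM
  | |- stable_factor (_ ^+ _) => apply: stable_factorX
  | _ => assumption
  end.

Lemma stable_inv_den : stable_factor (inv_den m z).
Proof. by case: m; rewrite /inv_den; split_factors. Qed.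

Lemma stable_inv_denx : stable_factor (inv_denx m z).
Proof. by case: m; rewrite /inv_denx; split_factors. Qed.

Lemma stable_dec_den : stable_factor (dec_den m z).
Proof. by case: m; rewrite /dec_den; split_factors. Qed.

Lemma stable_dec_denx : stable_factor t -> stable_factor (dec_denx m t z).
Proof. by case: m => st; rewrite /dec_denx; split_factors. Qed.

End Factors.

Section Catalytic.
Variables (F : fieldType) (char0 : [pchar F] =i pred0) (lambda : F) (m : model_name).
Local Notation R := (fps {poly F}).
Local Notation P := (fps {poly {poly F}}).
Local Notation S := (steps lambda m).
Local Notation K := (model_ker lambda m).
Local Notation q := (series_y lambda m).
Local Notation r := (series_x lambda m).
Local Notation q00 := (series_00 lambda m).

Let t : R := fpsX _.
Let l : R := const_ser (fpsC lambda).
Let z : R := var F.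

Let head_t : fps_head t = 0. Proof. exact: fps_headX. Qed.
Let head_z : fps_head z = 'X. Proof. exact: fps_headC. Qed.
Let head_l : fps_head l = lambda%:P.
Proof. exact: (congr1 polyC (fps_headC lambda)). Qed.

Let head1 : fps_head (1 : R) = 1. Proof. exact: rmorph1. Qed.
Let head0 : fps_head (0 : R) = 0. Proof. exact: rmorph0. Qed.
Let headN1 : fps_head (- 1 : R) = - 1.
Proof. by apply: etrans (rmorphN (@fps_head _) 1) _; congr (- _). Qed.

Let head_ker (b x y : R) (b' x' y' : {poly F}) :
    fps_head b = b' -> fps_head x = x' -> fps_head y = y' ->
  fps_head (ker l m b x y) = ker lambda%:P m b' x' y'.
Proof.
move=> <- <- <-; have e : fps_head (ker l m b x y) = ker (fps_head l) m (fps_head b)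
  (fps_head x) (fps_head y) := rmorph_ker (@fps_head {poly F}) l m b x y.
by rewrite e head_l.
Qed.

Let horner_ker (b x y : {poly F}) (a b' x' y' : F) :
    b.[a] = b' -> x.[a] = x' -> y.[a] = y' ->
  (ker lambda%:P m b x y).[a] = ker lambda m b' x' y'.
Proof.
move=> <- <- <-; have e := rmorph_ker (horner_eval a) lambda%:P m b x y.
by rewrite -[in RHS](hornerC lambda a); exact: e.
Qed.

Let horner1 (a : F) : (1 : {poly F}).[a] = 1. Proof. exact: hornerC. Qed.
Let hornerN1 (a : F) : (- 1 : {poly F}).[a] = - 1.
Proof. by rewrite hornerN horner1. Qed.

Lemma model_ker_head : fps_head K = - ('X%:P * 'X).
Proof.
rewrite -model_kerE fps_headB fps_headM fps_headX mul0r sub0r.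
by rewrite fps_headC.
Qed.

(** K(0,y) is divisible by t; its dependence on y is tested on the quotient at t = 0. *)
Lemma model_ker_x0 : nonconstant_in_y (at_x 0 K).
Proof.
rewrite at_x_ker const_ser0 -/t -/l -/z.
have -> : ker l m t 0 z = t * ker l m 1 0 z.
  by rewrite /ker; case: m => /=; ring.
apply: nonconstant_t; apply: nonconstant_head.
rewrite (head_ker head1 head0 head_z); apply: (@size_gt1_horner _ _ 1 0).
rewrite (horner_ker (horner1 1) (horner0 1) (hornerX 1)).
rewrite (horner_ker (horner1 0) (horner0 0) (hornerX 0)) -subr_eq0.
have -> : ker lambda m 1 0 1 - ker lambda m 1 0 0
   = (match m with WeightedE => 2 | WeightedF | WeightedG => 3 | _ => 1 end)%:R.
  by case: m; rewrite /ker /=; ring.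
by apply: (nat_neq0_char0 char0); case: (m).
Qed.

Lemma model_ker_xN1 : nonconstant_in_y (at_x (- 1) K).
Proof.
rewrite at_x_ker const_serN1 -/t -/l -/z.
apply: nonconstant_head.
rewrite (head_ker head_t headN1 head_z); apply: (@size_gt1_horner _ _ 1 0).
rewrite (horner_ker (horner0 1) (hornerN1 1) (hornerX 1)).
rewrite (horner_ker (horner0 0) (hornerN1 0) (hornerX 0)) -subr_eq0.
have -> : ker lambda m 0 (- 1) 1 - ker lambda m 0 (- 1) 0 = 1.
  by case: m; rewrite /ker /=; ring.
exact: oner_neq0.
Qed.

Lemma model_ker_y0 : at_y 0 K != 0.
Proof.
rewrite at_y_ker const_ser0 -/t -/l -/z.
have -> : ker l m t z 0 = t * ker l m 1 z 0.
  by rewrite /ker; case: m => /=; ring.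
apply: mulf_neq0; first exact: fpsX_neq0.
apply/eqP => /(congr1 (@fps_head _)); rewrite (head_ker head1 head_z head0) head0.
(* For [WeightedD] the value at x = 1 would be lambda + 2, which may be zero; at x = 0 it is 1. *)
pose a : F := if m is WeightedD then 0 else 1.
move/(congr1 (horner^~ a)); rewrite (horner_ker (horner1 a) (hornerX a) (horner0 a)) horner0.
have -> : ker lambda m 1 a 0
   = (match m with DoubleKreweras | WeightedE | WeightedG => 2 | WeightedF => 4 | _ => 1 end)%:R.
  by rewrite /a; case: m; rewrite /ker /=; ring.
by apply/eqP; apply: (nat_neq0_char0 char0); case: (m).
Qed.

Lemma model_ker_yN1 : at_y (- 1) K != 0.
Proof.
rewrite at_y_ker const_serN1 -/t -/l -/z.
apply/eqP => /(congr1 (@fps_head _)); rewrite (head_ker head_t head_z headN1) head0.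
move/(congr1 (horner^~ 1)); rewrite (horner_ker (horner0 1) (hornerX 1) (hornerN1 1)) horner0.
have -> : ker lambda m 0 1 (- 1) = 1 by case: m; rewrite /ker /=; ring.
by apply/eqP; exact: oner_neq0.
Qed.

Let adm_t : stable_factor (admits K) t.
Proof. by move=> d; apply: admits_t; exact: model_ker_head. Qed.

Let adm_z : stable_factor (admits K) z.
Proof. by rewrite /z var_subC0 => d; apply: admits_x; exact: model_ker_x0. Qed.

Let adm_z1 : stable_factor (admits K) (1 + z).
Proof. by rewrite /z var_subCN1 => d; apply: admits_x; exact: model_ker_xN1. Qed.

Let can_z : stable_factor (cancels K) z.
Proof. by rewrite /z var_subC0 => d; apply: cancels_y; exact: model_ker_y0. Qed.

Let can_z1 : stable_factor (cancels K) (1 + z).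
Proof. by rewrite /z var_subCN1 => d; apply: cancels_y; exact: model_ker_yN1. Qed.

Lemma admits_denominator : admits K (inv_denx m z * dec_denx m t z ^+ 3).
Proof.
have one : admits K 1 by apply: admits_one; exact: model_ker_head.
have -> : inv_denx m z * dec_denx m t z ^+ 3 = inv_denx m z * (dec_denx m t z ^+ 3 * 1).
  by rewrite mulr1.
apply: (stable_inv_denx m adm_z adm_z1).
by apply: stable_factorX one; exact: (stable_dec_denx m adm_z adm_z1 adm_t).
Qed.

Lemma cancels_denominator : cancels K (inv_den m z * dec_den m z ^+ 3).
Proof.
have -> : inv_den m z * dec_den m z ^+ 3 = inv_den m z * (dec_den m z ^+ 3 * 1).
  by rewrite mulr1.
apply: (stable_inv_den m can_z can_z1).
by apply: stable_factorX (@cancels_one _ _); exact: (stable_dec_den m can_z can_z1).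
Qed.

Definition kernel_y0 : R := ker l m t 0 z.

(* m = decoupled_y / dec_den and decoupled_x / dec_denx form the pair of
   invariants obtained from the functional equation and the decoupling functions. *)
Definition decoupled_y : R :=
  dec_num l m t z + dec_scale m t * dec_den m z * (kernel_y0 * q).

Definition kernel_x0 : R :=
  ker0 l m t z * r - const_ser (ker0 (fpsC lambda) m (fpsX _) 0 * q00).

Definition decoupled_x : R :=
  dec_numx m t z - dec_scale m t * dec_denx m t z * kernel_x0.

(** The hypothesis says that Phi(m, I) is a power series [M], hence has no pole. Its analogue in x
    agrees with it modulo K, so the pair is trivial, and the relation passes to x with the same
    constant. *)
Lemma catalytic_relation (k3 k2 k1 a b : fps F) (M : R) :
    let A := inv_num l m t z in let B := inv_den m z in let g := dec_den m z in
    let n := inv_numx l m t z in let d := inv_denx m z in let g1 := dec_denx m t z in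
    let C := @const_ser F in
    B * (C k3 * decoupled_y ^+ 3 + C k2 * decoupled_y ^+ 2 * g + C k1 * decoupled_y * g ^+ 2)
      + A * (C a * decoupled_y * g ^+ 2 + C b * g ^+ 3) = B * g ^+ 3 * M ->
  exists c, M = C c /\
    d * (C k3 * decoupled_x ^+ 3 + C k2 * decoupled_x ^+ 2 * g1 + C k1 * decoupled_x * g1 ^+ 2)
      + n * (C a * decoupled_x * g1 ^+ 2 + C b * g1 ^+ 3) = d * g1 ^+ 3 * C c.
Proof.
move=> A B g n d g1 C eqM.
have in_xB (a' b' : R) : in_x (a' - b') = in_x a' - in_x b' by exact: rmorphB.
have in_xM (a' b' : R) : in_x (a' * b') = in_x a' * in_x b' by exact: rmorphM.
have in_yD (a' b' : R) : in_y (a' + b') = in_y a' + in_y b' by exact: rmorphD.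
have in_yM (a' b' : R) : in_y (a' * b') = in_y a' * in_y b' by exact: rmorphM.
have tE : in_y t = in_x t.
  have -> : t = const_ser (fpsX _) by apply: esym; exact: fps_mapX.
  exact: in_y_const.
have lE : in_y l = in_x l by exact: in_y_const.
have CE k : in_y (C k) = in_x (C k) by exact: in_y_const.
have gE : in_y g = dec_den m (in_y z) := rmorph_dec_den (@in_y F) m z.
have BE : in_y B = inv_den m (in_y z) := rmorph_inv_den (@in_y F) m z.
have AE : in_y A = inv_num (in_x l) m (in_x t) (in_y z).
  by rewrite -tE -lE; exact: (rmorph_inv_num (@in_y F) l m t z).
have muE : in_y (dec_num l m t z) = dec_num (in_x l) m (in_x t) (in_y z).
  by rewrite -tE -lE; exact: (rmorph_dec_num (@in_y F) l m t z).
have sE : in_y (dec_scale m t) = dec_scale m (in_x t).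
  by rewrite -tE; exact: (rmorph_dec_scale (@in_y F) m t).
have sE' : in_x (dec_scale m t) = dec_scale m (in_x t).
  exact: (rmorph_dec_scale (@in_x F) m t).
have g1E : in_x g1 = dec_denx m (in_x t) (in_x z) := rmorph_dec_denx (@in_x F) m t z.
have mu1E : in_x (dec_numx m t z) = dec_numx m (in_x t) (in_x z).
  exact: (rmorph_dec_numx (@in_x F) m t z).
have dE : in_x d = inv_denx m (in_x z) := rmorph_inv_denx (@in_x F) m z.
have nE : in_x n = inv_numx (in_x l) m (in_x t) (in_x z).
  exact: (rmorph_inv_numx (@in_x F) l m t z).
have [X2] := rational_invariant (in_x l) m (in_x t) (in_x z) (in_y z).
rewrite -/(model_ker lambda m) -AE -BE -dE -nE => E2.
have [X3] := decoupling_identity (in_x l) m (in_x t) (in_x z) (in_y z).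
rewrite -/(model_ker lambda m) -gE -g1E -muE -mu1E => E3.
have FE : K * gen_fun S = in_x kernel_x0 + in_y (kernel_y0 * q) - in_x z * in_y z.
  exact: functional_equation.
have E1 : in_y g * in_x decoupled_x - in_x g1 * in_y decoupled_y
    = K * (X3 - dec_scale m (in_x t) * in_y g * in_x g1 * gen_fun S).
  rewrite /decoupled_x /decoupled_y in_xB in_yD.
  rewrite (in_xM (_ * _)) (in_xM (dec_scale _ _)) sE'.
  rewrite (in_yM (_ * _)) (in_yM (dec_scale _ _)) sE.
  exact: decoupling_combination E3 FE.
have DE : in_y (B * g ^+ 3) = in_y B * in_y g ^+ 3 := rmorph_denominator (@in_y F) B g.
have EM : in_y B * (in_y (C k3) * in_y decoupled_y ^+ 3
      + in_y (C k2) * in_y decoupled_y ^+ 2 * in_y g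
      + in_y (C k1) * in_y decoupled_y * in_y g ^+ 2)
    + in_y A * (in_y (C a) * in_y decoupled_y * in_y g ^+ 2 + in_y (C b) * in_y g ^+ 3)
    = in_y B * in_y g ^+ 3 * in_y M.
  rewrite -DE -[RHS]in_yM -eqM; apply: esym.
  exact: (rmorph_combination (@in_y F) B A decoupled_y g (C k3) (C k2) (C k1) (C a) (C b)).
rewrite (CE k3) (CE k2) (CE k1) (CE a) (CE b) in EM.
have [H EH] := invariant_combination E1 E2 EM.
have d_neq0 : d * g1 ^+ 3 != 0.
  rewrite mulf_neq0 ?expf_neq0 //; first exact: (inv_denx_neq0 m (var_neq0 F) (var1_neq0 F)).
  by apply: (dec_denx_neq0 m _ (var_neq0 F) (var1_neq0 F)); exact: fpsX_neq0.
pose N := d * (C k3 * decoupled_x ^+ 3 + C k2 * decoupled_x ^+ 2 * g1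
    + C k1 * decoupled_x * g1 ^+ 2) + n * (C a * decoupled_x * g1 ^+ 2 + C b * g1 ^+ 3).
have EH' : in_y (B * g ^+ 3) * (in_x N - in_x (d * g1 ^+ 3) * in_y M) = K * H.
  apply: etrans EH; rewrite DE; congr (_ * (_ - _ * _)).
    exact: (rmorph_combination (@in_x F) d n decoupled_x g1 (C k3) (C k2) (C k1) (C a) (C b)).
  exact: (rmorph_denominator (@in_x F) d g1).
have [c [MC NC]] := trivial_invariant_pair cancels_denominator admits_denominator d_neq0 EH'.
by exists c.
Qed.

End Catalytic.

(** * Algebraic elements *)

Lemma fractionE (A : idomainType) (x : {fraction A}) :
  exists a b : A, b != 0 /\ x = a%:F / b%:F.
Proof.
elim/quotW: x => r.
exists (frac r).1, (frac r).2; split; first exact: denom_ratioP.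
rewrite -[RHS]/(FracField.mul _ (FracField.inv _)); unlock tofrac.
rewrite -[X in FracField.mul _ X]FracField.pi_inv -[RHS]FracField.pi_mul.
rewrite /FracField.mulf /FracField.invf.
by rewrite !numden_Ratio ?oner_neq0 // ?denom_ratioP // mulr1 mul1r Ratio_numden.
Qed.

(** The closure properties needed below, in a form common to series in t and to series in x, y,
    t. *)
Record algebraically_closed_in (E : fieldType) (alg : E -> Prop) := AlgClosedIn {
  alg_nat : forall n : nat, alg n%:R;
  alg_add : forall u v, alg u -> alg v -> alg (u + v);
  alg_opp : forall u, alg u -> alg (- u);
  alg_mul : forall u v, alg u -> alg v -> alg (u * v);
  alg_inv : forall u, alg u -> alg u^-1;
  alg_root : forall (p : {poly E}) u,
    p != 0 -> root p u -> (forall i, alg p`_i) -> alg u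
}.

Section FractionLift.
Variables (A : idomainType) (E : fieldType) (f : {rmorphism A -> E}).
Hypothesis f_inj : injective f.

Let f_neq0 a : a != 0 -> f a != 0.
Proof. by rewrite (raddf_eq0 _ f_inj). Qed.

Let numden_ex (x : {fraction A}) : exists p : A * A, p.2 != 0 /\ x = p.1%:F / p.2%:F.
Proof. by have [a [b [b0 xE]]] := fractionE x; exists (a, b). Qed.

Let numden (x : {fraction A}) : A * A := projT1 (cid (numden_ex x)).

Definition frac_lift (x : {fraction A}) : E := f (numden x).1 / f (numden x).2.

Lemma frac_liftE a b : b != 0 -> frac_lift (a%:F / b%:F) = f a / f b.
Proof.
move=> b0; rewrite /frac_lift /numden; case: (cid _) => -[n d] /= [d0 /eqP].
rewrite eqr_div ?tofrac_eq0 // -!tofracM tofrac_eq => /eqP e.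
by apply/eqP; rewrite eqr_div ?f_neq0 // -!(rmorphM f) e.
Qed.

Lemma frac_lift_tofrac a : frac_lift a%:F = f a.
Proof. by rewrite -[a%:F]divr1 -tofrac1 frac_liftE ?oner_neq0 // rmorph1 divr1. Qed.

Fact frac_lift_is_zmod : zmod_morphism frac_lift.
Proof.
move=> x y; have [a [b [b0 ->]]] := fractionE x; have [c [d [d0 ->]]] := fractionE y.
have -> : a%:F / b%:F - c%:F / d%:F = (a * d - c * b)%:F / (b * d)%:F.
  by rewrite -mulNr addf_div ?tofrac_eq0 // rmorphB !rmorphM /= mulNr.
rewrite !frac_liftE ?mulf_neq0 // -[X in _ = _ + X]mulNr [RHS]addf_div ?f_neq0 //.
by rewrite rmorphB !rmorphM mulNr.
Qed.

Fact frac_lift_is_monoid : monoid_morphism frac_lift.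
Proof.
split; first by rewrite -tofrac1 frac_lift_tofrac rmorph1.
move=> x y; have [a [b [b0 ->]]] := fractionE x; have [c [d [d0 ->]]] := fractionE y.
by rewrite mulf_div -!tofracM !frac_liftE ?mulf_neq0 // !rmorphM mulf_div.
Qed.

HB.instance Definition _ :=
  GRing.isZmodMorphism.Build {fraction A} E frac_lift frac_lift_is_zmod.
HB.instance Definition _ :=
  GRing.isMonoidMorphism.Build {fraction A} E frac_lift frac_lift_is_monoid.

Lemma clear_denominators (p : {poly {fraction A}}) :
  exists2 c : A, c != 0 & exists q : {poly A}, map_poly (@tofrac A) q = c%:F *: p.
Proof.
elim/poly_ind: p => [|p x [c c0 [q qE]]].
  by exists 1; rewrite ?oner_neq0 //; exists 0; rewrite rmorph0 scaler0.
have [a [b [b0 xE]]] := fractionE x.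
exists (c * b); first by rewrite mulf_neq0.
exists (b *: q * 'X + (c * a)%:P).
rewrite rmorphD rmorphM /= map_polyX map_polyC /= map_polyZ /= qE xE.
rewrite scalerDr scalerAl scalerA -tofracM [b * c]mulrC; congr (_ + _).
rewrite -[RHS]mul_polyC -polyCM; congr (_%:P).
by rewrite !tofracM -!mulrA; congr (_ * _); rewrite mulrCA mulfV ?mulr1 // tofrac_eq0.
Qed.

(** Algebraicity is taken over the fraction field of A, where the field operations preserve it;
    [algebraic_overP] returns to polynomials with coefficients in A by clearing denominators. *)
Definition algebraic_over (u : E) := algebraicOver frac_lift u.

Lemma algebraic_overP u :
  algebraic_over u <-> exists2 p : {poly A}, p != 0 & root (map_poly f p) u.
Proof.
split=> [[p p0 pu]|[p p0 pu]]; last first.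
  exists (map_poly (@tofrac A) p).
    apply: contra_neq p0 => /polyP e; apply/polyP => i.
    by have /eqP := e i; rewrite coef_map !coef0 /= tofrac_eq0 => /eqP.
  rewrite -map_poly_comp /=; rewrite (eq_map_poly (g := f)) // => a.
  exact: frac_lift_tofrac.
have [c c0 [q qE]] := clear_denominators p.
exists q.
  apply: contra_neq p0 => q0; move/eqP: qE; rewrite q0 rmorph0 eq_sym scaler_eq0.
  by rewrite tofrac_eq0 (negPf c0) => /eqP.
have -> : map_poly f q = map_poly frac_lift (map_poly (@tofrac A) q).
  by rewrite -map_poly_comp; apply: eq_map_poly => a; rewrite /= frac_lift_tofrac.
by rewrite qE map_polyZ rootZ // fmorph_eq0 tofrac_eq0.
Qed.

Lemma algebraic_base a : algebraic_over (f a).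
Proof. by rewrite -frac_lift_tofrac; apply: algebraic_id. Qed.

Lemma algebraic_nat n : algebraic_over n%:R.
Proof. by rewrite -(rmorph_nat f); apply: algebraic_base. Qed.

Lemma algebraic_root (p : {poly E}) (u : E) :
  p != 0 -> root p u -> (forall i, algebraic_over p`_i) -> algebraic_over u.
Proof.
move=> p0 pu pA; apply/integral_algebraic; apply: (integral_root p0 pu) => c.
by case/(nthP 0) => i _ <-; apply/integral_algebraic; exact: pA.
Qed.

Lemma algebraic_over_closed : algebraically_closed_in algebraic_over.
Proof.
split.
- exact: algebraic_nat.
- by move=> u v; apply: algebraic_add.
- by move=> u; apply: algebraic_opp.
- by move=> u v; apply: algebraic_mul.
- by move=> u; apply: algebraic_inv.
- by move=> p u; apply: algebraic_root.
Qed.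

End FractionLift.

(** * Unknown constants determined by the critical values *)

Section AlgebraicClosure.
Variables (E : fieldType) (alg : E -> Prop).
Hypothesis closed : algebraically_closed_in alg.
Hypothesis char0 : forall n, (0 < n)%N -> (n%:R : E) != 0.

Lemma alg0 : alg 0. Proof. exact: (alg_nat closed 0). Qed.
Lemma alg1 : alg 1. Proof. exact: (alg_nat closed 1). Qed.

Lemma alg_sub u v : alg u -> alg v -> alg (u - v).
Proof. by move=> au av; apply: (alg_add closed au); apply: alg_opp. Qed.

Lemma alg_div u v : alg u -> alg v -> alg (u / v).
Proof. by move=> au av; apply: (alg_mul closed au); apply: alg_inv. Qed.

Lemma alg_exp u n : alg u -> alg (u ^+ n).
Proof.
by move=> au; elim: n => [|n IHn]; [exact: alg1 | rewrite exprS; apply: alg_mul].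
Qed.

Lemma alg_quartic c0 c1 c2 c3 c4 u :
    alg c0 -> alg c1 -> alg c2 -> alg c3 -> alg c4 -> [|| c2 != 0, c3 != 0 | c4 != 0] ->
  c0 + c1 * u + c2 * u ^+ 2 + c3 * u ^+ 3 + c4 * u ^+ 4 = 0 -> alg u.
Proof.
move=> a0 a1 a2 a3 a4 nz u0; pose c := [:: c0; c1; c2; c3; c4].
pose p : {poly E} := \poly_(i < 5) c`_i.
apply: (alg_root closed (p := p)).
- apply: contraTneq nz => /polyP p0.
  have e j : (j < 5)%N -> c`_j = 0 by move=> ltj; have := p0 j; rewrite coef_poly ltj coef0.
  by rewrite -[c2]/(c`_2) -[c3]/(c`_3) -[c4]/(c`_4) !e // eqxx.
- rewrite rootE horner_poly !big_ord_recl big_ord0 /=; apply/eqP; rewrite -[RHS]u0.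
  have bumpE n : bump 0 n = n.+1 by [].
  by rewrite !bumpE; ring.
- move=> j; rewrite coef_poly; case: ltnP => [|_]; last exact: alg0.
  by case: j => [|[|[|[|[|j]]]]].
Qed.

Lemma critical_value_1 k2 k1 b I c m :
    alg k2 -> alg k1 -> alg b -> alg I -> k2 != 0 ->
    k2 * m ^+ 2 + k1 * m + I * b = c -> 2 * k2 * m + k1 = 0 ->
  alg c.
Proof.
move=> ak2 ak1 ab aI k2n0 <- mE.
have n2 : (2 : E) != 0 := char0 (isT : (0 < 2)%N).
have -> : m = - k1 / (2 * k2).
  apply: (canRL (mulfK _)); first by rewrite mulf_neq0.
  by move/eqP: mE; rewrite addr_eq0 => /eqP <-; ring.
have am : alg (- k1 / (2 * k2)).
  apply: alg_div; first exact: (alg_opp closed ak1).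
  by apply: (alg_mul closed) => //; apply: (alg_nat closed 2).
apply: (alg_add closed); last exact: (alg_mul closed).
apply: (alg_add closed); last exact: (alg_mul closed).
by apply: (alg_mul closed) => //; apply: alg_exp.
Qed.

(** At a critical point c = -k2 m^2, so the two values of m are opposite; their difference is known
    from the difference of the two critical equations. *)
Lemma critical_value_2 k2 k1 a I1 I2 c m1 m2 :
    alg k2 -> alg a -> alg I1 -> alg I2 -> k2 != 0 -> a != 0 -> I1 != I2 ->
    k2 * m1 ^+ 2 + k1 * m1 + I1 * (a * m1) = c -> 2 * k2 * m1 + k1 + I1 * a = 0 ->
    k2 * m2 ^+ 2 + k1 * m2 + I2 * (a * m2) = c -> 2 * k2 * m2 + k1 + I2 * a = 0 ->
  alg k1 /\ alg c.
Proof.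
move=> ak2 aa aI1 aI2 k2n0 an0 I12 R1 C1 R2 C2.
have n2 : (2 : E) != 0 := char0 (isT : (0 < 2)%N).
have n4 : (4 : E) != 0 := char0 (isT : (0 < 4)%N).
have E1 : c = - (k2 * m1 ^+ 2).
  rewrite -R1; apply/eqP; rewrite -subr_eq0; apply/eqP.
  transitivity (m1 * (2 * k2 * m1 + k1 + I1 * a)); first by ring.
  by rewrite C1 mulr0.
have E2 : c = - (k2 * m2 ^+ 2).
  rewrite -R2; apply/eqP; rewrite -subr_eq0; apply/eqP.
  transitivity (m2 * (2 * k2 * m2 + k1 + I2 * a)); first by ring.
  by rewrite C2 mulr0.
have D12 : 2 * k2 * (m1 - m2) = a * (I2 - I1).
  apply/eqP; rewrite -subr_eq0; apply/eqP.
  transitivity ((2 * k2 * m1 + k1 + I1 * a) - (2 * k2 * m2 + k1 + I2 * a)); first by ring.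
  by rewrite C1 C2 subrr.
have m12 : m1 - m2 != 0.
  have : 2 * k2 * (m1 - m2) != 0.
    by rewrite D12 mulf_neq0 // subr_eq0 eq_sym.
  by apply: contra_neq => ->; rewrite mulr0.
have mN : m2 = - m1.
  apply/eqP; rewrite -addr_eq0 addrC; apply/eqP; apply: (mulfI m12).
  apply: (mulfI k2n0); rewrite !mulr0.
  transitivity (k2 * m1 ^+ 2 - k2 * m2 ^+ 2); first by ring.
  by rewrite -[k2 * m1 ^+ 2]opprK -E1 E2 opprK subrr.
have mE : m1 = a * (I2 - I1) / (4 * k2).
  apply: (canRL (mulfK _)); first by rewrite mulf_neq0.
  by rewrite -D12 mN; ring.
have am : alg m1.
  rewrite mE; apply: alg_div; first by apply: (alg_mul closed aa); apply: alg_sub.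
  by apply: (alg_mul closed) ak2; apply: (alg_nat closed 4).
split; last by rewrite E1; apply/(alg_opp closed)/(alg_mul closed ak2)/alg_exp.
have -> : k1 = - (2 * k2 * m1 + I1 * a).
  by apply/eqP; rewrite -addr_eq0 -C1; apply/eqP; ring.
apply: (alg_opp closed); apply: (alg_add closed); last exact: (alg_mul closed).
by apply: (alg_mul closed) am; apply: (alg_mul closed) ak2; apply: (alg_nat closed 2).
Qed.

(* The critical points m1, m2, m3 of k3 m^2 + k2 m + k1 - c / m have zero second
   elementary symmetric function, and the differences of critical values
   determine m3 / m2 up to a quartic equation. *)
Lemma critical_value_3 k3 k2 k1 a I1 I2 I3 c m1 m2 m3 :
    alg k3 -> alg a -> alg I1 -> alg I2 -> alg I3 -> k3 != 0 -> a != 0 ->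
    I1 != I2 -> I1 != I3 -> I2 != I3 ->
    (forall m I, (m, I) \in [:: (m1, I1); (m2, I2); (m3, I3)] ->
      k3 * m ^+ 3 + k2 * m ^+ 2 + k1 * m + I * (a * m) = c /\
      3 * k3 * m ^+ 2 + 2 * k2 * m + k1 + I * a = 0) ->
  [/\ alg k2, alg k1, alg c & alg m1].
Proof.
move=> ak3 aa aI1 aI2 aI3 k3n0 an0 I12 I13 I23 H.
have [R1 C1] := H m1 I1 (mem_head _ _).
have [|R2 C2] := H m2 I2; first by rewrite !inE eqxx orbT.
have [|R3 C3] := H m3 I3; first by rewrite !inE eqxx !orbT.
have cubic m I : k3 * m ^+ 3 + k2 * m ^+ 2 + k1 * m + I * (a * m) = c ->
    3 * k3 * m ^+ 2 + 2 * k2 * m + k1 + I * a = 0 ->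
    c = - (2 * k3 * m ^+ 3 + k2 * m ^+ 2).
  move=> <- Cm; apply/eqP; rewrite -subr_eq0; apply/eqP.
  transitivity (m * (3 * k3 * m ^+ 2 + 2 * k2 * m + k1 + I * a)); first by ring.
  by rewrite Cm mulr0.
have Q1 := cubic _ _ R1 C1; have Q2 := cubic _ _ R2 C2; have Q3 := cubic _ _ R3 C3.
have distinct m I m' I' : 3 * k3 * m ^+ 2 + 2 * k2 * m + k1 + I * a = 0 ->
    3 * k3 * m' ^+ 2 + 2 * k2 * m' + k1 + I' * a = 0 -> I != I' -> m - m' != 0.
  move=> Cm Cm'; apply: contra_neq => /eqP; rewrite subr_eq0 => /eqP mm'.
  apply: (mulIf an0); rewrite mm' in Cm; apply: (addrI (3 * k3 * m' ^+ 2 + 2 * k2 * m' + k1)).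
  by rewrite Cm Cm'.
have m12 := distinct _ _ _ _ C1 C2 I12.
have m13 := distinct _ _ _ _ C1 C3 I13.
have m23 := distinct _ _ _ _ C2 C3 I23.
have pair m m' : c = - (2 * k3 * m ^+ 3 + k2 * m ^+ 2) ->
    c = - (2 * k3 * m' ^+ 3 + k2 * m' ^+ 2) -> m - m' != 0 ->
    2 * k3 * (m ^+ 2 + m * m' + m' ^+ 2) + k2 * (m + m') = 0.
  move=> Qm Qm' mm'; apply: (mulfI mm'); rewrite mulr0.
  transitivity ((2 * k3 * m ^+ 3 + k2 * m ^+ 2) - (2 * k3 * m' ^+ 3 + k2 * m' ^+ 2)).
    by ring.
  by rewrite -[_ + k2 * m ^+ 2]opprK -Qm Qm' opprK subrr.
have P12 := pair _ _ Q1 Q2 m12; have P13 := pair _ _ Q1 Q3 m13.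
(* [P12] and [P13] differ by a multiple of m2 - m3. *)
have k2E : k2 = - (2 * k3 * (m1 + m2 + m3)).
  apply/eqP; rewrite -addr_eq0; apply/eqP; apply: (mulfI m23); rewrite mulr0.
  by apply: etrans (subrr 0); rewrite -{1}P12 -P13; ring.
have n2 : (2 : E) != 0 := char0 (isT : (0 < 2)%N).
have e2 : m1 * m2 + m1 * m3 + m2 * m3 = 0.
  apply: (mulfI (mulf_neq0 n2 k3n0)); rewrite mulr0; apply: oppr_inj; rewrite oppr0.
  by rewrite -P12 k2E; ring.
(* If x + y = 0, the symmetric function reduces to xy = -y^2; then y = 0 and x = y. *)
have nz (x y w : E) : x * y + x * w + y * w = 0 -> x - y != 0 -> x - w != 0 ->
    y - w != 0 -> x + y != 0.
  move=> e xy xw yw; apply: contraTneq xy => /eqP; rewrite addr_eq0 => /eqP xE.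
  have /eqP : y ^+ 2 = 0.
    by apply/eqP; rewrite -oppr_eq0 -e xE; apply/eqP; ring.
  by rewrite expf_eq0 /= xE => /eqP ->; rewrite !oppr0 addr0 eqxx.
have e2' : m1 * m3 + m1 * m2 + m3 * m2 = 0 by rewrite -e2; ring.
have e2'' : m2 * m3 + m2 * m1 + m3 * m1 = 0 by rewrite -e2; ring.
have m32 : m3 - m2 != 0 by rewrite -oppr_eq0 opprB.
have m21 : m2 - m1 != 0 by rewrite -oppr_eq0 opprB.
have m31 : m3 - m1 != 0 by rewrite -oppr_eq0 opprB.
have s12 := nz _ _ _ e2 m12 m13 m23.
have s13 := nz _ _ _ e2' m13 m12 m32.
have s23 := nz _ _ _ e2'' m23 m21 m31.
have m2_neq0 : m2 != 0.
  apply/eqP => m20; have : m1 * m3 != 0.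
    by rewrite mulf_neq0 //; [move: m12 | move: m32]; rewrite m20 subr0.
  by apply/negP; rewrite negbK -e2 m20; apply/eqP; ring.
(* Everything is expressed by w and m2, since [e2] gives m1 = -w m2 / (1 + w). *)
pose w := m3 / m2.
have m3E : m3 = w * m2 by rewrite mulfVK.
have w1 : 1 + w != 0.
  by apply: contra_neq s23 => w0; rewrite m3E -[X in X + _]mul1r -mulrDl w0 mul0r.
have m1E : m1 = - (w * m2) / (1 + w).
  apply: (canRL (mulfK w1)); apply: (mulfI m2_neq0).
  by apply/eqP; rewrite -subr_eq0 -e2 m3E; apply/eqP; ring.
(* Put S = m1 + m'. As m'' S = -m1 m', the factor 3 S^2 - 4 S (S + m'') equals -(m1 - m')^2. *)
have diff I m' I' m'' : 3 * k3 * m1 ^+ 2 + 2 * k2 * m1 + k1 + I * a = 0 ->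
    3 * k3 * m' ^+ 2 + 2 * k2 * m' + k1 + I' * a = 0 ->
    k2 = - (2 * k3 * (m1 + m' + m'')) -> m1 * m' + m1 * m'' + m' * m'' = 0 ->
    a * (I' - I) * (m1 + m') = - (k3 * (m1 - m') ^+ 3).
  move=> Cm Cm' kE e; have -> : a * (I' - I) = (m1 - m') * (3 * k3 * (m1 + m') + 2 * k2).
    apply/eqP; rewrite -subr_eq0; apply/eqP; rewrite -[RHS](subrr 0) -{1}Cm' -Cm; ring.
  rewrite kE; apply/eqP; rewrite -subr_eq0; apply/eqP.
  transitivity (- (4 * k3 * (m1 - m') * (m1 * m' + m1 * m'' + m' * m''))); first by ring.
  by rewrite e mulr0 oppr0.
have D12 := diff _ _ _ _ C1 C2 k2E e2.
have k2E' : k2 = - (2 * k3 * (m1 + m3 + m2)) by rewrite k2E; ring.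
have D13 := diff _ _ _ _ C1 C3 k2E' e2'.
pose d12 := a * (I2 - I1); pose d13 := a * (I3 - I1).
have d12n0 : d12 != 0 by rewrite mulf_neq0 // subr_eq0 eq_sym.
have d12E : d12 * (1 + w) ^+ 2 = k3 * (2 * w + 1) ^+ 3 * m2 ^+ 2.
  apply: (mulfI s12); rewrite [_ * (d12 * _)]mulrA [_ * d12]mulrC D12 m1E.
  by field.
have d13E : d13 * (1 + w) ^+ 2 = k3 * w * (w + 2) ^+ 3 * m2 ^+ 2.
  apply: (mulfI s13); rewrite [_ * (d13 * _)]mulrA [_ * d13]mulrC D13 m1E m3E.
  by field.
have ad12 : alg d12 by apply: (alg_mul closed aa); apply: alg_sub.
have ad13 : alg d13 by apply: (alg_mul closed aa); apply: alg_sub.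
have aN := alg_nat closed.
(* Eliminating m2^2 between [d12E] and [d13E] gives d12 w (w + 2)^3 = d13 (2 w + 1)^3, a quartic
   equation with leading coefficient d12. *)
have aw : alg w.
  apply: (@alg_quartic (- d13) (8 * d12 - 6 * d13) (12 * d12 - 12 * d13) (6 * d12 - 8 * d13) d12);
    rewrite ?d12n0 ?orbT //; try exact: (alg_opp closed);
    try by apply: alg_sub; apply: (alg_mul closed) => //; apply: aN.
  have w12 : (1 + w) ^+ 2 * (k3 * m2 ^+ 2) != 0.
    by rewrite !mulf_neq0 ?expf_neq0.
  apply: (mulfI w12); rewrite mulr0.
  transitivity (d12 * (1 + w) ^+ 2 * (k3 * w * (w + 2) ^+ 3 * m2 ^+ 2)
     - d13 * (1 + w) ^+ 2 * (k3 * (2 * w + 1) ^+ 3 * m2 ^+ 2)); first by ring.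
  by rewrite d12E d13E; ring.
have w2 : 2 * w + 1 != 0.
  apply: contra_neq m12 => w0; rewrite m1E; apply: (mulIf w1); rewrite mul0r.
  by apply: etrans (mulr0 (- m2)); rewrite -w0; field.
have aw1 : alg (1 + w) by apply: (alg_add closed) => //; apply: (aN 1%N).
have am2 : alg m2.
  apply: (@alg_quartic (- (d12 * (1 + w) ^+ 2 / (k3 * (2 * w + 1) ^+ 3))) 0 1 0 0);
    rewrite ?oner_neq0 //; try exact: alg0; try exact: alg1.
    apply: (alg_opp closed); apply: alg_div; first by apply: (alg_mul closed) => //; apply: alg_exp.
    apply: (alg_mul closed) => //; apply: alg_exp; apply: (alg_add closed); last exact: alg1.
    by apply: (alg_mul closed) => //; apply: (aN 2%N).
  by rewrite d12E; field; rewrite k3n0 w2.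
have am3 : alg m3 by rewrite m3E; apply: (alg_mul closed).
have am1 : alg m1.
  by rewrite m1E; apply: alg_div => //; apply/(alg_opp closed)/(alg_mul closed).
have ak2 : alg k2.
  rewrite k2E; apply/(alg_opp closed)/(alg_mul closed).
    by apply: (alg_mul closed) => //; apply: (aN 2%N).
  by do 2!apply: (alg_add closed) => //.
split=> //.
- have -> : k1 = - (3 * k3 * m1 ^+ 2 + 2 * k2 * m1 + I1 * a).
    by apply/eqP; rewrite -addr_eq0 -C1; apply/eqP; ring.
  apply: (alg_opp closed); apply: (alg_add closed); last exact: (alg_mul closed).
  apply: (alg_add closed).
    by apply: (alg_mul closed); [apply: (alg_mul closed) => //; apply: (aN 3%N) | apply: alg_exp].
  by apply: (alg_mul closed) => //; apply: (alg_mul closed) => //; apply: (aN 2%N).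
- rewrite Q1; apply: (alg_opp closed); apply: (alg_add closed).
    by apply: (alg_mul closed); [apply: (alg_mul closed) => //; apply: (aN 2%N) | apply: alg_exp].
  by apply: (alg_mul closed) => //; apply: alg_exp.
Qed.

End AlgebraicClosure.

(** * Critical points *)

Section CriticalPoint.
Variables (R : comNzRingType) (E : fieldType) (ev : {rmorphism R -> E}) (dv : R -> E).
Hypothesis dvD : forall a b, dv (a + b) = dv a + dv b.
Hypothesis dvM : forall a b, dv (a * b) = dv a * ev b + ev a * dv b.

Let dvX2 a : dv (a ^+ 2) = 2 * ev a * dv a.
Proof. by rewrite expr2 dvM; ring. Qed.

Let dvX3 a : dv (a ^+ 3) = 3 * ev a ^+ 2 * dv a.
Proof. by rewrite exprS dvM dvX2 rmorphXn; ring. Qed.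

(** [dv] is differentiation in y followed by the evaluation [ev]. The last two hypotheses say that
    I' = 0 and m' is nonzero at the point, so the chain rule applied to the relation forces the
    derivative in m to vanish. *)
Lemma critical_relation (k3 k2 k1 a b c A B mu g : R) :
    dv k3 = 0 -> dv k2 = 0 -> dv k1 = 0 -> dv a = 0 -> dv b = 0 -> dv c = 0 ->
    B * (k3 * mu ^+ 3 + k2 * mu ^+ 2 * g + k1 * mu * g ^+ 2)
      + A * (a * mu * g ^+ 2 + b * g ^+ 3) = B * g ^+ 3 * c ->
    ev B != 0 -> ev g != 0 -> dv A * ev B = ev A * dv B ->
    dv mu * ev g - ev mu * dv g != 0 ->
  let m := ev mu / ev g in let I := ev A / ev B in
  ev k3 * m ^+ 3 + ev k2 * m ^+ 2 + ev k1 * m + I * (ev a * m + ev b) = ev c /\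
  3 * ev k3 * m ^+ 2 + 2 * ev k2 * m + ev k1 + I * ev a = 0.
Proof.
move=> d3 d2 d1 da db dc rel B0 g0 critA critmu m I.
have := congr1 ev rel; rewrite !(rmorphD, rmorphM, rmorphXn) /= => rel0.
have := congr1 dv rel.
rewrite !(dvD, dvM, dvX2, dvX3, rmorphD, rmorphM, rmorphXn) /= d3 d2 d1 da db dc.
rewrite !(mul0r, mulr0, add0r, addr0) => rel1.
have dA : dv A = ev A * dv B / ev B by rewrite -critA mulfK.
split.
  apply: (mulfI (mulf_neq0 B0 (expf_neq0 3 g0))); rewrite -rel0 /m /I.
  by field; rewrite B0 g0.
have w0 : ev B * ev g ^+ 3 * (dv mu * ev g - ev mu * dv g) / ev g ^+ 2 != 0.
  by rewrite !mulf_neq0 ?invr_eq0 ?expf_neq0.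
apply: (mulfI w0); rewrite mulr0.
have ecE : ev c = (ev B * (ev k3 * ev mu ^+ 3 + ev k2 * ev mu ^+ 2 * ev g
    + ev k1 * ev mu * ev g ^+ 2) + ev A * (ev a * ev mu * ev g ^+ 2 + ev b * ev g ^+ 3))
    / (ev B * ev g ^+ 3).
  by rewrite rel0 mulrC mulKf // mulf_neq0 // expf_neq0.
move: rel1; rewrite ecE dA => /eqP; rewrite -subr_eq0 => /eqP rel1.
apply: etrans rel1; rewrite /m /I.
by field; rewrite B0 g0.
Qed.

End CriticalPoint.

(** * Evaluation at a series Y in s, with t = s^(e+1) *)

Section Substitution.
Variables (F : fieldType) (e : nat).
Local Notation R := (fps {poly F}).
Local Notation E := {fraction (fps F)}.

Definition subst_t : fps F -> fps F := fps_eval (@fpsC F) e.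
HB.instance Definition _ := GRing.RMorphism.copy subst_t (fps_eval (@fpsC F) e).

Lemma subst_tX : subst_t (fpsX F) = fpsX F ^+ e.+1.
Proof. exact: fps_evalX. Qed.

Lemma subst_tC c : subst_t (fpsC c) = fpsC c.
Proof. exact: fps_evalC. Qed.

Lemma subst_t_inj : injective subst_t.
Proof.
suff ker0 c : subst_t c = 0 -> c = 0.
  move=> a b /eqP; rewrite -subr_eq0 => /eqP ab.
  by apply/eqP; rewrite -subr_eq0; apply/eqP/ker0; rewrite rmorphB.
move=> sc0; apply: contrapT => /eqP c_neq0.
have [n cn lowc] := fps_order c_neq0.
have sE : subst_t c = fpsX F ^+ e.+1 ^+ n * subst_t (fps_shift n c).
  by rewrite {1}(fps_shiftK lowc) rmorphM rmorphXn /= subst_tX.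
have /eqP sh0 : subst_t (fps_shift n c) == 0.
  have := mulf_eq0 (fpsX F ^+ e.+1 ^+ n) (subst_t (fps_shift n c)).
  by rewrite -sE sc0 eqxx !expf_eq0 (negPf (fpsX_neq0 _)) !andbF.
have := congr1 (@fps_head _) sh0; rewrite fps_eval_head fps_headC rmorph0.
by rewrite /fps_head fps_coefE add0n => cn0; rewrite cn0 eqxx in cn.
Qed.

Definition base_t : {poly F} -> E := @tofrac _ \o (subst_t \o @fps_of_poly F).
HB.instance Definition _ := GRing.RMorphism.copy base_t
  (@tofrac _ \o (subst_t \o @fps_of_poly F)).

Lemma fps_of_poly_inj (A : comNzRingType) : injective (@fps_of_poly A).
Proof.
move=> p q /(congr1 (fun a => fps_coef a)) pq; apply/polyP => i.
exact: (congr1 (fun a => a i) pq).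
Qed.

Lemma tofrac_inj (A : idomainType) : injective (@tofrac A).
Proof. by move=> a b /eqP; rewrite tofrac_eq => /eqP. Qed.

Lemma base_t_inj : injective base_t.
Proof. by move=> p q /tofrac_inj /subst_t_inj /fps_of_poly_inj. Qed.

Definition algebraic_t := algebraic_over base_t.

Lemma algebraic_t_closed : algebraically_closed_in algebraic_t.
Proof. exact: (algebraic_over_closed base_t_inj). Qed.

Lemma algebraic_t_const c : algebraic_t (fpsC c)%:F.
Proof.
rewrite -subst_tC; exact: (algebraic_base base_t_inj c%:P).
Qed.

Lemma algebraic_t_t : algebraic_t (fpsX F ^+ e.+1)%:F.
Proof. rewrite -subst_tX; exact: (algebraic_base base_t_inj 'X). Qed.

Definition algebraic_series (c : fps F) : Prop :=
  exists2 p : {poly {poly F}}, p != 0 & (map_poly (@fps_of_poly F) p).[c] = 0.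

(** The ramification t = s^(e+1) is injective, so the same polynomial annihilates c before
    substitution. *)
Lemma algebraic_t_series c : algebraic_t (subst_t c)%:F -> algebraic_series c.
Proof.
case/(algebraic_overP base_t_inj) => p p0 pc; exists p => //.
apply: subst_t_inj; apply: tofrac_inj.
rewrite rmorph0 tofrac0; apply: etrans (eqP pc); apply: esym.
have -> : map_poly base_t p
   = map_poly (@tofrac _ \o subst_t) (map_poly (@fps_of_poly F) p).
  by rewrite -map_poly_comp.
exact: (horner_map (@tofrac _ \o subst_t)).
Qed.

Variable Y : fps F.

Definition eval_poly : {poly F} -> fps F := horner_eval Y \o map_poly (@fpsC F).
HB.instance Definition _ := GRing.RMorphism.copy eval_poly
  (horner_eval Y \o map_poly (@fpsC F)).

Lemma eval_polyC c : eval_poly c%:P = fpsC c.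
Proof. by rewrite /eval_poly /= map_polyC /horner_eval hornerC. Qed.

Lemma eval_polyX : eval_poly 'X = Y.
Proof. by rewrite /eval_poly /= map_polyX /horner_eval hornerX. Qed.

Definition eval_y : R -> fps F := fps_eval eval_poly e.
HB.instance Definition _ := GRing.RMorphism.copy eval_y (fps_eval eval_poly e).

Lemma eval_y_t : eval_y (fpsX _) = fpsX F ^+ e.+1.
Proof. exact: fps_evalX. Qed.

Lemma eval_y_var : eval_y (var F) = Y.
Proof. by apply: etrans (fps_evalC _ _ _) _; exact: eval_polyX. Qed.

Lemma eval_y_const c : eval_y (const_ser c) = subst_t c.
Proof.
apply: fpsP => N; rewrite /eval_y /subst_t !fps_coefE; congr (fps_coef _ _).
by apply: eq_bigr => n _; rewrite fps_coefE; congr (_ * _); exact: eval_polyC.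
Qed.

Definition eval_frac : R -> E := @tofrac _ \o eval_y.
HB.instance Definition _ := GRing.RMorphism.copy eval_frac (@tofrac _ \o eval_y).

Definition eval_deriv (u : R) : E := eval_frac (fps_deriv u).

Lemma eval_derivD a b : eval_deriv (a + b) = eval_deriv a + eval_deriv b.
Proof. by rewrite /eval_deriv fps_derivD rmorphD. Qed.

Lemma eval_derivM a b : eval_deriv (a * b)
  = eval_deriv a * eval_frac b + eval_frac a * eval_deriv b.
Proof. by rewrite /eval_deriv fps_derivM rmorphD !rmorphM. Qed.

Lemma eval_deriv_const c : eval_deriv (const_ser c) = 0.
Proof. by rewrite /eval_deriv [fps_deriv _]fps_deriv_const rmorph0. Qed.

End Substitution.

(** * Algebraicity from a polynomial relation *)

Section AlgebraicData.
Variables (E : fieldType) (alg : E -> Prop).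
Hypothesis closed : algebraically_closed_in alg.
Variables (l t x : E) (m : model_name).
Hypotheses (al : alg l) (at' : alg t) (ax : alg x).

Ltac solve_alg :=
  repeat lazymatch goal with
  | |- alg (_ - _) => apply: (alg_sub closed)
  | |- alg (_ + _) => apply: (alg_add closed)
  | |- alg (- _) => apply: (alg_opp closed)
  | |- alg (_ * _) => apply: (alg_mul closed)
  | |- alg (_ ^+ _) => apply: (alg_exp closed)
  | |- alg 1 => exact: (alg1 closed)
  | |- alg _%:R => exact: (alg_nat closed)
  | _ => assumption
  end.

Lemma alg_ker y : alg y -> alg (ker l m t x y).
Proof.
by move=> ay; rewrite /ker /ker2 /ker1 /ker0; case: m; solve_alg.
Qed.

Lemma alg_inv_num : alg (inv_num l m t x).
Proof. by rewrite /inv_num; case: m; solve_alg. Qed.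

Lemma alg_inv_den : alg (inv_den m x).
Proof. by rewrite /inv_den; case: m; solve_alg. Qed.

Lemma alg_inv_numx : alg (inv_numx l m t x).
Proof. by rewrite /inv_numx; case: m; solve_alg. Qed.

Lemma alg_inv_denx : alg (inv_denx m x).
Proof. by rewrite /inv_denx; case: m; solve_alg. Qed.

Lemma alg_dec_num : alg (dec_num l m t x).
Proof. by rewrite /dec_num; case: m; solve_alg. Qed.

Lemma alg_dec_den : alg (dec_den m x).
Proof. by rewrite /dec_den; case: m; solve_alg. Qed.

Lemma alg_dec_scale : alg (dec_scale m t).
Proof. by rewrite /dec_scale; case: m; solve_alg. Qed.

Lemma alg_dec_numx : alg (dec_numx m t x).
Proof. by rewrite /dec_numx; case: m; solve_alg. Qed.

Lemma alg_dec_denx : alg (dec_denx m t x).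
Proof. by rewrite /dec_denx; case: m; solve_alg. Qed.

Lemma alg_combination (k3 k2 k1 a b c B A g mu : E) :
    alg k3 -> alg k2 -> alg k1 -> alg a -> alg b -> alg c -> alg B -> alg A -> alg g ->
    B != 0 -> g != 0 -> (k3 != 0) || (k2 != 0) ->
    B * (k3 * mu ^+ 3 + k2 * mu ^+ 2 * g + k1 * mu * g ^+ 2)
      + A * (a * mu * g ^+ 2 + b * g ^+ 3) = B * g ^+ 3 * c ->
  alg mu.
Proof.
move=> a3 a2 a1 aa ab ac aB aA ag B0 g0 k0 rel.
apply: (@alg_quartic _ _ closed (A * b * g ^+ 3 - B * g ^+ 3 * c)
  (B * k1 * g ^+ 2 + A * a * g ^+ 2) (B * k2 * g) (B * k3) 0); try by solve_alg.
- exact: (alg0 closed).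
- by rewrite !mulf_eq0 !negb_or B0 g0 /= andbT eqxx orbF orbC.
- by apply: etrans (subrr (B * g ^+ 3 * c)); rewrite -{1}rel; ring.
Qed.

Lemma alg_of_affine (mu a s g w : E) : s != 0 -> g != 0 -> mu = a + s * g * w ->
  alg mu -> alg a -> alg s -> alg g -> alg w.
Proof.
move=> s0 g0 e amu aa as' ag.
have -> : w = (mu - a) / (s * g).
  by apply: (canRL (mulfK _)); [rewrite mulf_neq0 | rewrite e addrC addKr mulrC].
exact: (alg_div closed (alg_sub closed amu aa) (alg_mul closed as' ag)).
Qed.

End AlgebraicData.

(** * From the two relations to the algebraicity of Q(x,y;t) *)

Section Assembly.
Variables (F : fieldType) (char0 : [pchar F] =i pred0) (lambda : F) (m : model_name).
Local Notation R := (fps {poly F}).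
Local Notation P := (fps {poly {poly F}}).
Local Notation E := {fraction P}.
Local Notation S := (steps lambda m).

Let t : R := fpsX _.
Let l : R := const_ser (fpsC lambda).
Let z : R := var F.

Definition base_xyt : {poly {poly {poly F}}} -> E := @tofrac _ \o @fps_of_poly _.
HB.instance Definition _ := GRing.RMorphism.copy base_xyt
  (@tofrac _ \o @fps_of_poly {poly {poly F}}).

Lemma base_xyt_inj : injective base_xyt.
Proof. by move=> p q /tofrac_inj /fps_of_poly_inj. Qed.

Let alg (u : P) := algebraic_over base_xyt u%:F.
Let closed := algebraic_over_closed base_xyt_inj.

Let alg_base p : alg (fps_of_poly p).
Proof. exact: (algebraic_base base_xyt_inj p). Qed.

Definition const_xy : fps F -> P := @in_x F \o @const_ser F.
HB.instance Definition _ := GRing.RMorphism.copy const_xy (@in_x F \o @const_ser F).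

Definition const_poly : {poly F} -> {poly {poly {poly F}}} :=
  map_poly (@polyC {poly F} \o @polyC F).
HB.instance Definition _ := GRing.RMorphism.copy const_poly
  (map_poly (@polyC {poly F} \o @polyC F)).

Lemma const_xy_poly p : const_xy (fps_of_poly p) = fps_of_poly (const_poly p).
Proof. by apply: fpsP => n; apply: esym; exact: coef_map. Qed.

Lemma const_poly_inj : injective const_poly.
Proof. by apply: map_inj_poly => // a b /= /polyC_inj /polyC_inj. Qed.

Lemma algebraic_const c : algebraic_series c -> alg (const_xy c).
Proof.
case=> p p0 pc; apply/(algebraic_overP base_xyt_inj).
exists (map_poly const_poly p).
  apply: contra_neq p0 => /polyP e; apply/polyP => i; apply: const_poly_inj.
  by have := e i; rewrite coef_map !coef0 rmorph0.
rewrite rootE -map_poly_comp.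
have -> : map_poly (base_xyt \o const_poly) p
    = map_poly (@tofrac _ \o const_xy) (map_poly (@fps_of_poly F) p).
  rewrite -map_poly_comp; apply: eq_map_poly => a.
  exact: (congr1 (@tofrac P) (esym (const_xy_poly a))).
by rewrite (horner_map (@tofrac _ \o const_xy)) pc rmorph0.
Qed.

Lemma algebraic_gf_of_alg f : alg f -> algebraic_gf f.
Proof.
case/(algebraic_overP base_xyt_inj) => p p0 pf; exists p => //.
apply: tofrac_inj; rewrite tofrac0; apply: etrans (eqP pf); apply: esym.
have -> : map_poly base_xyt p = map_poly (@tofrac _) (map_poly (@fps_of_poly {poly {poly F}}) p).
  by rewrite -map_poly_comp.
exact: (horner_map (@tofrac _)).
Qed.

Let fx : R -> E := @tofrac _ \o @in_x F.
Let fy : R -> E := @tofrac _ \o @in_y F.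

Let alg_x : alg (in_x z).
Proof.
have -> : in_x z = fps_of_poly ('X%:P)%:P by exact: fps_mapC.
exact: alg_base.
Qed.

Let alg_y : alg (in_y z).
Proof.
have -> : in_y z = fps_of_poly ('X)%:P.
  by apply: etrans (fps_mapC _ _) _; congr (fps_of_poly _%:P); apply: map_polyX.
exact: alg_base.
Qed.

Let alg_t : alg (in_x t).
Proof.
have -> : in_x t = fps_of_poly 'X by exact: fps_mapX.
exact: alg_base.
Qed.

Let alg_l : alg (in_x l).
Proof.
have -> : in_x l = fps_of_poly (lambda%:P%:P)%:P.
  by rewrite /l; apply: etrans (congr1 (@in_x F) (fps_mapC _ _)) (fps_mapC _ _).
exact: alg_base.
Qed.

(** The relations are equations of degree 2 or 3 for m and m1, which are affine in the two unknown
    terms of the functional equation; dividing by K then gives Q. *)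
Lemma algebraic_gf_of_relations (k3 k2 k1 a b c : fps F) :
    let A := inv_num l m t z in let B := inv_den m z in let g := dec_den m z in
    let n := inv_numx l m t z in let d := inv_denx m z in let g1 := dec_denx m t z in
    let C := @const_ser F in let mu := decoupled_y lambda m in let mu1 := decoupled_x lambda m in
    algebraic_series k3 -> algebraic_series k2 -> algebraic_series k1 ->
    algebraic_series a -> algebraic_series b -> algebraic_series c ->
    (k3 != 0) || (k2 != 0) ->
    B * (C k3 * mu ^+ 3 + C k2 * mu ^+ 2 * g + C k1 * mu * g ^+ 2)
      + A * (C a * mu * g ^+ 2 + C b * g ^+ 3) = B * g ^+ 3 * C c ->
    d * (C k3 * mu1 ^+ 3 + C k2 * mu1 ^+ 2 * g1 + C k1 * mu1 * g1 ^+ 2)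
      + n * (C a * mu1 * g1 ^+ 2 + C b * g1 ^+ 3) = d * g1 ^+ 3 * C c ->
  algebraic_gf (gen_fun S).
Proof.
move=> A B g n d g1 C mu mu1 ak3 ak2 ak1 aa ab ac k0 rely relx.
have tE : in_y t = in_x t.
  have -> : t = const_ser (fpsX _) by apply: esym; exact: fps_mapX.
  exact: in_y_const.
have lE : in_y l = in_x l by exact: in_y_const.
have CE k : in_y (C k) = const_xy k by exact: in_y_const.
have aC k : algebraic_series k -> algebraic_over base_xyt (const_xy k)%:F.
  exact: algebraic_const.
have fracE (u v : P) : u = v -> u%:F = v%:F by move=> ->.
have toE (u : P) : u != 0 -> u%:F != 0 by rewrite tofrac_eq0.
have algE u v : u = v -> algebraic_over base_xyt v -> algebraic_over base_xyt u by move=> ->.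
pose te := (in_x t)%:F; pose le := (in_x l)%:F; pose xe := (in_x z)%:F.
pose ye := (in_y z)%:F.
have fytE : fy t = te by apply: fracE.
have fylE : fy l = le by apply: fracE.
have z_neq0 : z != 0 := var_neq0 F.
have z1_neq0 : 1 + z != 0 := var1_neq0 F.
have t_neq0 : t != 0 by exact: fpsX_neq0.
have B_neq0 : B != 0 by exact: (inv_den_neq0 (fun _ : m <> WeightedD => z_neq0) z1_neq0).
have g_neq0 : g != 0 by exact: (dec_den_neq0 (fun _ : m <> WeightedD => z_neq0) z1_neq0).
have d_neq0 : d != 0 by exact: (inv_denx_neq0 m z_neq0 z1_neq0).
have g1_neq0 : g1 != 0 by exact: (dec_denx_neq0 m t_neq0 z_neq0 z1_neq0).
have s_neq0 : dec_scale m t != 0 by exact: dec_scale_neq0.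
have fy_neq0 u : u != 0 -> fy u != 0.
  by move=> u0; apply: toE; rewrite in_y_eq0.
have fx_neq0 u : u != 0 -> fx u != 0.
  by move=> u0; apply: toE; rewrite in_x_eq0.
have cxy_neq0 k : k != 0 -> (const_xy k)%:F != 0.
  move=> kn0; apply: toE; apply: contra_neq kn0 => kk.
  by apply: const_ser_inj; apply: in_x_inj; apply: etrans kk _; rewrite !rmorph0.
have k0' : ((const_xy k3)%:F != 0) || ((const_xy k2)%:F != 0).
  by case/orP: k0 => kn0; apply/orP; [left|right]; apply: cxy_neq0.
have BE : fy B = inv_den m ye := rmorph_inv_den fy m z.
have gE : fy g = dec_den m ye := rmorph_dec_den fy m z.
have AE : fy A = inv_num le m te ye by rewrite -fytE -fylE; exact: (rmorph_inv_num fy).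
have dE : fx d = inv_denx m xe := rmorph_inv_denx fx m z.
have g1E : fx g1 = dec_denx m te xe := rmorph_dec_denx fx m t z.
have nE : fx n = inv_numx le m te xe := rmorph_inv_numx fx l m t z.
have atE : algebraic_over base_xyt te := alg_t.
have alE : algebraic_over base_xyt le := alg_l.
have axE : algebraic_over base_xyt xe := alg_x.
have ayE : algebraic_over base_xyt ye := alg_y.
have aB : algebraic_over base_xyt (fy B)
  by exact: (algE _ _ BE (alg_inv_den closed m ayE)).
have aA : algebraic_over base_xyt (fy A)
  by exact: (algE _ _ AE (alg_inv_num closed m alE atE ayE)).
have ag : algebraic_over base_xyt (fy g)
  by exact: (algE _ _ gE (alg_dec_den closed m ayE)).
have ad : algebraic_over base_xyt (fx d)
  by exact: (algE _ _ dE (alg_inv_denx closed m axE)).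
have an : algebraic_over base_xyt (fx n)
  by exact: (algE _ _ nE (alg_inv_numx closed m alE atE axE)).
have ag1 : algebraic_over base_xyt (fx g1)
  by exact: (algE _ _ g1E (alg_dec_denx closed m atE axE)).
have amu : algebraic_over base_xyt (fy mu).
  have relE : fy B * (fy (C k3) * fy mu ^+ 3 + fy (C k2) * fy mu ^+ 2 * fy g
        + fy (C k1) * fy mu * fy g ^+ 2)
      + fy A * (fy (C a) * fy mu * fy g ^+ 2 + fy (C b) * fy g ^+ 3)
      = fy B * fy g ^+ 3 * fy (C c).
    apply: etrans (esym (rmorph_combination fy B A mu g (C k3) (C k2) (C k1) (C a) (C b))) _.
    rewrite rely; apply: etrans (rmorphM fy _ _) _.
    exact: (congr1 (fun v => v * _) (rmorph_denominator fy B g)).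
  have fyC k : fy (C k) = (const_xy k)%:F by apply: fracE.
  rewrite !fyC in relE.
  exact: (alg_combination closed (aC _ ak3) (aC _ ak2) (aC _ ak1) (aC _ aa) (aC _ ab)
    (aC _ ac) aB aA ag (fy_neq0 _ B_neq0) (fy_neq0 _ g_neq0) k0' relE).
have amu1 : algebraic_over base_xyt (fx mu1).
  have relE : fx d * (fx (C k3) * fx mu1 ^+ 3 + fx (C k2) * fx mu1 ^+ 2 * fx g1
        + fx (C k1) * fx mu1 * fx g1 ^+ 2)
      + fx n * (fx (C a) * fx mu1 * fx g1 ^+ 2 + fx (C b) * fx g1 ^+ 3)
      = fx d * fx g1 ^+ 3 * fx (C c).
    apply: etrans (esym (rmorph_combination fx d n mu1 g1 (C k3) (C k2) (C k1) (C a) (C b))) _.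
    rewrite relx; apply: etrans (rmorphM fx _ _) _.
    exact: (congr1 (fun v => v * _) (rmorph_denominator fx d g1)).
  exact: (alg_combination closed (aC _ ak3) (aC _ ak2) (aC _ ak1) (aC _ aa) (aC _ ab)
    (aC _ ac) ad an ag1 (fx_neq0 _ d_neq0) (fx_neq0 _ g1_neq0) k0' relE).
have aS : algebraic_over base_xyt (dec_scale m te)
  by exact: (alg_dec_scale closed m atE).
have fyS : fy (dec_scale m t) = dec_scale m te.
  by rewrite -fytE; exact: (rmorph_dec_scale fy).
have fxS : fx (dec_scale m t) = dec_scale m te := rmorph_dec_scale fx m t.
have tS_neq0 : dec_scale m te != 0 := eq_ind _ (fun v => v != 0) (fy_neq0 _ s_neq0) _ fyS.
have ay : algebraic_over base_xyt (fy (kernel_y0 lambda m * series_y lambda m)).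
  have muE : fy mu = dec_num le m te ye
      + dec_scale m te * fy g * fy (kernel_y0 lambda m * series_y lambda m).
    rewrite -fyS -fytE -fylE; apply: etrans (rmorphD fy _ _) _.
    apply: (congr2 +%R); first exact: (rmorph_dec_num fy).
    by apply: etrans (rmorphM fy _ _) _; apply: (congr1 (fun v => v * _)); exact: rmorphM.
  exact: (alg_of_affine closed tS_neq0 (fy_neq0 _ g_neq0) muE amu
    (alg_dec_num closed m alE atE ayE) aS ag).
have ax : algebraic_over base_xyt (fx (kernel_x0 lambda m)).
  have muE : fx mu1 = dec_numx m te xe
      + - dec_scale m te * fx g1 * fx (kernel_x0 lambda m).
    rewrite -fxS; apply: etrans (rmorphB fx _ _) _.
    apply: etrans (congr2 (fun u v => u - v) (rmorph_dec_numx fx m t z) (rmorphM fx _ _)) _.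
    apply: etrans (congr1 (fun v => _ - v * _) (rmorphM fx _ _)) _.
    by rewrite !mulNr.
  have tSN_neq0 : - dec_scale m te != 0 by rewrite oppr_eq0.
  exact: (alg_of_affine closed tSN_neq0 (fx_neq0 _ g1_neq0) muE amu1
    (alg_dec_numx closed m atE axE) (alg_opp closed aS) ag1).
have K_neq0 : model_ker lambda m != 0.
  apply: contra_neq (model_ker_y0 char0 lambda m) => ->; exact: rmorph0.
apply: algebraic_gf_of_alg; rewrite /alg.
have -> : (gen_fun S)%:F = (fx (kernel_x0 lambda m)
    + fy (kernel_y0 lambda m * series_y lambda m) - xe * ye) / (model_ker lambda m)%:F.
  apply: (canRL (mulfK _)); first exact: toE.
  rewrite mulrC -tofracM.
  have FE : model_ker lambda m * gen_fun S = in_x (kernel_x0 lambda m)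
     + in_y (kernel_y0 lambda m * series_y lambda m) - in_x z * in_y z.
    exact: functional_equation.
  apply: etrans (fracE _ _ FE) _; apply: etrans (tofracB _ _) _.
  by rewrite tofracD tofracM.
apply: (alg_div closed).
  exact: (alg_sub closed (alg_add closed ax ay) (alg_mul closed axE ayE)).
have -> : (model_ker lambda m)%:F = ker le m te xe ye := rmorph_ker (@tofrac P) _ m _ _ _.
exact: (alg_ker closed m alE atE axE ayE).
Qed.

End Assembly.

(** * Derivatives of the invariants *)

Section Wronskian.
Variables (R : comNzRingType) (D : R -> R).
Hypothesis DD : forall a b, D (a + b) = D a + D b.
Hypothesis DM : forall a b, D (a * b) = D a * b + a * D b.
Variables (l t z : R) (m : model_name).
Hypotheses (Dl : D l = 0) (Dt : D t = 0) (Dz : D z = 1).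

Let D0 : D 0 = 0.
Proof. by apply: (addrI (D 0)); rewrite -DD !addr0. Qed.

Let DN a : D (- a) = - D a.
Proof. by apply: (addrI (D a)); rewrite -DD !subrr D0. Qed.

Let D1 : D 1 = 0.
Proof.
by apply: (addrI (D 1)); rewrite addr0 -[RHS](congr1 D (mulr1 1)) DM mulr1 mul1r.
Qed.

Let Dnat n : D n%:R = 0.
Proof. by elim: n => [|n IHn]; rewrite ?D0 // mulrS DD D1 IHn addr0. Qed.

Let DX a n : D (a ^+ n) = n%:R * a ^+ n.-1 * D a.
Proof.
elim: n => [|[|n] IHn]; rewrite ?expr0 ?expr1 ?D1 ?mulr1 ?mul0r ?mul1r //.
by rewrite exprS DM IHn /= [n.+2%:R]mulrS [a ^+ n.+1]exprS; ring.
Qed.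

Let derivE := (DD, DN, DM, DX, Dnat, D1, D0, Dl, Dt, Dz).

(* The derivative of the invariant vanishes with this polynomial. *)
Definition critical_num (A : comNzRingType) (l t y : A) : A :=
  let tau := 1 + 3 * t in
  let crit_e := t * tau * (3 * y ^+ 5 + y ^+ 6)
    + (tau ^+ 2 - t * tau - t ^+ 2) * (y ^+ 3 - y ^+ 4)
    - 2 * t * y ^+ 3 - t * (y + 3 * y ^+ 2) + t ^+ 2 * (2 + 4 * y) in
  match m with
  | Kreweras => y - t * y ^+ 3 - 2 * t
  | DoubleKreweras => t * y ^+ 4 + 2 * t * y ^+ 3 - y ^+ 2 + 2 * t * y + t
  | Gessel => (1 - y) * (y ^+ 2 - (t * (1 + y) ^+ 2) ^+ 2)
  | WeightedD => (1 + t * l) * (1 + y) - 2 * (1 + t * l) ^+ 2 - t ^+ 2 * (1 + y) ^+ 3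
  | WeightedE | WeightedG => crit_e
  | WeightedF => t ^+ 2 * (4 * y ^+ 5 + 2 * y ^+ 6) - t * (3 * y ^+ 4 + y ^+ 5)
      - 2 * t * y ^+ 3 + (t ^+ 2 + t * tau - tau ^+ 2) * (y ^+ 2 - y ^+ 3)
      + t * tau * (1 + 3 * y)
  end.

Lemma deriv_invariant : exists c,
  D (inv_num l m t z) * inv_den m z - inv_num l m t z * D (inv_den m z)
    = c * critical_num l t z.
Proof.
rewrite /critical_num; case: m; rewrite /= !derivE /=.
- by exists z; ring.
- by exists 1; ring.
- by exists (1 + z); ring.
- by exists (1 + z); ring.
- by exists (- z * (1 + z)); ring.
- by exists (1 + z); ring.
- by exists (z * (1 + z)); ring.
Qed.

Definition wronskian_head (A : comNzRingType) (y : A) : A :=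
  match m with
  | WeightedE => - y ^+ 2
  | WeightedF => 1 - y ^+ 2
  | WeightedG => y ^+ 2 - 1
  | _ => - 1
  end.

Definition unscaled := if m is (Kreweras | DoubleKreweras | WeightedG) then true else false.

(** The unknown k = K(0,y) Q(0,y) occurs only with a factor t or, when [dec_scale] is 1, a factor
    y^2. Both vanish at s = 0 at the critical points used, so [wronskian_head] alone decides that m'
    is nonzero. *)
Lemma deriv_decoupled k :
  let mu := dec_num l m t z + dec_scale m t * dec_den m z * k in
  exists c1 c2, D mu * dec_den m z - mu * D (dec_den m z)
    = wronskian_head z + t * c1 + unscaled%:R * (z ^+ 2 * c2).
Proof.
move=> mu; rewrite /mu /unscaled /wronskian_head; case: m; rewrite /= !derivE /=.
- by exists 0, (D k); ring.
- by exists 0, (D k); ring.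
- by exists ((1 + z) ^+ 2 * D k), 0; ring.
- by exists (- l + (1 + z) ^+ 2 * D k), 0; ring.
- by exists (1 + 2 * z - z ^+ 2 + 2 * z ^+ 3 + z ^+ 4 + (z * (1 + z)) ^+ 2 * D k), 0; ring.
- by exists ((1 + z) * (2 * z ^+ 2 - 3 * z + 3) + z ^+ 2 * D k), 0; ring.
- by exists 0, (D k); ring.
Qed.

End Wronskian.

Section WronskianMorphism.
Variables (R R' : comNzRingType) (f : {rmorphism R -> R'}) (m : model_name).

Let morphE := (rmorphB f, rmorphN f, rmorphD f, rmorphM f, rmorphXn f, rmorph1 f,
  rmorph_nat f).

Lemma rmorph_critical_num l t y :
  f (critical_num m l t y) = critical_num m (f l) (f t) (f y).
Proof. by rewrite /critical_num; case: m; rewrite /= ?morphE. Qed.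

Lemma rmorph_wronskian_head y : f (wronskian_head m y) = wronskian_head m (f y).
Proof. by rewrite /wronskian_head; case: m; rewrite /= ?morphE. Qed.

Lemma rmorph_wronskian t z c1 c2 : f t = 0 -> (unscaled m -> f z = 0) ->
  f (wronskian_head m z + t * c1 + (unscaled m)%:R * (z ^+ 2 * c2)) = wronskian_head m (f z).
Proof.
move=> ft fz; rewrite !morphE rmorph_wronskian_head ft mul0r addr0.
by case: (unscaled m) fz => [->|_]; rewrite ?expr0n ?mul0r ?mulr0 ?addr0.
Qed.

End WronskianMorphism.

Section CriticalPoints.
Variables (F : fieldType) (lambda : F) (m : model_name) (e : nat) (Y : fps F).
Local Notation R := (fps {poly F}).
Local Notation E := {fraction fps F}.

Let t : R := fpsX _.
Let l : R := const_ser (fpsC lambda).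
Let z : R := var F.
Let T : fps F := fpsX F ^+ e.+1.
Let L : fps F := fpsC lambda.

Definition inv_value : E := (inv_num L m T Y)%:F / (inv_den m Y)%:F.

Definition const_frac (c : fps F) : E := (subst_t e c)%:F.

Lemma algebraic_inv_value : algebraic_t e Y%:F -> algebraic_t e inv_value.
Proof.
move=> aY; have closed := @algebraic_t_closed F e.
have nE : (inv_num L m T Y)%:F = inv_num L%:F m T%:F Y%:F :> E.
  exact: (rmorph_inv_num (@tofrac (fps F))).
have dE : (inv_den m Y)%:F = inv_den m Y%:F :> E.
  exact: (rmorph_inv_den (@tofrac (fps F))).
have algE (u v : E) : u = v -> algebraic_t e v -> algebraic_t e u by move=> ->.
have aL : algebraic_t e L%:F by exact: algebraic_t_const.
have aT : algebraic_t e T%:F by exact: algebraic_t_t.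

exact: (alg_div closed (algE _ _ nE (alg_inv_num closed m aL aT aY))
  (algE _ _ dE (alg_inv_den closed m aY))).

Qed.

(** The first two conditions keep the denominators away from 0; the last two make m'(Y) nonzero. *)
Record critical_point : Prop := CriticalPoint {
  critical_neq0 : Y != 0;
  critical_neqN1 : 1 + Y != 0;
  critical_eq : critical_num m L T Y = 0;
  critical_wronskian : wronskian_head m (fps_head Y) != 0;
  critical_unscaled : unscaled m -> fps_head Y = 0
}.

Let ev : {rmorphism R -> fps F} := eval_y e Y.

Let evt : ev t = T. Proof. exact: eval_y_t. Qed.
Let evz : ev z = Y. Proof. exact: eval_y_var. Qed.
Let evl : ev l = L.
Proof. by apply: etrans (eval_y_const _ _ _) _; exact: subst_tC. Qed.

Let dl : fps_deriv l = 0. Proof. exact: fps_deriv_const. Qed.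
Let dt : fps_deriv t = 0.
Proof.
have -> : t = const_ser (fpsX _) by apply: esym; exact: fps_mapX.
exact: fps_deriv_const.
Qed.
Let dz : fps_deriv z = 1.
Proof. by apply: etrans (fps_derivC _) _; rewrite derivX; exact: rmorph1. Qed.

Lemma critical_point_relation k3 k2 k1 a b c :
    let C := @const_ser F in let f := const_frac in
    let A := inv_num l m t z in let B := inv_den m z in let g := dec_den m z in
    let mu := decoupled_y lambda m in
    critical_point ->
    B * (C k3 * mu ^+ 3 + C k2 * mu ^+ 2 * g + C k1 * mu * g ^+ 2)
      + A * (C a * mu * g ^+ 2 + C b * g ^+ 3) = B * g ^+ 3 * C c ->
  exists v, f k3 * v ^+ 3 + f k2 * v ^+ 2 + f k1 * v + inv_value * (f a * v + f b) = f c /\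
    3 * f k3 * v ^+ 2 + 2 * f k2 * v + f k1 + inv_value * f a = 0.
Proof.
move=> C f A B g mu [Y0 YN1 crit wr0 unsc] rel.
have dC k : eval_deriv e Y (C k) = 0 by exact: eval_deriv_const.
have AE : ev A = inv_num L m T Y by rewrite -evl -evt -evz; exact: (rmorph_inv_num ev).
have BE : ev B = inv_den m Y by rewrite -evz; exact: (rmorph_inv_den ev).
have gE : ev g = dec_den m Y by rewrite -evz; exact: (rmorph_dec_den ev).
have B0 : ev B != 0 by rewrite BE; exact: (inv_den_neq0 (fun _ => Y0) YN1).
have g0 : ev g != 0 by rewrite gE; exact: (dec_den_neq0 (fun _ => Y0) YN1).
have critA : ev (fps_deriv A) * ev B = ev A * ev (fps_deriv B).
  apply/eqP; rewrite -subr_eq0; apply/eqP.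
  have [k E] := deriv_invariant (@fps_derivD F) (@fps_derivM F) m dl dt dz.
  have := congr1 ev E; rewrite rmorphB !rmorphM => ->.
  have -> : ev (critical_num m l t z) = 0.
    rewrite -crit -evl -evt -evz; exact: (rmorph_critical_num ev).
  exact: mulr0.
have critmu : ev (fps_deriv mu) * ev g - ev mu * ev (fps_deriv g) != 0.
  have [c1 [c2 E]] := deriv_decoupled (@fps_derivD F) (@fps_derivM F) m dl dt dz
    (kernel_y0 lambda m * series_y lambda m).
  have := congr1 ev E; rewrite rmorphB !rmorphM => ->.
  apply: contra_neq wr0 => /(congr1 (@fps_head F)); rewrite [RHS](rmorph0 (@fps_head F)) => <-.
  pose h : {rmorphism R -> F} := @fps_head F \o ev.
  have ht : h t = 0 by rewrite /h /= evt /T exprS fps_headM fps_headX mul0r.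
  have hz : h z = fps_head Y by rewrite /h /= evz.
  have hz' : unscaled m -> h z = 0 by rewrite hz.
  rewrite -hz; exact: esym (rmorph_wronskian c1 c2 ht hz').
have toE (u : fps F) : u != 0 -> u%:F != 0 by rewrite tofrac_eq0.
have evC k : eval_frac e Y (C k) = f k by exact: (congr1 (@tofrac _) (eval_y_const e Y k)).
have IE : eval_frac e Y A / eval_frac e Y B = inv_value.
  exact: (congr2 (fun u v => u%:F / v%:F) AE BE).
have critA' : eval_deriv e Y A * eval_frac e Y B = eval_frac e Y A * eval_deriv e Y B.
  apply: etrans (esym (tofracM _ _)) _; apply: etrans (congr1 (@tofrac _) critA) _.
  exact: tofracM.
have critmu' : eval_deriv e Y mu * eval_frac e Y g - eval_frac e Y mu * eval_deriv e Y g != 0.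
  apply: contra (toE _ critmu) => /eqP w0; apply/eqP.
  apply: etrans w0; apply: etrans (tofracB _ _) _.
  exact: (congr2 (fun u v => u - v) (tofracM _ _) (tofracM _ _)).
have [H1 H2] := critical_relation (eval_derivD e Y) (eval_derivM e Y) (dC k3) (dC k2) (dC k1)
  (dC a) (dC b) (dC c) rel (toE _ B0) (toE _ g0) critA' critmu'.
exists (eval_frac e Y mu / eval_frac e Y g).
rewrite -IE -(evC k3) -(evC k2) -(evC k1) -(evC a) -(evC b) -(evC c).
exact: conj H1 H2.
Qed.

End CriticalPoints.

Section AlgebraicSeries.
Variables (F : fieldType) (char0 : [pchar F] =i pred0) (e : nat).
Local Notation E := {fraction fps F}.

HB.instance Definition _ := GRing.RMorphism.copy (@const_frac F e)
  (@tofrac _ \o @subst_t F e).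

Lemma algebraic_seriesP (c : fps F) : algebraic_series c <-> algebraic_t e (const_frac e c).
Proof.
split; last exact: algebraic_t_series.
case=> p p0 pc; apply/(algebraic_overP (@base_t_inj F e)); exists p => //.
apply/eqP; apply: etrans (_ : const_frac e 0 = 0); last exact: rmorph0.
rewrite -pc.
have -> : map_poly (base_t e) p
   = map_poly (@const_frac F e) (map_poly (@fps_of_poly F) p).
  by rewrite -map_poly_comp.
exact: (horner_map (@const_frac F e)).
Qed.

Lemma algebraic_series_poly (p : {poly F}) : algebraic_series (fps_of_poly p).
Proof.
exists ('X - p%:P); first by rewrite polyXsubC_eq0.
by rewrite rmorphB /= map_polyX map_polyC !hornerE subrr.
Qed.

Lemma nat_frac_neq0 n : (0 < n)%N -> (n%:R : E) != 0.
Proof.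
move=> n0; have -> : (n%:R : E) = (fpsC n%:R)%:F.
  apply: esym; apply: etrans (congr1 (@tofrac (fps F)) (rmorph_nat (@fpsC F) n)) _.
  exact: rmorph_nat.
rewrite tofrac_eq0; apply: contra_neq (nat_neq0_char0 char0 n0).
by move/(congr1 (@fps_head F)); rewrite fps_headC => ->; exact: rmorph0.
Qed.

Lemma const_frac_neq0 (c : fps F) : c != 0 -> const_frac e c != 0.
Proof.
move=> c0; rewrite tofrac_eq0; apply: contra_neq c0 => sc.
by apply: (@subst_t_inj F e); rewrite sc rmorph0.
Qed.

End AlgebraicSeries.

(** * Algebraicity from one, two or three critical points *)

Section CriticalAssembly.
Variables (F : fieldType) (char0 : [pchar F] =i pred0) (lambda : F) (m : model_name) (e : nat).
Local Notation R := (fps {poly F}).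
Local Notation E := {fraction fps F}.
Local Notation C := (@const_ser F).
Local Notation f := (@const_frac F e).
Local Notation mu := (decoupled_y lambda m).

Let t : R := fpsX _.
Let z : R := var F.
Let A := inv_num (const_ser (fpsC lambda)) m t z.
Let B := inv_den m z.
Let g := dec_den m z.
Let closed := @algebraic_t_closed F e.
Let charE := @nat_frac_neq0 F char0.

Definition algebraic_critical_point Y := critical_point lambda m e Y /\ algebraic_t e Y%:F.

Let algI Y : algebraic_critical_point Y -> algebraic_t e (inv_value lambda m e Y).
Proof. by case=> _; exact: algebraic_inv_value. Qed.

Let algP (c : fps F) : algebraic_series c -> algebraic_t e (f c).
Proof. by move/(algebraic_seriesP e). Qed.

Let Palg (c : fps F) : algebraic_t e (f c) -> algebraic_series c.
Proof. by move/(algebraic_seriesP e). Qed.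

Let f0 : f 0 = 0. Proof. exact: rmorph0. Qed.

(** All coefficients of Phi are known and only c is unknown; the critical equation gives m(Y) = -k1
    / (2 k2). *)
Lemma algebraic_gf_critical_1 (k2 k1 b : fps F) (M : R) Y :
    algebraic_series k2 -> algebraic_series k1 -> algebraic_series b -> k2 != 0 ->
    algebraic_critical_point Y ->
    B * (C 0 * mu ^+ 3 + C k2 * mu ^+ 2 * g + C k1 * mu * g ^+ 2)
      + A * (C 0 * mu * g ^+ 2 + C b * g ^+ 3) = B * g ^+ 3 * M ->
  algebraic_gf (gen_fun (steps lambda m)).
Proof.
move=> ak2 ak1 ab k2n0 cY rel.
have [c [Mc relx]] := catalytic_relation char0 rel; rewrite Mc in rel.
have [v [H1 H2]] := critical_point_relation cY.1 rel.
have ac : algebraic_series c.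
  apply: Palg; apply: (critical_value_1 closed charE (algP ak2) (algP ak1) (algP ab)
    (algI cY) (const_frac_neq0 e k2n0) (m := v)).
    by rewrite -H1 f0; ring.
  by rewrite -H2 f0; ring.
apply: (algebraic_gf_of_relations char0 _ ak2 ak1 _ ab ac _ rel relx).
- exact: (algebraic_series_poly 0).
- exact: (algebraic_series_poly 0).
- by rewrite k2n0 orbT.
Qed.

(** No algebraicity is assumed for k1, into which Q(0,0) enters; it is obtained together with c. *)
Lemma algebraic_gf_critical_2 (k2 k1 a : fps F) (M : R) Y1 Y2 :
    algebraic_series k2 -> algebraic_series a -> k2 != 0 -> a != 0 ->
    algebraic_critical_point Y1 -> algebraic_critical_point Y2 ->
    inv_value lambda m e Y1 != inv_value lambda m e Y2 ->
    B * (C 0 * mu ^+ 3 + C k2 * mu ^+ 2 * g + C k1 * mu * g ^+ 2)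
      + A * (C a * mu * g ^+ 2 + C 0 * g ^+ 3) = B * g ^+ 3 * M ->
  algebraic_gf (gen_fun (steps lambda m)).
Proof.
move=> ak2 aa k2n0 an0 cY1 cY2 I12 rel.
have [c [Mc relx]] := catalytic_relation char0 rel; rewrite Mc in rel.
have [v1 [H1 G1]] := critical_point_relation cY1.1 rel.
have [v2 [H2 G2]] := critical_point_relation cY2.1 rel.
rewrite f0 mul0r add0r addr0 in H1; rewrite f0 mulr0 mul0r add0r in G1.
rewrite f0 mul0r add0r addr0 in H2; rewrite f0 mulr0 mul0r add0r in G2.
have [ak1 ac] := critical_value_2 closed charE (algP ak2) (algP aa) (algI cY1) (algI cY2)
  (const_frac_neq0 e k2n0) (const_frac_neq0 e an0) I12 H1 G1 H2 G2.
apply: (algebraic_gf_of_relations char0 _ ak2 (Palg ak1) aa _ (Palg ac) _ rel relx).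
- exact: (algebraic_series_poly 0).
- exact: (algebraic_series_poly 0).
- by rewrite k2n0 orbT.
Qed.

(* Shifting the unknown by p makes the coefficient of the invariant
   homogeneous, as in the two models where this lemma is applied. *)
Lemma algebraic_gf_critical_3 (k3 k2 k1 a p : fps F) (M : R) Y1 Y2 Y3 :
    algebraic_series k3 -> algebraic_series a -> k3 != 0 -> a != 0 ->
    (algebraic_series (3 * k3 * p + k2) -> algebraic_series p) ->
    algebraic_critical_point Y1 -> algebraic_critical_point Y2 ->
    algebraic_critical_point Y3 ->
    inv_value lambda m e Y1 != inv_value lambda m e Y2 ->
    inv_value lambda m e Y1 != inv_value lambda m e Y3 ->
    inv_value lambda m e Y2 != inv_value lambda m e Y3 ->
    B * (C k3 * mu ^+ 3 + C k2 * mu ^+ 2 * g + C k1 * mu * g ^+ 2)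
      + A * (C a * mu * g ^+ 2 + C (- (a * p)) * g ^+ 3) = B * g ^+ 3 * M ->
  algebraic_gf (gen_fun (steps lambda m)).
Proof.
move=> ak3 aa k3n0 an0 shift cY1 cY2 cY3 I12 I13 I23 rel.
have [c [Mc relx]] := catalytic_relation char0 rel; rewrite Mc in rel.
have [v1 H1] := critical_point_relation cY1.1 rel.
have [v2 H2] := critical_point_relation cY2.1 rel.
have [v3 H3] := critical_point_relation cY3.1 rel.
(* The coefficients of Phi in the unknown v - p. The three critical values give [k2'], from which
   [shift] recovers p and then the original coefficients. *)
pose k2' := 3 * k3 * p + k2; pose k1' := 3 * k3 * p ^+ 2 + 2 * k2 * p + k1.
pose c' := c - (k3 * p ^+ 3 + k2 * p ^+ 2 + k1 * p).
have bE : f (- (a * p)) = - (f a * f p) by rewrite rmorphN rmorphM.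
have k2'E : f k2' = 3 * f k3 * f p + f k2 by rewrite rmorphD !rmorphM rmorph_nat.
have k1'E : f k1' = 3 * f k3 * f p ^+ 2 + 2 * f k2 * f p + f k1.
  by rewrite !(rmorphXn, rmorphD, rmorphM, rmorph_nat).
have c'E : f c' = f c - (f k3 * f p ^+ 3 + f k2 * f p ^+ 2 + f k1 * f p).
  by rewrite !(rmorphXn, rmorphB, rmorphD, rmorphM).
have H u I : (u, I) \in [:: (v1 - f p, inv_value lambda m e Y1);
      (v2 - f p, inv_value lambda m e Y2); (v3 - f p, inv_value lambda m e Y3)] ->
    f k3 * u ^+ 3 + f k2' * u ^+ 2 + f k1' * u + I * (f a * u) = f c' /\
    3 * f k3 * u ^+ 2 + 2 * f k2' * u + f k1' + I * f a = 0.
  rewrite k2'E k1'E c'E !inE => /or3P[] /eqP[-> ->].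
  - by case: H1; rewrite bE => <- <-; split; ring.
  - by case: H2; rewrite bE => <- <-; split; ring.
  - by case: H3; rewrite bE => <- <-; split; ring.
have [ak2' ak1' ac' _] := critical_value_3 closed charE (algP ak3) (algP aa)
  (algI cY1) (algI cY2) (algI cY3) (const_frac_neq0 e k3n0) (const_frac_neq0 e an0)
  I12 I13 I23 H.
have ap : algebraic_t e (f p) := algP (shift (Palg ak2')).
have a3 := algP ak3; have n3 := alg_nat closed 3; have n2 := alg_nat closed 2.
have ak2 : algebraic_t e (f k2).
  have -> : f k2 = f k2' - 3 * f k3 * f p by rewrite k2'E addrC addKr.
  exact: (alg_sub closed ak2' (alg_mul closed (alg_mul closed n3 a3) ap)).
have ak1 : algebraic_t e (f k1).
  have -> : f k1 = f k1' - (3 * f k3 * f p ^+ 2 + 2 * f k2 * f p).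
    by rewrite k1'E addrC addKr.
  apply: (alg_sub closed ak1'); apply: (alg_add closed).
    exact: (alg_mul closed (alg_mul closed n3 a3) (alg_exp closed 2 ap)).
  exact: (alg_mul closed (alg_mul closed n2 ak2) ap).
have ac : algebraic_t e (f c).
  have -> : f c = f c' + (f k3 * f p ^+ 3 + f k2 * f p ^+ 2 + f k1 * f p).
    by rewrite c'E subrK.
  apply: (alg_add closed ac'); apply: (alg_add closed); first apply: (alg_add closed).
  - exact: (alg_mul closed a3 (alg_exp closed 3 ap)).
  - exact: (alg_mul closed ak2 (alg_exp closed 2 ap)).
  - exact: (alg_mul closed ak1 ap).
have ab : algebraic_t e (f (- (a * p))).
  by rewrite bE; apply: (alg_opp closed); exact: (alg_mul closed (algP aa) ap).
apply: (algebraic_gf_of_relations char0 ak3 (Palg ak2) (Palg ak1) aa (Palg ab) (Palg ac)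
  _ rel relx).
by rewrite k3n0.
Qed.

End CriticalAssembly.

(** * The polynomial relation of each model *)

Section Relations.
Variables (R : comNzRingType) (l t z : R).

Local Notation tau := (1 + 3 * t).

Definition catalytic_value m q : R :=
  dec_num l m t z + dec_scale m t * dec_den m z * (ker l m t 0 z * q).

Definition catalytic_equation m q (k3 k2 k1 a b M : R) : Prop :=
  let mu := catalytic_value m q in let g := dec_den m z in let B := inv_den m z in
  B * (k3 * mu ^+ 3 + k2 * mu ^+ 2 * g + k1 * mu * g ^+ 2)
    + inv_num l m t z * (a * mu * g ^+ 2 + b * g ^+ 3) = B * g ^+ 3 * M.

(* In each relation the coefficients are such that the poles at y = 0 and y = - 1
   cancel; q0, q1 and qm are the first coefficients of the expansion of q at
   these points. *)
Lemma relation_kreweras q : exists M, catalytic_equation Kreweras q 0 t (- 1) 0 (- 1) M.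
Proof.
exists (2 * t ^+ 2 * q + t ^+ 3 * z ^+ 2 * q ^+ 2 - t * z * q + t * z).
by rewrite /catalytic_equation /catalytic_value /ker /=; ring.
Qed.

(** K(0,y) = t (1 + y) and [dec_num] vanish at y = -1, so m kills the pole of I there. At y = 0, t
    m^2 cancels the double pole of I m, and the linear term, with Q(0,0), the simple one. *)
Lemma relation_double_kreweras q q0 q1 : q = q0 + z * q1 -> exists M,
  catalytic_equation DoubleKreweras q 0 t (- (1 + 2 * t + t ^+ 2 * q0)) 1 0 M.
Proof.
(* Eliminating q0 makes q, q1 and z independent, and what remains is a polynomial identity. *)
move=> qE; have -> : q0 = q - z * q1 by rewrite qE addrK.
set c0 := 1 + _ + _.
exists ((1 + t * z * q) * (t * z + t + t ^+ 2 * ((2 + z) * q + q1) - c0)).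
by rewrite /catalytic_equation /catalytic_value /ker /c0 /=; ring.
Qed.

(** At y = -1, m has a simple pole and I a double one, whence the cubic; the simple pole that is
    left brings in Q(0,-1) through h. At y = 0 only I has a pole, cancelled by m - l0 because l0 =
    m(0). *)
Lemma relation_gessel q q0 q1 qm q2 : q = q0 + z * q1 -> q = qm + (1 + z) * q2 ->
  let l0 := 1 + t ^+ 2 * q0 in let h := 2 * qm - 4 in exists M,
  catalytic_equation Gessel q 1 (- (1 + l0)) (l0 - t ^+ 2 * h) 1 (- (1 * l0)) M.
Proof.
move=> q0E qmE; have -> : q0 = q - z * q1 by rewrite q0E addrK.
have -> : qm = q - (1 + z) * q2 by rewrite qmE addrK.
move=> l0 h.
exists (t ^+ 2 * (1 + z + 2 * z * q2 + t ^+ 2 * z * (1 + z) * q ^+ 2 - z * q)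
  * (t ^+ 2 * (1 + z) * (q + q1) - 1) - t ^+ 2 * h * l0).
by rewrite /catalytic_equation /catalytic_value /ker /l0 /h /=; ring.
Qed.

(** With v = 1 + y and g = 1 + t lambda, I = g^2/v^2 - g/v - t^2 v and m = g/v + t^2 v q: the same
    shape as for Kreweras. *)
Lemma relation_weighted_d q : exists M, catalytic_equation WeightedD q 0 1 (- 1) 0 (- 1) M.
Proof.
exists (2 * (1 + t * l) * t ^+ 2 * q + t ^+ 4 * (1 + z) ^+ 2 * q ^+ 2
  - t ^+ 2 * (1 + z) * q + t ^+ 2 * (1 + z)).
by rewrite /catalytic_equation /catalytic_value /ker /=; ring.
Qed.

(** K(0,y) = t y (1 + y) vanishes at both poles of m, so q does not enter the polar parts, and a
    single coefficient 1 + 4t cancels the simple poles at both points. *)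
Lemma relation_weighted_e q : exists M,
  catalytic_equation WeightedE q 0 1 (- (1 + 4 * t)) 0 (- 1) M.
Proof.
exists (t ^+ 2 * (z - 2) * (z + 1) + t ^+ 2 * q * (2 * dec_num l WeightedE t z
  + t ^+ 2 * z ^+ 2 * (1 + z) ^+ 2 * q - (1 + 4 * t) * z * (1 + z))).
by rewrite /catalytic_equation /catalytic_value /ker /=; ring.
Qed.

(** K(0,y) = t (1 + y)^2 and [dec_num] both vanish doubly at y = -1, which absorbs the double pole
    of I; at y = 0 the situation is that of double Kreweras. *)
Lemma relation_weighted_f q q0 q1 : q = q0 + z * q1 -> exists M,
  catalytic_equation WeightedF q 0 (- t) (- (4 * t * tau - t ^+ 2 - t ^+ 3 * q0)) 1 0 M.
Proof.
move=> qE; have -> : q0 = q - z * q1 by rewrite qE addrK.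
set h := 4 * _ * _ - _ - _.
exists ((t * z - tau + t ^+ 2 * z * q) * (t ^+ 2 * z ^+ 3 - t * z ^+ 2 - t * z
  + (t ^+ 2 + t * tau - tau ^+ 2) + t * tau * (6 + 4 * z + z ^+ 2) - t ^+ 3 * q1
  - t * (t + t ^+ 2 * q) * (4 + 6 * z + 4 * z ^+ 2 + z ^+ 3) - h * (2 + z))).
by rewrite /catalytic_equation /catalytic_value /ker /h /=; ring.
Qed.

(** Again m has a double zero at y = -1. At y = 0, I has a double pole and m a simple one, so I m is
    cancelled by t^2 m^3; the poles of order 2 and 1 that are left bring in q0 and then q1. *)
Lemma relation_weighted_g q q0 q1 q2 : q = q0 + z * (q1 + z * q2) ->
  let be := t + 6 * t ^+ 2 + 2 * t ^+ 3 * q0 in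
  let h := t ^+ 2 * (15 + 2 * t * q1 + 12 * (t * q0) + (t * q0) ^+ 2) - be * (4 + t * q0) + t in
  exists M, catalytic_equation WeightedG q (t ^+ 2) (- be) (- h) 1 0 M.
Proof.
move=> qE; have -> : q0 = q - z * (q1 + z * q2) by rewrite qE addrK.
move=> be h; pose p := 1 + t * z * q; pose w := 6 + 4 * z + z ^+ 2.
pose p0 := t * (q - z * (q1 + z * q2)); pose d := t * (q1 + z * q2).
pose u := (20 + 15 * z + 6 * z ^+ 2 + z ^+ 3) * p ^+ 2 + 30 * t * q + 6 * (t * q) ^+ 2
  + 15 * z * (t * q) ^+ 2 + 2 * t * q2 + 12 * d + d * (t * q + p0).
exists (p * (t ^+ 2 * u - be * (d + 4 * t * q + w * p) - h * (2 + z)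
  + (tau ^+ 2 - t * tau - t ^+ 2) + t * tau * z ^+ 2)).
rewrite /catalytic_equation /catalytic_value /ker /h /u /be /d /p0 /w /p /=; ring.
Qed.

End Relations.

(** * The critical points of each model *)

Section AlgebraicCriticalPoint.
Variables (F : fieldType) (char0 : [pchar F] =i pred0) (lambda : F) (m : model_name) (e : nat).
Local Notation E := {fraction fps F}.
Let T : fps F := fpsX F ^+ e.+1.
Let L : fps F := fpsC lambda.

Let critical_poly : {poly {poly F}} := critical_num m lambda%:P%:P ('X%:P) 'X.

Let critical_poly_neq0 : critical_poly != 0.
Proof.
suff [t [c [c0 tc]]] : exists t c, c != 0 /\ critical_num m lambda t 0 = c.
  apply: contra_neq c0 => p0; rewrite -tc.
  pose h : {rmorphism {poly {poly F}} -> F} := horner_eval t \o horner_eval 0.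
  have := rmorph_critical_num h m lambda%:P%:P 'X%:P 'X.
  rewrite -/critical_poly p0 rmorph0 /h /= /horner_eval !hornerE => e0.
  exact: esym e0.
have n2 : (2 : F) != 0 := nat_neq0_char0 char0 (isT : (0 < 2)%N).
rewrite /critical_num; case: m.
- by exists 1, (- 2); rewrite oppr_eq0; split; last by ring.
- by exists 1, 1; rewrite oner_neq0; split; last by ring.
- by exists 1, (- 1); rewrite oppr_eq0 oner_neq0; split; last by ring.
- by exists 0, (- 1); rewrite oppr_eq0 oner_neq0; split; last by ring.
- by exists 1, 2; split; last by ring.
- by exists 1, (2 * 2); rewrite mulf_neq0 //; split; last by ring.
- by exists 1, 2; split; last by ring.
Qed.

Lemma algebraic_of_critical Y : critical_num m L T Y = 0 -> algebraic_t e Y%:F.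
Proof.
move=> cY; apply/(algebraic_overP (@base_t_inj F e)); exists critical_poly => //.
have hl : base_t e lambda%:P = L%:F by exact: (congr1 (@tofrac _) (subst_tC e lambda)).
have ht : base_t e 'X = T%:F by exact: (congr1 (@tofrac _) (subst_tX F e)).
have -> : map_poly (base_t e) critical_poly = critical_num m (L%:F)%:P (T%:F)%:P 'X.
  rewrite -hl -ht -(map_polyC (base_t e)) -(map_polyC (base_t e)) -(map_polyX (base_t e)).
  exact: (rmorph_critical_num (map_poly (base_t e))).
have lE : horner_eval Y%:F (L%:F)%:P = L%:F := hornerC _ _.
have tE : horner_eval Y%:F (T%:F)%:P = T%:F := hornerC _ _.
have yE : horner_eval Y%:F 'X = Y%:F := hornerX _.
have congr_critical (u v w u' v' w' : E) : u = u' -> v = v' -> w = w' ->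
  critical_num m u v w = critical_num m u' v' w' by move=> -> -> ->.
apply/eqP; apply: etrans (rmorph_critical_num (horner_eval Y%:F) m (L%:F)%:P (T%:F)%:P 'X) _.
apply: etrans (congr_critical _ _ _ _ _ _ lE tE yE) _.
apply: etrans (esym (rmorph_critical_num (@tofrac (fps F)) m L T Y)) _.
rewrite cY; exact: rmorph0.
Qed.

Lemma inv_value_neq Y1 Y2 k d :
    Y1 != 0 -> 1 + Y1 != 0 -> Y2 != 0 -> 1 + Y2 != 0 -> fps_head d != 0 ->
    inv_num L m T Y1 * inv_den m Y2 - inv_num L m T Y2 * inv_den m Y1 = fpsX F ^+ k * d ->
  inv_value lambda m e Y1 != inv_value lambda m e Y2.
Proof.
move=> Y10 Y1N Y20 Y2N d0 eqd.
have B10 : inv_den m Y1 != 0 by exact: inv_den_neq0 (fun _ => Y10) Y1N.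
have B20 : inv_den m Y2 != 0 by exact: inv_den_neq0 (fun _ => Y20) Y2N.
rewrite /inv_value eqr_div ?tofrac_eq0 // -!tofracM tofrac_eq -subr_eq0 -/T -/L eqd.
rewrite mulf_eq0 negb_or expf_neq0 ?fpsX_neq0 //=.
by apply: contra_neq d0 => ->; exact: rmorph0.
Qed.

Lemma algebraic_critical_pointI Y : Y != 0 -> 1 + Y != 0 -> critical_num m L T Y = 0 ->
    wronskian_head m (fps_head Y) != 0 -> (unscaled m -> fps_head Y = 0) ->
  algebraic_critical_point lambda m e Y.
Proof.
by move=> Y0 YN cY w0 u0; split; [split | exact: algebraic_of_critical].
Qed.

End AlgebraicCriticalPoint.

Section Head.
Variable F : fieldType.
Implicit Types (a b : fps F).

Lemma fps_head1 : fps_head (1 : fps F) = 1. Proof. exact: rmorph1. Qed.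
Lemma fps_head_nat n : fps_head (n%:R : fps F) = n%:R. Proof. exact: rmorph_nat. Qed.
Lemma fps_headN a : fps_head (- a) = - fps_head a. Proof. exact: rmorphN. Qed.
Lemma fps_headD a b : fps_head (a + b) = fps_head a + fps_head b. Proof. exact: rmorphD. Qed.
Lemma fps_head_exp a n : fps_head (a ^+ n) = fps_head a ^+ n. Proof. exact: rmorphXn. Qed.

Definition fps_headE := (fps_headN, fps_headD, @fps_headM F, fps_head_exp, fps_head_nat,
  fps_head1, @fps_headX F, @fps_headC F).

Lemma fps_headXn k : fps_head (fpsX F ^+ k.+1) = 0.
Proof. by rewrite exprS fps_headM fps_headX mul0r. Qed.

Lemma head_neq0 a : fps_head a != 0 -> a != 0.
Proof. by apply: contra_neq => ->; exact: rmorph0. Qed.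

Lemma scaled_neq0 k a : fps_head a != 0 -> fpsX F ^+ k * a != 0.
Proof. by move=> a0; rewrite mulf_neq0 ?expf_neq0 ?fpsX_neq0 // head_neq0. Qed.

Lemma scaled_head k a : fps_head (fpsX F ^+ k.+1 * a) = 0.
Proof. by rewrite fps_headM fps_headXn mul0r. Qed.

Lemma scaled_neqN1 k a : 1 + fpsX F ^+ k.+1 * a != 0.
Proof.
apply: head_neq0; rewrite rmorphD rmorph1 /= scaled_head addr0; exact: oner_neq0.
Qed.

End Head.

(** A polynomial in three variables, encoded as an operation on all commutative rings compatible
    with morphisms: the same expression can be reduced at s = 0 in F[X] and evaluated in power
    series. *)
Definition natural (q : forall A : comNzRingType, A -> A -> A -> A) :=
  forall (A B : comNzRingType) (f : {rmorphism A -> B}) s u y,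
    f (q A s u y) = q B (f s) (f u) (f y).

(* The critical points are of the form s^i Z, or Z - 1; q s u Z is the critical
   polynomial after this substitution, divided by a power of s, and u stands for
   a constant. *)
Lemma hensel_natural (F : fieldType) (q : forall A : comNzRingType, A -> A -> A -> A)
    (p0 : {poly F}) (k c : F) :
    natural q -> q _ 0 k%:P 'X = p0 -> p0.[c] = 0 -> p0^`().[c] != 0 ->
  exists2 Z, q _ (fpsX F) (fpsC k) Z = 0 & fps_head Z = c.
Proof.
move=> natq; pose p : {poly fps F} := q _ (fpsX F)%:P (fpsC k)%:P 'X.
have hE (r : {poly fps F}) : fps_head r.[fpsC c] = (map_poly (@fps_head F) r).[c].
  by rewrite -{2}[c](@fps_headC F) horner_map.
have -> : q _ 0 k%:P 'X = map_poly (@fps_head F) p.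
  rewrite /p (natq _ _ (map_poly (@fps_head F))) /= !map_polyC map_polyX /=.
  by rewrite fps_headX fps_headC.
move=> <- pc dpc; have [||Z pZ hZ] := @hensel F p c; rewrite ?hE //.
  by rewrite -deriv_map.
exists Z => //; rewrite -pZ; apply: esym.
have congr_q (s u y s' u' y' : fps F) : s = s' -> u = u' -> y = y' -> q _ s u y = q _ s' u' y'.
  by move=> -> -> ->.
apply: etrans (natq _ _ (horner_eval Z) _ _ _) _.
exact: congr_q (hornerC _ _) (hornerC _ _) (hornerX _).
Qed.

Lemma rmorph_opsE (A B : comNzRingType) (f : {rmorphism A -> B}) :
  (forall n, f n%:R = n%:R) * {morph f : x y / x - y} * {morph f : x y / x + y}
  * (forall n, {morph f : x / x ^+ n}) * {morph f : x y / x * y} * (f 1 = 1).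
Proof.
by do !split; [exact: rmorph_nat | exact: rmorphB | exact: rmorphD | exact: rmorphXn
  | exact: rmorphM | exact: rmorph1].
Qed.

Section CriticalPointExistence.
Variables (F : fieldType) (char0 : [pchar F] =i pred0) (lambda : F).
Local Notation s := (fpsX F).
Local Notation crit m e := (algebraic_critical_point lambda m e).

Let two_neq0 : (2 : F) != 0 := nat_neq0_char0 char0 (isT : (0 < 2)%N).

Let sqr_eq1_neq0 (c : F) : c ^+ 2 = 1 -> c != 0.
Proof. by apply: contra_eq_neq => ->; rewrite expr0n eq_sym oner_eq0. Qed.

Let scaled_critical m e k Z : fps_head Z != 0 -> wronskian_head m (0 : F) != 0 ->
    critical_num m (fpsC lambda) (s ^+ e.+1) (s ^+ k.+1 * Z) = 0 ->
  crit m e (s ^+ k.+1 * Z).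
Proof.
move=> Z0 w0 cZ; apply: (algebraic_critical_pointI char0) => //.
- exact: scaled_neq0.
- exact: scaled_neqN1.
- by rewrite scaled_head.
- by rewrite scaled_head.
Qed.

(** For small t the dominant terms are y - 2t, so that Y is equivalent to 2t. *)
Lemma critical_kreweras : exists Y, crit Kreweras 0 Y.
Proof.
pose q (A : comNzRingType) (s u y : A) : A :=
  y - s ^+ 3 * y ^+ 3 - 2.
have pE : q {poly F} 0 0%:P 'X = 'X - 2%:P by rewrite /q; ring.
have natq : natural q by move=> A B f r u y; rewrite /q !(rmorph_opsE f).
have p0 : ('X - 2%:P : {poly F}).[2] = 0 by rewrite !hornerE /=; ring.
have p1 : ('X - 2%:P : {poly F})^`().[2] != 0.
  have -> : ('X - 2%:P : {poly F})^`().[2] = 1 by rewrite !derivE !hornerE /=; ring.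
  by rewrite oner_neq0.
have [Z pZ hZ] := hensel_natural natq pE p0 p1.
exists (s ^+ 1 * Z).
apply: scaled_critical; first by rewrite hZ.
  by rewrite /wronskian_head oppr_eq0 oner_neq0.
rewrite -(mulr0 s) -pZ /q /critical_num; ring.
Qed.

(** For small t the dominant terms are t - y^2, so that Y is equivalent to a square root of t,
    whence t = s^2. *)
Lemma critical_double_kreweras c : c ^+ 2 = 1 ->
  exists2 Z, fps_head Z = c & crit DoubleKreweras 1 (s ^+ 1 * Z).
Proof.
move=> c1; have c0 := sqr_eq1_neq0 c1.
pose q (A : comNzRingType) (s u y : A) : A :=
  s ^+ 4 * y ^+ 4 + 2 * s ^+ 3 * y ^+ 3 - y ^+ 2 + 2 * s * y + 1.
have pE : q {poly F} 0 0%:P 'X = 1 - 'X^2 by rewrite /q; ring.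
have natq : natural q by move=> A B f r u y; rewrite /q !(rmorph_opsE f).
have p0 : (1 - 'X^2 : {poly F}).[c] = 0 by rewrite !hornerE /=; ring: c1.
have p1 : (1 - 'X^2 : {poly F})^`().[c] != 0.
  have -> : (1 - 'X^2 : {poly F})^`().[c] = - (2 * c) by rewrite !derivE !hornerE /=; ring.
  by rewrite oppr_eq0 mulf_neq0.
have [Z pZ hZ] := hensel_natural natq pE p0 p1; exists Z => //.
apply: scaled_critical; first by rewrite hZ.
  by rewrite /wronskian_head oppr_eq0 oner_neq0.
rewrite -(mulr0 (s ^+ 2)) -pZ /q /critical_num; ring.
Qed.

(** The critical polynomial is 1 - y times a difference of squares; the points wanted solve y = c t
    (1 + y)^2. *)
Lemma critical_gessel c : c ^+ 2 = 1 ->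
  exists2 Z, fps_head Z = c & crit Gessel 0 (s ^+ 1 * Z).
Proof.
move=> c1; have c0 := sqr_eq1_neq0 c1.
pose q (A : comNzRingType) (s u y : A) : A :=
  y - u * (1 + s * y) ^+ 2.
have pE : q {poly F} 0 c%:P 'X = 'X - c%:P by rewrite /q; ring.
have natq : natural q by move=> A B f r u y; rewrite /q !(rmorph_opsE f).
have p0 : ('X - c%:P : {poly F}).[c] = 0 by rewrite !hornerE /=; ring.
have p1 : ('X - c%:P : {poly F})^`().[c] != 0.
  have -> : ('X - c%:P : {poly F})^`().[c] = 1 by rewrite !derivE !hornerE /=; ring.
  by rewrite oner_neq0.
have [Z pZ hZ] := hensel_natural natq pE p0 p1; exists Z => //.
have cc : fpsC c ^+ 2 = 1 by rewrite -rmorphXn c1; exact: rmorph1.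
apply: scaled_critical; first by rewrite hZ.
  by rewrite /wronskian_head oppr_eq0 oner_neq0.
move: pZ; rewrite /q /critical_num => /eqP; rewrite subr_eq0 => /eqP ZE.
(* Squaring removes c and gives the second factor of the critical polynomial. *)
have sq : Z ^+ 2 - ((1 + s * Z) ^+ 2) ^+ 2 = 0.
  move: ZE; set W := (1 + s * Z) ^+ 2 => ZE.
  by rewrite -[W ^+ 2]mul1r -cc -exprMn -ZE subrr.
by apply: etrans (mulr0 ((1 - s * Z) * s ^+ 2)); rewrite -sq; ring.
Qed.

Lemma critical_gessel1 : crit Gessel 0 1.
Proof.
apply: (algebraic_critical_pointI char0).
- exact: oner_neq0.
- by apply: head_neq0; rewrite !fps_headE.
- by rewrite /critical_num subrr mul0r.
- by rewrite /wronskian_head oppr_eq0 oner_neq0.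
- by [].
Qed.

(** At t = 0 the critical polynomial is (1 + y) - 2; the unknown Z is 1 + y. *)
Lemma critical_weighted_d : exists Y, crit WeightedD 0 Y.
Proof.
pose q (A : comNzRingType) (s u y : A) : A :=
  let gm := 1 + s * u in gm * y - 2 * gm ^+ 2 - s ^+ 2 * y ^+ 3.
have pE : q {poly F} 0 lambda%:P 'X = 'X - 2%:P by rewrite /q; ring.
have natq : natural q by move=> A B f r u y; rewrite /q !(rmorph_opsE f).
have p0 : ('X - 2%:P : {poly F}).[2] = 0 by rewrite !hornerE /=; ring.
have p1 : ('X - 2%:P : {poly F})^`().[2] != 0.
  have -> : ('X - 2%:P : {poly F})^`().[2] = 1 by rewrite !derivE !hornerE /=; ring.
  by rewrite oner_neq0.
have [Z pZ hZ] := hensel_natural natq pE p0 p1.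
exists (Z - 1); apply: (algebraic_critical_pointI char0).
- by apply: head_neq0; rewrite !fps_headE hZ (_ : 2 - 1 = 1) ?oner_neq0 //; ring.
- by apply: head_neq0; rewrite !fps_headE hZ subrKC.
- rewrite -pZ /q /critical_num; ring.
- by rewrite /wronskian_head oppr_eq0 oner_neq0.
- by [].
Qed.

(** At t = 0 the critical polynomial is y^3 - y^4. Its simple root 1 is the one to take:
    [wronskian_head] vanishes at 0. *)
Lemma critical_weighted_e : exists Y, crit WeightedE 0 Y.
Proof.
pose q (A : comNzRingType) (s u y : A) : A :=
  let tau := 1 + 3 * s in (s * tau) * (3 * y ^+ 5 + y ^+ 6)
  + (tau ^+ 2 - s * tau - s ^+ 2) * (y ^+ 3 - y ^+ 4)
  - (2 * s) * y ^+ 3 - s * (y + 3 * y ^+ 2) + (s ^+ 2) * (2 + 4 * y).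
have pE : q {poly F} 0 0%:P 'X = 'X^3 - 'X^4 by rewrite /q; ring.
have natq : natural q by move=> A B f r u y; rewrite /q !(rmorph_opsE f).
have p0 : ('X^3 - 'X^4 : {poly F}).[1] = 0 by rewrite !hornerE /=; ring.
have p1 : ('X^3 - 'X^4 : {poly F})^`().[1] != 0.
  have -> : ('X^3 - 'X^4 : {poly F})^`().[1] = - 1 by rewrite !derivE !hornerE /=; ring.
  by rewrite oppr_eq0 oner_neq0.
have [Z pZ hZ] := hensel_natural natq pE p0 p1.
exists Z; apply: (algebraic_critical_pointI char0).
- by apply: head_neq0; rewrite hZ oner_neq0.
- by apply: head_neq0; rewrite !fps_headE hZ.
- rewrite -pZ /q /critical_num; ring.
- by rewrite /wronskian_head hZ expr1n oppr_eq0 oner_neq0.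
- by [].
Qed.

Lemma critical_weighted_f c : c ^+ 2 = 1 ->
  exists2 Z, fps_head Z = c & crit WeightedF 1 (s ^+ 1 * Z).
Proof.
move=> c1; have c0 := sqr_eq1_neq0 c1.
pose q (A : comNzRingType) (s u y : A) : A :=
  let tau := 1 + 3 * s ^+ 2 in let om := s ^+ 4 + s ^+ 2 * tau - tau ^+ 2 in
  (s ^+ 7) * (4 * y ^+ 5 + (2 * s) * y ^+ 6)
  - (s ^+ 4) * (3 * y ^+ 4 + s * y ^+ 5) - (2 * s ^+ 3) * y ^+ 3
  + om * (y ^+ 2 - s * y ^+ 3) + tau * (1 + (3 * s) * y).
have pE : q {poly F} 0 0%:P 'X = 1 - 'X^2 by rewrite /q; ring.
have natq : natural q by move=> A B f r u y; rewrite /q !(rmorph_opsE f).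
have p0 : (1 - 'X^2 : {poly F}).[c] = 0 by rewrite !hornerE /=; ring: c1.
have p1 : (1 - 'X^2 : {poly F})^`().[c] != 0.
  have -> : (1 - 'X^2 : {poly F})^`().[c] = - (2 * c) by rewrite !derivE !hornerE /=; ring.
  by rewrite oppr_eq0 mulf_neq0.
have [Z pZ hZ] := hensel_natural natq pE p0 p1; exists Z => //.
apply: scaled_critical; first by rewrite hZ.
  by rewrite /wronskian_head expr0n subr0 oner_neq0.
rewrite -(mulr0 (s ^+ 2)) -pZ /q /critical_num; ring.
Qed.

(** The dominant terms y^3 - t y + 2 t^2 have a Newton polygon with two edges: one gives Y close to
    s or -s, with t = s^2, and the other gives the third critical point, close to 2t. *)
Lemma critical_weighted_g c : c ^+ 2 = 1 ->
  exists2 Z, fps_head Z = c & crit WeightedG 1 (s ^+ 1 * Z).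
Proof.
move=> c1; have c0 := sqr_eq1_neq0 c1.
pose q (A : comNzRingType) (s u y : A) : A :=
  let tau := 1 + 3 * s ^+ 2 in let om := tau ^+ 2 - s ^+ 2 * tau - s ^+ 4 in
  tau * ((3 * s ^+ 4) * y ^+ 5 + (s ^+ 5) * y ^+ 6)
  + om * (y ^+ 3 - s * y ^+ 4) - (2 * s ^+ 2) * y ^+ 3 - (y + (3 * s) * y ^+ 2)
  + (2 * s) + (4 * s ^+ 2) * y.
have pE : q {poly F} 0 0%:P 'X = 'X^3 - 'X by rewrite /q; ring.
have natq : natural q by move=> A B f r u y; rewrite /q !(rmorph_opsE f).
have p0 : ('X^3 - 'X : {poly F}).[c] = 0 by rewrite !hornerE /=; ring: c1.
have p1 : ('X^3 - 'X : {poly F})^`().[c] != 0.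
  have -> : ('X^3 - 'X : {poly F})^`().[c] = 2 by rewrite !derivE !hornerE /=; ring: c1.
  by rewrite two_neq0.
have [Z pZ hZ] := hensel_natural natq pE p0 p1; exists Z => //.
apply: scaled_critical; first by rewrite hZ.
  by rewrite /wronskian_head expr0n sub0r oppr_eq0 oner_neq0.
rewrite -(mulr0 (s ^+ 3)) -pZ /q /critical_num; ring.
Qed.

Lemma critical_weighted_g2 : exists2 Z, fps_head Z = 2 & crit WeightedG 1 (s ^+ 2 * Z).
Proof.
pose q (A : comNzRingType) (s u y : A) : A :=
  let tau := 1 + 3 * s ^+ 2 in let om := tau ^+ 2 - s ^+ 2 * tau - s ^+ 4 in
  tau * ((3 * s ^+ 8) * y ^+ 5 + (s ^+ 10) * y ^+ 6)
  + om * ((s ^+ 2) * y ^+ 3 - (s ^+ 4) * y ^+ 4) - (2 * s ^+ 4) * y ^+ 3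
  - (y + (3 * s ^+ 2) * y ^+ 2) + 2 + (4 * s ^+ 2) * y.
have pE : q {poly F} 0 0%:P 'X = 2%:P - 'X by rewrite /q; ring.
have natq : natural q by move=> A B f r u y; rewrite /q !(rmorph_opsE f).
have p0 : (2%:P - 'X : {poly F}).[2] = 0 by rewrite !hornerE /=; ring.
have p1 : (2%:P - 'X : {poly F})^`().[2] != 0.
  have -> : (2%:P - 'X : {poly F})^`().[2] = - 1 by rewrite !derivE !hornerE /=; ring.
  by rewrite oppr_eq0 oner_neq0.
have [Z pZ hZ] := hensel_natural natq pE p0 p1; exists Z => //.
apply: scaled_critical; first by rewrite hZ.
  by rewrite /wronskian_head expr0n sub0r oppr_eq0 oner_neq0.
rewrite -(mulr0 (s ^+ 4)) -pZ /q /critical_num; ring.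
Qed.

End CriticalPointExistence.

(** * The critical values are distinct *)

Section Distinctness.
Variables (F : fieldType) (char0 : [pchar F] =i pred0) (lambda : F).
Local Notation s := (fpsX F).
Local Notation crit m e := (algebraic_critical_point lambda m e).
Local Notation inv_value := (inv_value lambda).

Let two_neq0 : (2 : F) != 0 := nat_neq0_char0 char0 (isT : (0 < 2)%N).
Let four_neq0 : (4 : F) != 0 := nat_neq0_char0 char0 (isT : (0 < 4)%N).

Lemma inv_value_neq_crit m e Y1 Y2 k d : crit m e Y1 -> crit m e Y2 -> fps_head d != 0 ->
    inv_num (fpsC lambda) m (s ^+ e.+1) Y1 * inv_den m Y2
      - inv_num (fpsC lambda) m (s ^+ e.+1) Y2 * inv_den m Y1 = s ^+ k * d ->
  inv_value m e Y1 != inv_value m e Y2.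
Proof.
by move=> [[Y10 Y1N _ _ _] _] [[Y20 Y2N _ _ _] _]; exact: inv_value_neq.
Qed.

(** The terms of order s^2 of the cross-multiplied difference cancel. Replacing I by I - 1, of
    numerator t y^3 - y^2 - t, which is divisible by s^2, exhibits the factor s^3. *)
Lemma inv_value_neq_double_kreweras Z1 Z2 : fps_head Z1 = 1 -> fps_head Z2 = - 1 ->
    crit DoubleKreweras 1 (s ^+ 1 * Z1) -> crit DoubleKreweras 1 (s ^+ 1 * Z2) ->
  inv_value DoubleKreweras 1 (s ^+ 1 * Z1) != inv_value DoubleKreweras 1 (s ^+ 1 * Z2).
Proof.
move=> h1 h2 c1 c2; apply: (inv_value_neq_crit (k := 3)
  (d := (s ^+ 3 * Z1 ^+ 3 - 1 - Z1 ^+ 2) * (Z2 * (1 + s * Z2))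
      - (s ^+ 3 * Z2 ^+ 3 - 1 - Z2 ^+ 2) * (Z1 * (1 + s * Z1))) c1 c2).
  by rewrite !fps_headE h1 h2 (_ : _ - _ = 4) //; ring.
by rewrite /inv_num /inv_den; ring.
Qed.

Lemma inv_value_neq_weighted_f Z1 Z2 : fps_head Z1 = 1 -> fps_head Z2 = - 1 ->
    crit WeightedF 1 (s ^+ 1 * Z1) -> crit WeightedF 1 (s ^+ 1 * Z2) ->
  inv_value WeightedF 1 (s ^+ 1 * Z1) != inv_value WeightedF 1 (s ^+ 1 * Z2).
Proof.
pose tau := 1 + 3 * s ^+ 2.
pose a Z := s ^+ 7 * Z ^+ 5 - s ^+ 4 * Z ^+ 4 - s ^+ 3 * Z ^+ 3
  + (s ^+ 4 + s ^+ 2 * tau - tau ^+ 2) * Z ^+ 2 - tau.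
move=> h1 h2 c1 c2; apply: (inv_value_neq_crit (k := 3)
  (d := a Z1 * (Z2 * (1 + s * Z2) ^+ 2) - a Z2 * (Z1 * (1 + s * Z1) ^+ 2)) c1 c2).
  by rewrite /a /tau !fps_headE h1 h2 (_ : _ - _ = 4) //; ring.
by rewrite /a /tau /inv_num /inv_den; ring.
Qed.

Lemma inv_value_neq_gessel Z1 Z2 : fps_head Z1 = 1 -> fps_head Z2 = - 1 ->
    crit Gessel 0 (s ^+ 1 * Z1) -> crit Gessel 0 (s ^+ 1 * Z2) ->
  inv_value Gessel 0 (s ^+ 1 * Z1) != inv_value Gessel 0 (s ^+ 1 * Z2).
Proof.
pose a Z := (s * Z - 1) ^+ 2 * (1 + s * Z) ^+ 2 + Z ^+ 2.
move=> h1 h2 c1 c2; apply: (inv_value_neq_crit (k := 3)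
  (d := a Z1 * (Z2 * (1 + s * Z2) ^+ 2) - a Z2 * (Z1 * (1 + s * Z1) ^+ 2)) c1 c2).
  by rewrite /a !fps_headE h1 h2 (_ : _ - _ = - 4) ?oppr_eq0 //; ring.
by rewrite /a /inv_num /inv_den; ring.
Qed.

(** I(1) = 1/4, while I tends to 0 at the other point. *)
Lemma inv_value_neq_gessel1 Z : fps_head Z != 0 ->
    crit Gessel 0 1 -> crit Gessel 0 (s ^+ 1 * Z) ->
  inv_value Gessel 0 1 != inv_value Gessel 0 (s ^+ 1 * Z).
Proof.
move=> h0 c1 c2; apply: (inv_value_neq_crit (k := 1)
  (d := Z * (1 + s * Z) ^+ 2
     - 4 * s * ((s * Z - 1) ^+ 2 * (1 + s * Z) ^+ 2 + Z ^+ 2)) c1 c2).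
  by rewrite !fps_headE (_ : _ - _ = fps_head Z) //; ring.
by rewrite /inv_num /inv_den; ring.
Qed.

Lemma inv_value_neq_weighted_g Z1 Z2 : fps_head Z1 = 1 -> fps_head Z2 = - 1 ->
    crit WeightedG 1 (s ^+ 1 * Z1) -> crit WeightedG 1 (s ^+ 1 * Z2) ->
  inv_value WeightedG 1 (s ^+ 1 * Z1) != inv_value WeightedG 1 (s ^+ 1 * Z2).
Proof.
pose tau := 1 + 3 * s ^+ 2.
pose a Z := s ^+ 4 * tau * Z ^+ 5 + (tau ^+ 2 - s ^+ 2 * tau - s ^+ 4) * Z ^+ 3
  + s * Z ^+ 2 + Z - s.
move=> h1 h2 c1 c2; apply: (inv_value_neq_crit (k := 5)
  (d := a Z1 * (Z2 ^+ 2 * (1 + s * Z2) ^+ 2) - a Z2 * (Z1 ^+ 2 * (1 + s * Z1) ^+ 2)) c1 c2).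
  by rewrite /a /tau !fps_headE h1 h2 (_ : _ - _ = 4) //; ring.
by rewrite /a /tau /inv_num /inv_den; ring.
Qed.

(** I tends to 1/4 at the critical point close to 2t and to 0 at the other one. *)
Lemma inv_value_neq_weighted_g2 W Z : fps_head W = 2 -> fps_head Z != 0 ->
    crit WeightedG 1 (s ^+ 2 * W) -> crit WeightedG 1 (s ^+ 1 * Z) ->
  inv_value WeightedG 1 (s ^+ 2 * W) != inv_value WeightedG 1 (s ^+ 1 * Z).
Proof.
pose tau := 1 + 3 * s ^+ 2; pose om := tau ^+ 2 - s ^+ 2 * tau - s ^+ 4.
pose a := s ^+ 8 * tau * W ^+ 5 + om * s ^+ 2 * W ^+ 3 + s ^+ 2 * W ^+ 2 + W - 1.
pose b := s ^+ 4 * tau * Z ^+ 5 + om * Z ^+ 3 + s * Z ^+ 2 + Z - s.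
move=> h1 h0 c1 c2; apply: (inv_value_neq_crit (k := 6)
  (d := a * (Z ^+ 2 * (1 + s * Z) ^+ 2) - s * b * (W ^+ 2 * (1 + s ^+ 2 * W) ^+ 2)) c1 c2).
  by rewrite /a /b /om /tau !fps_headE h1 (_ : _ - _ = fps_head Z ^+ 2) ?expf_neq0 //; ring.
by rewrite /a /b /om /tau /inv_num /inv_den; ring.
Qed.

End Distinctness.

(** * Algebraicity of the generating functions *)

Section Algebraicity.
Variables (F : fieldType) (char0 : [pchar F] =i pred0) (lambda : F).
Local Notation R := (fps {poly F}).
Local Notation C := (@const_ser F).
Local Notation gf m := (gen_fun (steps lambda m)).

Let t : R := fpsX _.
Let z : R := var F.
Let l : R := const_ser (fpsC lambda).
Let s : fps F := fpsX F.

Lemma var_decomposition b (u : R) :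
  exists v, u = C (at_var b u) + (z - C (fpsC b)) * v.
Proof.
have [|v uE] := @at_var_factor F b (u - C (at_var b u)).
  have e : at_var b (u - C (at_var b u)) = at_var b u - at_var b (C (at_var b u)).
    exact: rmorphB.
  by rewrite e at_var_const subrr.
by exists v; rewrite -uE subrKC.
Qed.

Lemma var_decomposition0 (u : R) : exists v, u = C (at_var 0 u) + z * v.
Proof. by have [v uE] := var_decomposition 0 u; exists v; rewrite {1}uE const_ser0 subr0. Qed.

Lemma var_decompositionN1 (u : R) : exists v, u = C (at_var (- 1) u) + (1 + z) * v.
Proof.
have [v uE] := var_decomposition (- 1) u; exists v.
by rewrite {1}uE const_serN1 opprK [z + 1]addrC.
Qed.

Let Ct : C s = t. Proof. exact: fps_mapX. Qed.
Let C0 : C 0 = 0. Proof. exact: rmorph0. Qed.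
Let C1 : C 1 = 1. Proof. exact: rmorph1. Qed.
Let CN u : C (- u) = - C u. Proof. exact: rmorphN. Qed.
Let CD u v : C (u + v) = C u + C v. Proof. exact: rmorphD. Qed.
Let CM u v : C (u * v) = C u * C v. Proof. exact: rmorphM. Qed.
Let CX u n : C (u ^+ n) = C u ^+ n. Proof. exact: rmorphXn. Qed.
Let Cn n : C n%:R = n%:R. Proof. exact: rmorph_nat. Qed.
Let CE := (C0, C1, Ct, CN, CX, Cn, CD, CM).

Let alg0 : algebraic_series (0 : fps F). Proof. exact: (algebraic_series_poly 0). Qed.
Let alg1 : algebraic_series (1 : fps F). Proof. exact: (algebraic_series_poly 1). Qed.
Let algt : algebraic_series s. Proof. exact: (algebraic_series_poly 'X). Qed.

Let clos := @algebraic_t_closed F 0.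

Let alg_series_opp (u : fps F) : algebraic_series u -> algebraic_series (- u).
Proof.
move=> /(algebraic_seriesP 0) au; apply/(algebraic_seriesP 0).
rewrite rmorphN; exact: (alg_opp clos).
Qed.

Let sqN1 : (- 1 : F) ^+ 2 = 1. Proof. by rewrite sqrrN expr1n. Qed.
Let algebraic_series_half (u : fps F) :
  algebraic_series (2 * u - 1) -> algebraic_series u.
Proof.
move=> /(algebraic_seriesP 0) au; apply/(algebraic_seriesP 0).
have fE : const_frac 0 (2 * u - 1) = 2 * const_frac 0 u - 1.
  by rewrite rmorphB rmorphM rmorph_nat rmorph1.
rewrite fE in au.
have uE : const_frac 0 u = (2 * const_frac 0 u - 1 + 1) / 2.
  by rewrite subrK mulrAC mulfV ?mul1r // nat_frac_neq0.
have := alg_div clos (alg_add clos au (alg_nat clos 1)) (alg_nat clos 2).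
by rewrite -uE.
Qed.

Let algN1 : algebraic_series (- 1 : fps F) := alg_series_opp alg1.
Let s_neq0 : s != 0 := fpsX_neq0 F.
Let one_neq0 : (1 : fps F) != 0 := oner_neq0 _.

Lemma algebraic_kreweras : algebraic_gf (gf Kreweras).
Proof.
have [Y cY] := critical_kreweras char0 lambda.
have [M rel] := relation_kreweras l t z (series_y lambda Kreweras).
apply: (algebraic_gf_critical_1 (k2 := s) (k1 := - 1) (b := - 1) char0 algt algN1 algN1
  s_neq0 cY (M := M)).
rewrite !CE; exact: rel.
Qed.

Lemma algebraic_weighted_d : algebraic_gf (gf WeightedD).
Proof.
have [Y cY] := critical_weighted_d char0 lambda.
have [M rel] := relation_weighted_d l t z (series_y lambda WeightedD).
apply: (algebraic_gf_critical_1 (k2 := 1) (k1 := - 1) (b := - 1) char0 alg1 algN1 algN1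
  one_neq0 cY (M := M)).
rewrite !CE; exact: rel.
Qed.

Lemma algebraic_weighted_e : algebraic_gf (gf WeightedE).
Proof.
have [Y cY] := critical_weighted_e char0 lambda.
have [M rel] := relation_weighted_e l t z (series_y lambda WeightedE).
have ak : algebraic_series (- (1 + 4 * s)).
  have -> : - (1 + 4 * s) = fps_of_poly (- (1 + 4 * 'X)).
    by rewrite rmorphN rmorphD rmorphM rmorph_nat rmorph1.
  exact: algebraic_series_poly.
apply: (algebraic_gf_critical_1 (k2 := 1) (k1 := - (1 + 4 * s)) (b := - 1) char0 alg1 ak algN1
  one_neq0 cY (M := M)).
rewrite !CE; exact: rel.
Qed.

Lemma algebraic_double_kreweras : algebraic_gf (gf DoubleKreweras).
Proof.
have [Z1 h1 c1] := critical_double_kreweras char0 lambda (expr1n F 2).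
have [Z2 h2 c2] := critical_double_kreweras char0 lambda sqN1.
have [q1 qE] := var_decomposition0 (series_y lambda DoubleKreweras).
have [M rel] := relation_double_kreweras l t qE.
pose k := - (1 + 2 * s + s ^+ 2 * at_var 0 (series_y lambda DoubleKreweras)).
apply: (algebraic_gf_critical_2 (k2 := s) (k1 := k) (a := 1) char0 algt alg1 s_neq0 one_neq0 c1 c2
  _ (M := M)).
  exact: inv_value_neq_double_kreweras h1 h2 c1 c2.
rewrite /k !CE; exact: rel.
Qed.

Lemma algebraic_weighted_f : algebraic_gf (gf WeightedF).
Proof.
have [Z1 h1 c1] := critical_weighted_f char0 lambda (expr1n F 2).
have [Z2 h2 c2] := critical_weighted_f char0 lambda sqN1.
have [q1 qE] := var_decomposition0 (series_y lambda WeightedF).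
have [M rel] := relation_weighted_f l t qE.
pose k := - (4 * s * (1 + 3 * s) - s ^+ 2
  - s ^+ 3 * at_var 0 (series_y lambda WeightedF)).
have sN : - s != 0 by rewrite oppr_eq0.
apply: (algebraic_gf_critical_2 (k2 := - s) (k1 := k) (a := 1) char0 (alg_series_opp algt) alg1
  sN one_neq0 c1 c2 _ (M := M)).
  exact: inv_value_neq_weighted_f h1 h2 c1 c2.
rewrite /k !CE; exact: rel.
Qed.

Lemma algebraic_gessel : algebraic_gf (gf Gessel).
Proof.
have [Z1 h1 c1] := critical_gessel char0 lambda (expr1n F 2).
have [Z2 h2 c2] := critical_gessel char0 lambda sqN1.
have c0 := critical_gessel1 char0 lambda.
have [q1 qE] := var_decomposition0 (series_y lambda Gessel).
have [q2 qE'] := var_decompositionN1 (series_y lambda Gessel).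
have [M rel] := relation_gessel l t qE qE'.
pose l0 := 1 + s ^+ 2 * at_var 0 (series_y lambda Gessel).
pose h := 2 * at_var (- 1) (series_y lambda Gessel) - 4.
(* Since p = l0 and k2 = -(1 + l0), the shifted quadratic coefficient is 2 l0 - 1, and l0 can be
   recovered from it. *)
have shift : algebraic_series (3 * 1 * l0 + - (1 + l0)) -> algebraic_series l0.
  have -> : 3 * 1 * l0 + - (1 + l0) = 2 * l0 - 1 by ring.
  exact: algebraic_series_half.
have n1 : fps_head Z1 != 0 by rewrite h1 oner_neq0.
have n2 : fps_head Z2 != 0 by rewrite h2 oppr_eq0 oner_neq0.
apply: (algebraic_gf_critical_3 (k3 := 1) (k2 := - (1 + l0)) (k1 := l0 - s ^+ 2 * h) (a := 1)
  (p := l0) char0 alg1 alg1 one_neq0 one_neq0 shift c0 c1 c2 _ _ _ (M := M)).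
- exact: inv_value_neq_gessel1 n1 c0 c1.
- exact: inv_value_neq_gessel1 n2 c0 c2.
- exact: inv_value_neq_gessel h1 h2 c1 c2.
- rewrite /h /l0 !CE; exact: rel.
Qed.

Lemma algebraic_weighted_g : algebraic_gf (gf WeightedG).
Proof.
have [Z1 h1 c1] := critical_weighted_g char0 lambda (expr1n F 2).
have [Z2 h2 c2] := critical_weighted_g char0 lambda sqN1.
have [W h0 c0] := critical_weighted_g2 char0 lambda.
have [q1 qE] := var_decomposition0 (series_y lambda WeightedG).
have [q2 q1E] := var_decomposition0 q1.
have qE2 : series_y lambda WeightedG
    = C (at_var 0 (series_y lambda WeightedG)) + z * (C (at_var 0 q1) + z * q2).
  by rewrite -q1E.
have [M rel] := relation_weighted_g l t qE2.
pose q0 := at_var 0 (series_y lambda WeightedG); pose be := s + 6 * s ^+ 2 + 2 * s ^+ 3 * q0.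
pose h := s ^+ 2 * (15 + 2 * s * at_var 0 q1 + 12 * (s * q0) + (s * q0) ^+ 2)
  - be * (4 + s * q0) + s.
have n1 : fps_head Z1 != 0 by rewrite h1 oner_neq0.
have n2 : fps_head Z2 != 0 by rewrite h2 oppr_eq0 oner_neq0.
have as2 : algebraic_series (s ^+ 2).
  rewrite -(rmorphXn (@fps_of_poly F)); exact: algebraic_series_poly.
have s2 : s ^+ 2 != 0 by rewrite expf_neq0.
apply: (algebraic_gf_critical_3 (k3 := s ^+ 2) (k2 := - be) (k1 := - h) (a := 1)
  (p := 0) char0 as2 alg1 s2 one_neq0 (fun _ => alg0) c0 c1 c2 _ _ _ (M := M)).
- exact: inv_value_neq_weighted_g2 h0 n1 c0 c1.
- exact: inv_value_neq_weighted_g2 h0 n2 c0 c2.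
- exact: inv_value_neq_weighted_g h1 h2 c1 c2.
- rewrite /h /be mulr0 oppr0 !CE; exact: rel.
Qed.

Lemma steps_algebraic m : algebraic_gf (gf m).
Proof.
case: m.
- exact: algebraic_kreweras.
- exact: algebraic_double_kreweras.
- exact: algebraic_gessel.
- exact: algebraic_weighted_d.
- exact: algebraic_weighted_e.
- exact: algebraic_weighted_f.
- exact: algebraic_weighted_g.
Qed.

End Algebraicity.

Theorem proposition6 (F : fieldType) (char0 : [pchar F] =i pred0)
    (lambda : F) (m : model_name) :
  [/\ has_rational_invariants (steps lambda m),
      decoupled (steps lambda m),
      invariant_lemma (steps lambda m) (lemma_data_of m) &
      algebraic_gf (gen_fun (steps lambda m))].
Proof.
split.
- exact: steps_rational_invariants.
- exact: steps_decoupled.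
- exact: steps_invariant_lemma.
- exact: steps_algebraic.
Qed.
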